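(* Let $C:f=0$ be a 3-syzygy curve of degree $d\geq 3$ in $\mathbb{P}^2$ with exponents $(d_1,d_2,d_3)$, and let $$0\to S(-e)\to \oplus_{j=1}^3 S(1-d-d_j)\to S^3(1-d)\to S$$ be the minimal graded free resolution of the Milnor algebra $M(f)$. Then the following hold. (1) $e=d_1+d_2+d_3$. In particular $d_1+d_2\geq d$. (2) $ct(f)=d-2+d_1$. (3) $st(f)=reg(f)+1=d_1+d_2+d_3-2$. (4) $\tau(C)=(d-1)(d_1+d_2+d_3)-(d_1d_2+d_1d_3+d_2d_3)$.
   Context: Let $S=\mathbb{C}[x,y,z]$ with its standard grading, and let $C:f=0$ be a reduced curve of degree $d\geq 3$ in $\mathbb{P}^2$, with $f\in S$ homogeneous of degree $d$. Let $J_f=(f_x,f_y,f_z)$ and $M(f)=S/J_f$ (the Jacobian, or Milnor, algebra). Put $AR(f)=\{(a,b,c)\in S^3: af_x+bf_y+cf_z=0\}$, a graded $S$-module in which $(a,b,c)$ has degree $k$ when $a,b,c\in S_k$. The curve $C$ is an $m$-syzygy curve if a minimal set of homogeneous generators of $AR(f)$ has $m$ elements; the degrees $d_1\leq\dots\leq d_m$ of these generators are the exponents of $C$. The total Tjurina number $\tau(C)$ is the sum of the Tjurina numbers of the singular points of $C$; it equals $\dim M(f)_k$ for all large $k$. The stability threshold is $st(f)=\min\{q:\dim M(f)_k=\tau(C)\text{ for all }k\geq q\}$. The coincidence threshold is $ct(f)=\max\{q:\dim M(f)_k=\dim M(f_s)_k\text{ for all }k\leq q\}$, where $f_s\in S$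 is any homogeneous polynomial of degree $d$ defining a smooth curve. Finally $reg(f)$ is the Castelnuovo-Mumford regularity of the graded $S$-module $M(f)$.
   Formalization: Part (2), ct(f)=d-2+d_1, is stated only for singular C: for a smooth C (a 3-syzygy curve with exponents (d-1,d-1,d-1)) the maximum defining ct(f) does not exist; parts (1), (3) and (4) cover smooth curves too. *)

(* Defs.v *)
From mathcomp Require Export all_boot all_order all_algebra.
From mathcomp Require Export reals complex.
From mathcomp Require Export mpoly.

Set Implicit Arguments.
Unset Strict Implicit.
Unset Printing Implicit Defensive.

Import GRing.Theory.
Local Open Scope ring_scope.

(* n is the dimension over K of V / (V :&: W), for K-subspaces V and W of the
   K-algebra iota : K -> A. *)
Definition quot_dim (K : fieldType) (A : comNzRingType) (iota : K -> A)
    (V W : A -> Prop) (n : nat) : Prop :=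
  exists2 b : 'I_n -> A, (forall i, V (b i)) &
    forall v, V v ->
      exists! c : {ffun 'I_n -> K}, W (v - \sum_(i < n) iota (c i) * b i).

(* Homogeneous of integer degree z; only 0 is homogeneous of negative degree. *)
Definition homogz (K : fieldType) (z : int) (p : {mpoly K[3]}) : Prop :=
  match z with
  | Posz k => p \is k.-homog
  | Negz _ => p = 0
  end.

Definition squarefree (K : fieldType) (f : {mpoly K[3]}) : Prop :=
  forall g h : {mpoly K[3]}, f = g ^+ 2 * h -> g \is a GRing.unit.

Definition jacobian_ideal (K : fieldType) (f p : {mpoly K[3]}) : Prop :=
  exists a : 'I_3 -> {mpoly K[3]}, p = \sum_(i < 3) a i * f^`M(i).

Definition milnor_dim (K : fieldType) (f : {mpoly K[3]}) (k n : nat) : Prop :=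
  quot_dim (@mpolyC 3 K) (fun p => p \is k.-homog) (jacobian_ideal f) n.

Section Syzygies.
Variable K : fieldType.
Local Notation S := {mpoly K[3]}.

Definition AR (f : S) (r : 'rV[S]_3) : Prop :=
  \sum_(i < 3) r 0 i * f^`M(i) = 0.

(* The rows of rho form a minimal set of homogeneous generators of AR(f), the
   j-th one being homogeneous of degree ds`_j. *)
Definition min_generators (f : S) (ds : seq nat)
    (rho : 'M[S]_(size ds, 3)) : Prop :=
  [/\ forall (j : 'I_(size ds)) i, rho j i \is (nth 0%N ds j).-homog,
      forall r, AR f r <-> exists a, r = a *m rho
    & forall j, ~ exists2 a : 'rV[S]_(size ds), a 0 j = 0 & row j rho = a *m rho].

(* f = 0 is a (size ds)-syzygy curve with exponents ds. *)
Definition syzygy_curve (f : S) (ds : seq nat) : Prop :=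
  sorted leq ds /\ exists rho, min_generators f (ds := ds) rho.

(* A table of shifts B encodes the graded free modules
     F_i = \oplus_j S(- B_(i,j)),  with F_i = 0 for i >= size B,
   whose elements are row vectors. *)
Definition rk (B : seq (seq int)) (i : nat) : nat := size (nth [::] B i).
Definition shift (B : seq (seq int)) (i j : nat) : int := nth 0 (nth [::] B i) j.

(* eps : F_0 -> S induces the augmentation F_0 -> S / J, and the maps
   phi i : F_(i+1) -> F_i act by right multiplication. *)
Definition min_free_resolution (J : S -> Prop) (B : seq (seq int))
    (eps : 'cV[S]_(rk B 0)) (phi : forall i, 'M[S]_(rk B i.+1, rk B i)) : Prop :=
  [/\ (forall j : 'I_(rk B 0), homogz (shift B 0 j) (eps j 0)) /\
      (forall i (j : 'I_(rk B i.+1)) (k : 'I_(rk B i)), homogz (shift B i.+1 j - shift B i k) (phi i j k)),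
      forall p : S, exists u : 'rV[S]_(rk B 0), J (p - (u *m eps) 0 0),
      forall u : 'rV[S]_(rk B 0), J ((u *m eps) 0 0) <-> exists w, u = w *m phi 0%N,
      forall i (u : 'rV[S]_(rk B i.+1)),
        u *m phi i = 0 <-> exists w, u = w *m phi i.+1
    & forall i j k, (phi i j k)@_0%MM = 0].

Definition has_min_free_resolution (J : S -> Prop) (B : seq (seq int)) : Prop :=
  exists eps phi, @min_free_resolution J B eps phi.

(* Castelnuovo-Mumford regularity of S / J, i.e., the maximum of B_(i,j) - i
   over the shifts of its minimal graded free resolution. *)
Definition is_regularity (J : S -> Prop) (r : int) : Prop :=
  exists2 B, has_min_free_resolution J B &
    (forall i j, (j < rk B i)%N -> (shift B i j - i%:Z <= r)%R) /\
    (exists i j, (j < rk B i)%N /\ shift B i j - i%:Z = r).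

End Syzygies.

Section Singularities.
Variable K : fieldType.

(* Points of the projective plane are given by homogeneous coordinates. *)
Definition proj_eq (p q : {ffun 'I_3 -> K}) : Prop :=
  exists2 c : K, c != 0 & forall i, q i = c * p i.

Definition singular_point (f : {mpoly K[3]}) (p : {ffun 'I_3 -> K}) : Prop :=
  [/\ exists i, p i != 0, f.@[p] = 0 & forall i, (f^`M(i)).@[p] = 0].

Definition smooth_curve (f : {mpoly K[3]}) : Prop :=
  forall p, ~ singular_point f p.

(* Equation of the curve in the affine chart x_i = 1, where the remaining
   coordinates are numbered by lift i. *)
Definition dehomog (i : 'I_3) (f : {mpoly K[3]}) : {mpoly K[2]} :=
  f \mPo [tuple (if unlift i j is Some k then 'X_k else 1) | j < 3].

Definition chart_point (i : 'I_3) (p : {ffun 'I_3 -> K}) : {ffun 'I_2 -> K} :=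
  [ffun k => p (lift i k) / p i].

Definition local_ring (a : {ffun 'I_2 -> K}) (x : {fraction {mpoly K[2]}}) : Prop :=
  exists g h : {mpoly K[2]}, h.@[a] != 0 /\ x = tofrac g / tofrac h.

Definition tjurina_ideal (g : {mpoly K[2]}) (a : {ffun 'I_2 -> K})
    (x : {fraction {mpoly K[2]}}) : Prop :=
  exists u (v : 'I_2 -> {fraction {mpoly K[2]}}),
    [/\ local_ring a u, forall k, local_ring a (v k)
      & x = u * tofrac g + \sum_(k < 2) v k * tofrac g^`M(k)].

(* Dimension of O_a / (g, g_u, g_v), with O_a the local ring of the affine plane
   at a.  At an isolated singularity, the ideal contains a power of the maximal
   ideal, and analytic germs give the same algebra. *)
Definition tjurina_number (g : {mpoly K[2]}) (a : {ffun 'I_2 -> K}) (n : nat) : Prop :=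
  quot_dim (fun c => tofrac (c%:MP : {mpoly K[2]}))
    (local_ring a) (tjurina_ideal g a) n.

(* pt enumerates the singular points without repetition, and n k is the Tjurina
   number of f = 0 at pt k, computed in any chart containing that point. *)
Definition total_tjurina (f : {mpoly K[3]}) (t : nat) : Prop :=
  exists N (pt : 'I_N -> {ffun 'I_3 -> K}) (n : 'I_N -> nat),
    [/\ forall k, singular_point f (pt k),
        forall p, singular_point f p -> exists! k, proj_eq p (pt k),
        forall k i, pt k i != 0 ->
          tjurina_number (dehomog i f) (chart_point i (pt k)) (n k)
      & t = (\sum_(k < N) n k)%N].

End Singularities.

Definition is_least (P : nat -> Prop) (q : nat) : Prop :=
  P q /\ forall q', P q' -> (q <= q')%N.

Definition is_greatest (P : nat -> Prop) (q : nat) : Prop :=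
  P q /\ forall q', P q' -> (q' <= q)%N.

Definition stability_threshold (K : fieldType) (f : {mpoly K[3]}) (q : nat) : Prop :=
  exists2 t, total_tjurina f t &
    is_least (fun q => forall k, (q <= k)%N -> milnor_dim f k t) q.

(* The maximum does not exist when f = 0 is itself smooth. *)
Definition coincidence_threshold (K : fieldType) (d : nat) (f : {mpoly K[3]})
    (q : nat) : Prop :=
  forall fs : {mpoly K[3]}, fs \is d.-homog -> smooth_curve fs ->
    is_greatest (fun q => forall k, (k <= q)%N ->
      exists2 n, milnor_dim f k n & milnor_dim fs k n) q.

(* Main.v *)
(* The graded pieces of the resolution give the Hilbert function of M(f), an
   alternating sum of binomial coefficients, whose eventual value is affine in k
   with slope e - (d1 + d2 + d3).  It is bounded: eliminating a variable between f
   and a partial derivative (f is reduced) gives, for each pair of variables, a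
   nonzero binary form in J_f, and these forms leave boundedly many monomials in
   each degree.  So the slope is zero, and the constant value is tau by the
   formula (4).

   The eventual value is the total Tjurina number: the binary forms also give a
   Nullstellensatz and the finiteness of the singular locus.  For a singular point
   p let Q_p consist of the forms whose germ at p is in the Tjurina ideal.  A form
   not vanishing at p acts injectively, hence bijectively, on S_k / (Q_p)_k for
   large k, which identifies this space with the local Tjurina algebra in every
   chart; and M(f)_k is the product of these spaces by the Chinese remainder
   theorem.

   Exactness of the resolution at its last steps shows that no entry of the last
   map vanishes, so by minimality e > d - 1 + d_j for all j; this gives
   d <= d1 + d2, the regularity e - 3, and dim M(f)_(e-3) = tau + 1.  Finally,
   when f_s is smooth its partial derivatives contain powers of the variables and
   have no syzygies of degree less than d - 1, whereas tau > 0 forces d1 < d - 1. *)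

From HB Require Import structures.
Require Import Defs.
From mathcomp Require Import boolp ring zify.

Set Implicit Arguments.
Unset Strict Implicit.
Unset Printing Implicit Defensive.

Import Order.TTheory GRing.Theory Num.Theory.
Local Open Scope ring_scope.

(** * Dimensions of quotients *)

Section QuotientDimension.
Variable K : fieldType.

(** Ideals and their graded pieces are bare predicates, so dimensions are carried by coordinate
    maps, and the comparison of injective and surjective maps is reduced to ranks of matrices. The
    passage between forms and affine polynomials is always the same: an affine identity is lifted to
    forms of one common large degree, where it holds because a form that dehomogenizes to zero is
    zero. In this way denominators of germs, Bezout coefficients and repeated factors all become
    homogeneous. Zeros of ideals are constructed coordinate by coordinate: over an algebraically
    closed field binary forms split into linear forms, and adjoining one factor X_j - a X_l for each
    of two variables fixes a point. Boundedness of dim M(f)_k has to precede everything local, since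
    the local dimensions are obtained as limits of bounded increasing sequences. *)

Definition subspace (A : lmodType K) (V : A -> Prop) : Prop :=
  V 0 /\ forall a u v, V u -> V v -> V (a *: u + v).

(* The dimension of V / (V :&: W), read off a linear coordinate map on V; as in
   quot_dim, W need not be contained in V. *)
Definition qdim (A : lmodType K) (V W : A -> Prop) (n : nat) : Prop :=
  exists pi : A -> 'rV[K]_n,
    [/\ forall a u v, V u -> V v -> pi (a *: u + v) = a *: pi u + pi v,
        forall x, exists2 v, V v & pi v = x
      & forall v, V v -> (pi v = 0 <-> W v)].

Lemma subspaceD (A : lmodType K) (V : A -> Prop) u v :
  subspace V -> V u -> V v -> V (u + v).
Proof. by move=> [_ h] hu hv; rewrite -[u]scale1r; apply: h. Qed.

Lemma subspaceZ (A : lmodType K) (V : A -> Prop) a u :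
  subspace V -> V u -> V (a *: u).
Proof. by move=> [h0 h] hu; rewrite -[_ *: _]addr0; apply: h. Qed.

Lemma subspaceB (A : lmodType K) (V : A -> Prop) u v :
  subspace V -> V u -> V v -> V (u - v).
Proof. by move=> sV hu hv; rewrite -scaleN1r addrC; apply sV.2. Qed.

Lemma subspace_sum (A : lmodType K) (V : A -> Prop) (I : Type) (r : seq I) (P : pred I) F :
  subspace V -> (forall i, P i -> V (F i)) -> V (\sum_(i <- r | P i) F i).
Proof.
by move=> sV hF; apply: (big_ind V) => //; [exact: sV.1|move=> *; exact: subspaceD].
Qed.

Lemma subspace_lincomb (A : lmodType K) (V : A -> Prop) n (x : 'I_n -> K) (b : 'I_n -> A) :
  subspace V -> (forall i, V (b i)) -> V (\sum_i x i *: b i).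
Proof. by move=> sV hb; apply: subspace_sum => // i _; apply: subspaceZ. Qed.

Section Coordinates.
Variables (A : lmodType K) (V : A -> Prop) (n : nat) (pi : A -> 'rV[K]_n).
Hypothesis sV : subspace V.
Hypothesis linpi : forall a u v, V u -> V v -> pi (a *: u + v) = a *: pi u + pi v.

Lemma coord0 : pi 0 = 0.
Proof.
have := linpi 1 sV.1 sV.1; rewrite !scale1r addr0 => /eqP.
by rewrite -subr_eq subrr eq_sym => /eqP.
Qed.

Lemma coordZ a u : V u -> pi (a *: u) = a *: pi u.
Proof. by move=> hu; rewrite -[a *: u]addr0 linpi ?coord0 ?addr0 //; exact: sV.1. Qed.

Lemma coordB u v : V u -> V v -> pi (u - v) = pi u - pi v.
Proof. by move=> hu hv; rewrite addrC -scaleN1r linpi // scaleN1r addrC. Qed.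

Lemma coord_sum (I : Type) (r : seq I) (P : pred I) F :
  (forall i, P i -> V (F i)) -> pi (\sum_(i <- r | P i) F i) = \sum_(i <- r | P i) pi (F i).
Proof.
move=> hF; elim: r => [|i r IH]; first by rewrite !big_nil coord0.
rewrite !big_cons; case: ifP => // Pi.
rewrite -IH -[F i]scale1r linpi ?scale1r //; first exact: hF.
exact: subspace_sum.
Qed.

Lemma coord_lincomb m (x : 'I_m -> K) (b : 'I_m -> A) : (forall i, V (b i)) ->
  pi (\sum_i x i *: b i) = \sum_i x i *: pi (b i).
Proof.
move=> hb; rewrite coord_sum; last by move=> i _; apply: subspaceZ.
by apply: eq_bigr => i _; rewrite coordZ.
Qed.

Lemma coord_section : (forall x, exists2 v, V v & pi v = x) ->
  exists2 b : 'I_n -> A, (forall i, V (b i)) &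
    forall x : 'rV[K]_n, pi (\sum_i x 0 i *: b i) = x.
Proof.
move=> onto; have /choice [b hb] : forall i : 'I_n, exists v, V v /\ pi v = delta_mx 0 i.
  by move=> i; have [v hv hpi] := onto (delta_mx 0 i); exists v.
exists b => [i|x]; first by case: (hb i).
rewrite coord_lincomb => [|i]; last by case: (hb i).
by rewrite [RHS]row_sum_delta; apply: eq_bigr => i _; case: (hb i) => _ ->.
Qed.

End Coordinates.

Lemma qdim_eq (A : lmodType K) (V W W' : A -> Prop) n :
  (forall v, V v -> (W v <-> W' v)) -> qdim V W n -> qdim V W' n.
Proof.
by move=> h [pi [l o k]]; exists pi; split => // v hv; rewrite -h //; apply: k.
Qed.

(** The coordinates of the images of a basis of V modulo W are the rows of an n by n' matrix;
    injectivity modulo W' makes these rows independent. *)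
Lemma qdim_map_le (A B : lmodType K) (V W : A -> Prop) (V' W' : B -> Prop)
    (phi : A -> B) n n' :
    subspace V -> subspace V' -> linear phi -> (forall v, V v -> V' (phi v)) ->
    (forall v, V v -> W' (phi v) -> W v) ->
  qdim V W n -> qdim V' W' n' -> (n <= n')%N.
Proof.
move=> sV sV' lphi VV' inj [pi [l o k]] [pi' [l' o' k']].
have [b hb hs] := coord_section sV l o.
pose M := \matrix_(i < n) pi' (phi (b i)).
have hM (x : 'rV[K]_n) : x *m M = pi' (phi (\sum_i x 0 i *: b i)).
  pose phiL := HB.pack phi (GRing.isLinear.Build _ _ _ _ _ lphi) : {linear A -> B}.
  rewrite (_ : phi _ = \sum_i x 0 i *: phi (b i)); last first.
    by rewrite -[phi]/(phiL : A -> B) linear_sum; apply: eq_bigr => i _; rewrite linearZ.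
  rewrite (coord_lincomb sV' l') => [|i]; last exact: VV'.
  by rewrite mulmx_sum_row; apply: eq_bigr => i _; rewrite rowK.
suff /eqP <- : row_free M by apply: rank_leq_col.
rewrite -kermx_eq0; apply/eqP/row_matrixP => i; rewrite row0.
have hv : V (\sum_j (row i (kermx M)) 0 j *: b j) by apply: subspace_lincomb.
rewrite -[LHS]hs; apply/k => //; apply: inj => //; apply/k'; first exact: VV'.
by rewrite -hM -row_mul mulmx_ker row0.
Qed.

Lemma qdim_uniq (A : lmodType K) (V W : A -> Prop) n n' :
  subspace V -> qdim V W n -> qdim V W n' -> n = n'.
Proof.
move=> sV h h'; apply/eqP; rewrite eqn_leq.
by rewrite !(qdim_map_le (V := V) (W := W) (V' := V) (W' := W) (phi := id)).
Qed.

Lemma qdim_map (A B : lmodType K) (V W : A -> Prop) (V' W' : B -> Prop) (phi : A -> B) n :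
    linear phi -> (forall v, V v -> V' (phi v)) ->
    subspace V' ->
    (forall v, V v -> (W' (phi v) <-> W v)) ->
    (forall v', V' v' -> exists2 v, V v & W' (v' - phi v)) ->
  qdim V' W' n -> qdim V W n.
Proof.
move=> lphi VV' sV' ker onto [pi [l o k]]; exists (pi \o phi); split.
- by move=> a u v hu hv /=; rewrite lphi l //; apply: VV'.
- move=> x; have [v' hv' <-] := o x; have [v hv hW] := onto _ hv'.
  exists v => //=; apply/esym/eqP; rewrite -subr_eq0 -(coordB l) //; last exact: VV'.
  by apply/eqP/k => //; apply: subspaceB => //; apply: VV'.
- by move=> v hv /=; rewrite k ?ker //; apply: VV'.
Qed.

(** This is the bridge to [quot_dim]. In the direction from bases, uniqueness of the coefficients
    makes the coordinate map linear. *)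
Lemma qdim_basis (A : lmodType K) (V W : A -> Prop) n :
    subspace V -> subspace W ->
  qdim V W n <-> exists2 b : 'I_n -> A, (forall i, V (b i)) &
    forall v, V v -> exists! c : {ffun 'I_n -> K}, W (v - \sum_i c i *: b i).
Proof.
move=> sV sW; split=> [[pi [l o k]]|[b hb hc]].
  have [b hb hs] := coord_section sV l o; exists b => // v hv.
  have hcE (c : {ffun 'I_n -> K}) :
      W (v - \sum_i c i *: b i) <-> pi v = \row_i c i.
    have hV : V (\sum_i c i *: b i) by apply: subspace_lincomb.
    rewrite -k; last by apply: subspaceB.
    have -> : \sum_i c i *: b i = \sum_i (\row_i c i) 0 i *: b i.
      by apply: eq_bigr => i _; rewrite mxE.
    rewrite (coordB l) //; last by apply: subspace_lincomb.
    by rewrite hs; split=> [/eqP|->]; [rewrite subr_eq0 => /eqP|rewrite subrr].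
  exists [ffun i => pi v 0 i]; split.
    by apply/hcE/rowP => i; rewrite mxE ffunE.
  by move=> c /hcE ->; apply/ffunP => i; rewrite ffunE mxE.
have /choice [g hg] : forall v, exists c : {ffun 'I_n -> K},
    V v -> W (v - \sum_i c i *: b i).
  move=> v; have [hv|nv] := pselect (V v); last by exists [ffun=> 0] => /nv.
  by have [c [hcW _]] := hc v hv; exists c.
have guniq v (c : {ffun 'I_n -> K}) : V v -> W (v - \sum_i c i *: b i) -> g v = c.
  move=> hv hW; have [c' [_ hu]] := hc v hv.
  by rewrite -(hu _ hW); apply/esym/hu/hg.
exists (fun v => \row_i g v i); split.
- move=> a u v hu hv; apply/rowP => i; rewrite !mxE.
  rewrite (@guniq _ [ffun i => a * g u i + g v i]) ?ffunE //; first exact: sV.2.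
  rewrite (_ : _ - _ = a *: (u - \sum_i g u i *: b i) + (v - \sum_i g v i *: b i)).
    by apply: sW.2; apply: hg.
  rewrite scalerBr addrACA -opprD; congr (_ - _); rewrite scaler_sumr -big_split /=.
  by apply: eq_bigr => j _; rewrite ffunE scalerDl scalerA.
- move=> x; exists (\sum_i x 0 i *: b i); first exact: subspace_lincomb.
  apply/rowP => i; rewrite mxE (@guniq _ [ffun i => x 0 i]) ?ffunE //.
    exact: subspace_lincomb.
  rewrite (_ : _ - _ = 0); first exact: sW.1.
  by apply/eqP; rewrite subr_eq0; apply/eqP/eq_bigr => j _; rewrite ffunE.
- move=> v hv; split=> [h0|hW].
    rewrite (_ : v = v - \sum_i g v i *: b i); first exact: hg.
    by rewrite big1 ?subr0 // => i _; have /rowP/(_ i) := h0; rewrite !mxE => ->; rewrite scale0r.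
  apply/rowP => i; rewrite !mxE (@guniq _ [ffun=> 0]) ?ffunE //.
  by rewrite big1 ?subr0 // => j _; rewrite ffunE scale0r.
Qed.

(** Among the matrices whose row space lies in P, one of maximal rank works: adjoining a further
    vector of P would raise the rank. *)
Lemma subspace_rowspace n (P : 'rV[K]_n -> Prop) : subspace P ->
  exists M : 'M[K]_n, forall u, P u <-> (u <= M)%MS.
Proof.
move=> sP.
pose Q r := `[< exists M : 'M[K]_n, \rank M = r /\ forall u, (u <= M)%MS -> P u >].
have exQ : exists r, Q r.
  exists 0%N; apply/asboolP; exists 0; split; first by rewrite mxrank0.
  by move=> u; rewrite submx0 => /eqP ->; exact: sP.1.
have ubQ r : Q r -> (r <= n)%N by move=> /asboolP [M [<- _]]; apply: rank_leq_row.
have [r /asboolP [M [rM hM]] maxr] := ex_maxnP exQ ubQ.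
exists M => u; split=> [hu|]; last exact: hM.
have : Q (\rank (M + u)%MS).
  apply/asboolP; exists (M + u)%MS; split => // v /sub_addsmxP [[w1 w2] ->].
  apply: subspaceD => //; first by apply: hM; rewrite submxMl.
  by have /sub_rVP [a ->] : (w2 *m u <= u)%MS by [rewrite submxMl]; apply: subspaceZ.
move=> /maxr; rewrite -rM => le.
have := mxrank_leqif_sup (addsmxSl M u); move=> [_ ].
rewrite eqn_leq le mxrankS ?addsmxSl // => /esym.
by move=> h; apply: submx_trans (addsmxSr M u) h.
Qed.

(** Besides additivity this supplies the existence of dimensions, starting from that of V modulo 0.
    The coordinates of U form the row space of a matrix [M], whose cokernel gives coordinates on V/U
    and whose row basis gives those on U/W. *)
Lemma qdim_sub (A : lmodType K) (V U W : A -> Prop) n :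
    subspace V -> subspace U -> (forall v, V v -> W v -> U v) -> (forall v, U v -> V v) ->
  qdim V W n -> exists a b, [/\ qdim V U a, qdim U W b & (a + b = n)%N].
Proof.
move=> sV sU WU UV [pi [l o k]].
have [M hM] : exists M : 'M[K]_n, forall u, (exists2 v, U v & pi v = u) <-> (u <= M)%MS.
  apply: subspace_rowspace; split; first by exists 0; [exact: sU.1|exact: coord0 l].
  move=> a _ _ [u hu <-] [v hv <-]; exists (a *: u + v); first exact: sU.2.
  by rewrite l //; apply: UV.
have hMU v : V v -> ((pi v <= M)%MS <-> U v).
  move=> hv; split=> [/hM [u hu hpi]|hu]; last by apply/hM; exists v.
  rewrite -[v](subrK u); apply: subspaceD => //.
  have hVu : V (v - u) by apply: subspaceB => //; exact: UV.
  apply: WU => //; apply/k => //; by rewrite (coordB l) ?hpi ?subrr //; exact: UV.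
have rf : row_free (row_base (cokermx M)) by exact: row_base_free.
exists (\rank (cokermx M)), (\rank M); split.
- have ckM : col_base (cokermx M) *m row_base (cokermx M) = cokermx M by exact: mulmx_base.
  exists (fun v => pi v *m col_base (cokermx M)); split.
  + by move=> a u v hu hv; rewrite l // mulmxDl -scalemxAl.
  + move=> x; have [v hv hpi] := o (x *m pinvmx (col_base (cokermx M))).
    by exists v => //; rewrite hpi mulmxKpV // submx_full // col_base_full.
  + move=> v hv; rewrite -hMU // submxE; split=> [h|/eqP h].
      by rewrite -ckM mulmxA h mul0mx.
    by apply: (row_free_inj rf); rewrite mul0mx -mulmxA ckM.
- exists (fun v => pi v *m pinvmx (row_base M)); split.
  + by move=> a u v hu hv; rewrite l ?mulmxDl -?scalemxAl //; apply: UV.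
  + move=> x; have /hM [v hv hpi] : (x *m row_base M <= M)%MS.
      by rewrite (submx_trans (submxMl _ _)) // eq_row_base.
    by exists v => //; rewrite hpi mulmxKp // row_base_free.
  + move=> v hv; rewrite -k; last exact: UV.
    have h : (pi v <= row_base M)%MS by rewrite eq_row_base hMU //; exact: UV.
    split=> [h0|->]; last by rewrite mul0mx.
    by rewrite -(mulmxKpV h) h0 mul0mx.
- by rewrite mxrank_coker subnK // rank_leq_row.
Qed.

Lemma qdim_span_le (A : lmodType K) (V W : A -> Prop) n m (b : 'I_m -> A) :
    subspace V -> subspace W -> (forall i, V (b i)) ->
    (forall v, V v -> exists x : 'I_m -> K, W (v - \sum_i x i *: b i)) ->
  qdim V W n -> (n <= m)%N.
Proof.
move=> sV sW hb hspan [p [l o k]].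
pose M := \matrix_(i < m) p (b i).
suff : row_full M by move=> /eqP <-; apply: rank_leq_row.
rewrite -sub1mx; apply/row_subP => i; have [v hv <-] := o (row i 1%:M).
have [x hx] := hspan v hv.
have hl : V (\sum_i x i *: b i) by exact: subspace_lincomb.
have : p (v - \sum_i x i *: b i) = 0 by apply/k => //; apply: subspaceB.
rewrite (coordB l) // => /eqP; rewrite subr_eq0 => /eqP ->.
rewrite (coord_lincomb sV l) //; apply: summx_sub => j _; apply: scalemx_sub.
by rewrite -[p (b j)](rowK (fun i => p (b i))) row_sub.
Qed.

(** The elements congruent to the image modulo W' already have dimension n modulo W'; since n' <= n,
    they exhaust V'. *)
Lemma qdim_inj_onto (A B : lmodType K) (V W : A -> Prop) (V' W' : B -> Prop)
    (phi : A -> B) n n' :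
    subspace V -> subspace W -> subspace V' -> subspace W' ->
    linear phi -> (forall v, V v -> V' (phi v)) ->
    (forall v, V v -> (W' (phi v) <-> W v)) ->
  qdim V W n -> qdim V' W' n' -> (n' <= n)%N ->
  forall v', V' v' -> exists2 v, V v & W' (v' - phi v).
Proof.
move=> sV sW sV' sW' lphi VV' ker dV dV' le.
pose phiL := HB.pack phi (GRing.isLinear.Build _ _ _ _ _ lphi) : {linear A -> B}.
have phiE : phi = phiL by [].
pose U v' := V' v' /\ exists2 v, V v & W' (v' - phi v).
have sU : subspace U.
  split; first by split; [exact: sV'.1|exists 0; [exact: sV.1|rewrite phiE linear0 subr0;
      exact: sW'.1]].
  move=> a u v [hu [u0 hu0 hwu]] [hv [v0 hv0 hwv]]; split; first exact: sV'.2.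
  exists (a *: u0 + v0); first exact: sV.2.
  rewrite lphi (_ : _ - _ = a *: (u - phi u0) + (v - phi v0)); first exact: sW'.2.
  by rewrite scalerBr addrACA -opprD.
have WU v : V' v -> W' v -> U v.
  by move=> hv hw; split=> //; exists 0; [exact: sV.1|rewrite phiE linear0 subr0].
have [a [b [VU UW ab]]] := qdim_sub sV' sU WU (fun v hv => hv.1) dV'.
have VW : qdim V W b.
  apply: qdim_map UW => //; last by move=> v' [].
  move=> v hv; split; first exact: VV'.
  by exists v => //; rewrite subrr; exact: sW'.1.
have nb := qdim_uniq sV dV VW.
have a0 : a = 0%N by apply/eqP; rewrite -leqn0 -(leq_add2r b) ab add0n -nb.
case: VU => p [_ _ k] v' hv'; suff [] : U v' by [].
by apply/k => //; rewrite a0 in p k *; rewrite [LHS]thinmx0.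
Qed.

Lemma qdim_onto_inj (A B : lmodType K) (V W : A -> Prop) (V' W' : B -> Prop)
    (phi : A -> B) n n' :
    subspace V -> subspace W -> subspace V' -> subspace W' ->
    linear phi -> (forall v, V v -> V' (phi v)) -> (forall v, V v -> W v -> W' (phi v)) ->
    (forall v', V' v' -> exists2 v, V v & W' (v' - phi v)) ->
  qdim V W n -> qdim V' W' n' -> (n <= n')%N ->
  forall v, V v -> W' (phi v) -> W v.
Proof.
move=> sV sW sV' sW' lphi VV' WW' onto dV dV' le.
pose U v := V v /\ W' (phi v).
pose phiL := HB.pack phi (GRing.isLinear.Build _ _ _ _ _ lphi) : {linear A -> B}.
have phiE : phi = phiL by [].
have sU : subspace U.
  split; first by split; [exact: sV.1|rewrite phiE linear0; exact: sW'.1].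
  by move=> a u v [hu hwu] [hv hwv]; split; [exact: sV.2|rewrite lphi; exact: sW'.2].
have [a [b [VU UW ab]]] := qdim_sub (V := V) (U := U) (W := W) sV sU
  (fun v hv hw => conj hv (WW' v hv hw)) (fun v hv => hv.1) dV.
have VU' : qdim V U n'.
  by apply: qdim_map dV' => // v hv; split=> [|[]].
have na := qdim_uniq sV VU VU'.
have b0 : b = 0%N by apply/eqP; rewrite -leqn0 -(leq_add2l a) ab addn0 na.
case: UW => p [_ _ k] v hv hw; apply/(k v); first by split.
by rewrite b0 in p k *; rewrite [LHS]thinmx0.
Qed.

Lemma qdim0 (A : lmodType K) (V W : A -> Prop) :
  subspace V -> (forall v, V v -> W v) -> qdim V W 0.
Proof.
move=> sV VW; exists (fun=> 0); split=> [a u v _ _|x|v hv].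
- by rewrite scaler0 addr0.
- by exists 0; [exact: sV.1|rewrite [RHS]thinmx0].
- by split=> // _; exact: VW.
Qed.

(** Concatenated coordinates for the single W_j are coordinates for their intersection; simultaneous
    approximation is what makes them surjective. *)
Lemma qdim_crt (A : lmodType K) (V : A -> Prop) N (W : 'I_N -> A -> Prop) (n : 'I_N -> nat) :
    subspace V -> (forall j, qdim V (W j) (n j)) ->
    (forall v : 'I_N -> A, (forall j, V (v j)) -> exists2 u, V u & forall j, W j (u - v j)) ->
  qdim V (fun v => forall j, W j v) (\sum_j n j).
Proof.
move=> sV dW onto.
pose p j := sval (cid (dW j)).
have hp j : [/\ forall a u v, V u -> V v -> p j (a *: u + v) = a *: p j u + p j v,
    forall x, exists2 v, V v & p j v = x & forall v, V v -> (p j v = 0 <-> W j v)].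
  by rewrite /p; case: cid.
have eq_sub (x y : 'rV[K]_(\sum_j n j)) : (forall j, submxrow x j = submxrow y j) -> x = y.
  by move=> xy; rewrite -[x]submxrowK -[y]submxrowK; exact: eq_mxrow.
have subL a (x y : 'rV[K]_(\sum_j n j)) j :
    submxrow (a *: x + y) j = a *: submxrow x j + submxrow y j.
  by apply/matrixP => r c; rewrite !mxE.
have sub0 j : submxrow (0 : 'rV[K]_(\sum_j n j)) j = 0 by apply/matrixP => r c; rewrite !mxE.
exists (fun v => \mxrow_j p j v); split.
- move=> a u v hu hv; apply: eq_sub => j.
  rewrite subL !mxrowK; case: (hp j) => l _ _; exact: l.
- move=> x; have /choice [v hv] : forall j, exists v, V v /\ p j v = submxrow x j.
    by move=> j; case: (hp j) => _ o _; have [v hv hpv] := o (submxrow x j); exists v.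
  have [|u hu hW] := onto v; first by move=> j; case: (hv j).
  exists u => //; apply: eq_sub => j; rewrite mxrowK.
  have [Vv <-] := hv j; have [l _ k] := hp j.
  by apply/eqP; rewrite -subr_eq0 -(coordB l) //; apply/eqP/k; [exact: subspaceB|exact: hW].
- move=> v hv; split=> [h0 j|hW].
    have [_ _ k] := hp j; apply/k => //.
    by have /(congr1 (fun x => submxrow x j)) := h0; rewrite mxrowK sub0.
  by apply: eq_sub => j; rewrite mxrowK sub0; have [_ _ k] := hp j; apply/k.
Qed.

End QuotientDimension.

(** * Forms *)

Lemma mpoly_ring_ind (n : nat) (R : nzRingType) (P : {mpoly R[n]} -> Prop) :
    (forall c, P c%:MP) -> (forall i, P 'X_i) ->
    (forall p q, P p -> P q -> P (p + q)) -> (forall p q, P p -> P q -> P (p * q)) ->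
  forall p, P p.
Proof.
move=> PC PX PD PM p; rewrite [p]mpolyE.
have P0 : P 0 by rewrite -(mpolyC0 n R).
have P1 : P 1 by rewrite -(mpolyC1 n R).
apply: (big_ind P P0 PD) => m _; rewrite -mul_mpolyC; apply: (PM) => //.
rewrite mpolyXE_id; apply: (big_ind P P1 PM) => i _.
by elim: (m i) => [|k IH]; rewrite ?expr0 ?exprS //; exact: PM.
Qed.

Lemma mmap_homog_scale (n : nat) (R : nzRingType) (B : comNzRingType) (f : {rmorphism R -> B})
    (h h' : 'I_n -> B) c d p :
  p \is d.-homog -> (forall i, h' i = c * h i) -> mmap f h' p = c ^+ d * mmap f h p.
Proof.
move=> hp hh; rewrite /mmap big_distrr /=; apply: eq_big_seq => m hm.
rewrite mulrCA; congr (_ * _); rewrite -(dhomog_mf hp hm) /mmap1 /= mdegE expr_sum.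
by rewrite -big_split /=; apply: eq_bigr => i _; rewrite hh exprMn.
Qed.

Lemma mderivXU (n : nat) (R : nzRingType) (i j : 'I_n) :
  ('X_j)^`M(i) = (i == j)%:R :> {mpoly R[n]}.
Proof.
rewrite mderivX mnm1E eq_sym; case: eqP => [->|_]; last by rewrite scale0r.
rewrite scale1r (_ : (U_(j) - U_(j))%MM = 0%MM) ?mpolyX0 //.
by apply/mnmP => k; rewrite mnmBE subnn mnm0E.
Qed.

Lemma mmap_derivation (n : nat) (R : nzRingType) (B : comNzRingType) (f : {rmorphism R -> B})
    (h : 'I_n -> B) (D : B -> B) p :
    (forall x y, D (x + y) = D x + D y) -> (forall x y, D (x * y) = D x * y + x * D y) ->
    (forall c, D (f c) = 0) ->
  D (mmap f h p) = \sum_i mmap f h p^`M(i) * D (h i).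
Proof.
move=> DD DM Df; elim/mpoly_ring_ind: p => [c|j|p q IHp IHq|p q IHp IHq].
- by rewrite mmapC Df big1 // => i _; rewrite mderivC rmorph0 mul0r.
- rewrite mmapX mmap1U (bigD1 j) //= mderivXU eqxx rmorph1 mul1r big1 ?addr0 //.
  by move=> i /negPf ij; rewrite mderivXU ij mulr0n rmorph0 mul0r.
- rewrite rmorphD DD IHp IHq -big_split /=; apply: eq_bigr => i _.
  by rewrite mderivD rmorphD mulrDl.
- rewrite rmorphM DM IHp IHq mulr_suml mulr_sumr -big_split /=.
  apply: eq_bigr => i _; rewrite mderivM rmorphD !rmorphM /=; ring.
Qed.

Section Homogeneous.
Variables (n : nat) (K : fieldType).
Implicit Types p q h : {mpoly K[n]}.

Lemma dhomog_const p : p \is 0.-homog -> p = (p@_0%MM)%:MP.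
Proof.
move=> hp; apply/mpolyP => m; rewrite mcoeffC.
have [<-|m0] := eqVneq 0%MM m; first by rewrite mulr1.
by rewrite mulr0 (dhomog_nemf_coeff hp) //= mdeg_eq0 eq_sym.
Qed.

Lemma dhomog_var i : 'X_i \is [in K[n], 1.-homog].
Proof. by rewrite dhomogX /= mdeg1. Qed.

Lemma dhomog_exp p k N : p \is k.-homog -> p ^+ N \is (k * N).-homog.
Proof. exact: dhomogMn. Qed.

Lemma dhomog_varX i N : 'X_i ^+ N \is [in K[n], N.-homog].
Proof. by rewrite -[N in N.-homog]mul1n; apply/dhomog_exp/dhomog_var. Qed.

Lemma pihomogM e k h p : h \is e.-homog ->
  pihomog mdeg (e + k) (h * p) = h * pihomog mdeg k p.
Proof.
move=> hh; elim/mpolyind: p => [|c m p _ _ IH]; first by rewrite mulr0 !pihomog0 mulr0.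
rewrite mulrDr !pihomogD IH mulrDr; congr (_ + _).
rewrite -scalerAr !linearZ /= pihomogX -scalerAr; congr (_ *: _).
have hX : 'X_[m] \is [in K[n], (mdeg m).-homog] by rewrite dhomogX.
have [mk|mk] := eqVneq (mdeg m) k.
  by rewrite pihomog_dE // -mk; exact: dhomogM.
rewrite mulr0 (@pihomog_ne0 _ _ _ (e + mdeg m)) ?eqn_add2l //.
exact: dhomogM.
Qed.

Lemma pihomogM_lt e k h p : h \is e.-homog -> (k < e)%N -> pihomog mdeg k (h * p) = 0.
Proof.
move=> hh ke; elim/mpolyind: p => [|c m p _ _ IH]; first by rewrite mulr0 pihomog0.
rewrite mulrDr pihomogD IH addr0 -scalerAr linearZ /=.
have hX : 'X_[m] \is [in K[n], (mdeg m).-homog] by rewrite dhomogX.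
rewrite (@pihomog_ne0 _ _ _ (e + mdeg m)) ?scaler0 //; last exact: dhomogM.
by rewrite neq_ltn (leq_trans ke) ?orbT // leq_addr.
Qed.

Lemma dhomog_factor e k h p : h != 0 -> h \is e.-homog ->
  h * p \is (e + k).-homog -> p \is k.-homog.
Proof.
move=> h0 hh hp; rewrite homog_piE; apply/eqP/(mulfI h0).
by rewrite -(pihomogM _ _ hh) pihomog_dE.
Qed.

Lemma euler_formula d p : p \is d.-homog -> \sum_i 'X_i * p^`M(i) = d%:R *: p.
Proof.
move=> hp; rewrite {2}[p]mpolyE scaler_sumr.
transitivity (\sum_i \sum_(m <- msupp p) 'X_i * (p@_m *: 'X_[m])^`M(i)).
  by apply: eq_bigr => i _; rewrite {1}[p]mpolyE raddf_sum /= big_distrr.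
rewrite exchange_big /=; apply: eq_big_seq => m hm.
rewrite -(dhomog_mf hp hm) /= mdegE natr_sum scaler_suml.
apply: eq_bigr => i _; rewrite mderivZ mderivX -scalerAr -scalerAr.
rewrite [RHS]scalerA [_ * p@_m]mulrC -[RHS]scalerA; congr (_ *: _).
have [->|mi] := eqVneq (m i) 0%N; first by rewrite !scale0r.
congr (_ *: _); by rewrite -mpolyXD addmC submK // lep1mP.
Qed.

Lemma subspace_homog k : subspace (fun p : {mpoly K[n]} => p \is k.-homog).
Proof. by split=> [|a u v hu hv]; [exact: dhomog0|apply: dhomogD; [exact: dhomogZ|]]. Qed.

Lemma subspace_zero (A : lmodType K) : subspace (fun x : A => x = 0).
Proof. by split=> // a u v -> ->; rewrite scaler0 addr0. Qed.

End Homogeneous.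

Lemma qdim_homog (n : nat) (K : fieldType) k :
  qdim (fun p : {mpoly K[n.+1]} => p \is k.-homog) (fun p => p = 0) 'C(k + n, k).
Proof.
have [f lf [g fK gK]] := @dhomog_vecaxiom n K k.
have fL u v (a : K) : f (a *: u + v) = a *: f u + f v by rewrite lf.
exists (fun p => f (indhomog k p)); split.
- move=> a u v hu hv; rewrite -fL; congr f; apply/val_inj => /=.
  by rewrite !val_insubd /= hu hv (subspace_homog n.+1 K k).2.
- by move=> x; exists (val (g x)); rewrite ?dhomog_is_dhomog // /indhomog valKd gK.
- move=> p hp; have f0 : f 0 = 0 by have := fL 0 0 (-1); rewrite scaler0 addr0 scaleN1r addNr.
  split=> [|->]; last by rewrite -[RHS]f0; congr f; apply/val_inj; rewrite val_insubd dhomog0.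
  rewrite -f0 => /(can_inj fK) /(congr1 val); by rewrite val_insubd hp.
Qed.

Definition hdim (z : int) : nat := if z is Posz k then 'C(k.+2, 2) else 0%N.

Lemma subspace_homogz (K : fieldType) z : subspace (@homogz K z).
Proof. by case: z => k; [exact: subspace_homog|exact: subspace_zero]. Qed.

Lemma qdim_homogz (K : fieldType) z : qdim (@homogz K z) (fun p => p = 0) (hdim z).
Proof.
case: z => k /=; last by apply: qdim0 => //; exact: subspace_zero.
have -> : 'C(k.+2, 2) = 'C(k + 2, k) by rewrite -(@bin_sub k.+2 2) // !subSS subn0 addn2.
exact: qdim_homog.
Qed.

Definition is_ideal (B : comNzRingType) (I : B -> Prop) : Prop :=
  [/\ I 0, forall u v, I u -> I v -> I (u + v) & forall a u, I u -> I (a * u)].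

Lemma idealB (B : comNzRingType) (I : B -> Prop) u v : is_ideal I -> I u -> I v -> I (u - v).
Proof. by move=> [_ iD iM] hu hv; apply: iD => //; rewrite -mulN1r; apply: iM. Qed.

Lemma ideal_sum (B : comNzRingType) (I : B -> Prop) (T : Type) (r : seq T) (P : pred T) F :
  is_ideal I -> (forall i, P i -> I (F i)) -> I (\sum_(i <- r | P i) F i).
Proof. by move=> [i0 iD _] h; apply: (big_ind I). Qed.

Lemma ideal_subspace (n : nat) (K : fieldType) (I : {mpoly K[n]} -> Prop) :
  is_ideal I -> subspace I.
Proof. by case=> i0 iD iM; split=> // a u v hu hv; apply: iD => //; rewrite -mul_mpolyC;
    apply: iM. Qed.

Lemma mmap_congr (n : nat) (R : nzRingType) (B : comNzRingType) (f : {rmorphism R -> B})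
    (h h' : 'I_n -> B) (I : B -> Prop) p :
  is_ideal I -> (forall i, I (h i - h' i)) -> I (mmap f h p - mmap f h' p).
Proof.
move=> iI hh; have [i0 iD iM] := iI.
elim/mpoly_ring_ind: p => [c|j|p q IHp IHq|p q IHp IHq].
- by rewrite !mmapC subrr.
- by rewrite !mmapX !mmap1U.
- by rewrite !rmorphD opprD addrACA; exact: iD.
- rewrite !rmorphM /=; set a := mmap f h p; set b := mmap f h q.
  rewrite (_ : _ - _ = a * (b - mmap f h' q) + mmap f h' q * (a - mmap f h' p)).
    by apply: iD; apply: iM.
  by rewrite !mulrBr [_ * a]mulrC addrA subrK [_ * mmap f h' p]mulrC.
Qed.

(** * Jacobian ideal and dehomogenization *)

Section Jacobian.
Variable K : numClosedFieldType.
Local Notation S := {mpoly K[3]}.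
Implicit Types f s h : S.

Lemma jacobian_is_ideal f : is_ideal (jacobian_ideal f).
Proof.
split.
- by exists (fun=> 0); rewrite big1 // => i _; rewrite mul0r.
- move=> u v [a ->] [b ->]; exists (fun i => a i + b i).
  by rewrite -big_split; apply: eq_bigr => i _; rewrite mulrDl.
- move=> c u [a ->]; exists (fun i => c * a i).
  by rewrite mulr_sumr; apply: eq_bigr => i _; rewrite mulrA.
Qed.

Lemma jacobian_deriv f i : jacobian_ideal f f^`M(i).
Proof.
exists (fun j => (j == i)%:R); rewrite (bigD1 i) //= eqxx mul1r big1 ?addr0 //.
by move=> j /negPf ->; rewrite mul0r.
Qed.

Lemma jacobian_self f d : (0 < d)%N -> f \is d.-homog -> jacobian_ideal f f.
Proof.
move=> d0 hf; have [_ _ iM] := jacobian_is_ideal f.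
suff : jacobian_ideal f (d%:R^-1%:MP * \sum_i 'X_i * f^`M(i)).
  by rewrite (euler_formula hf) mul_mpolyC scalerA mulVf ?scale1r // pnatr_eq0 -lt0n.
apply: (iM); apply: ideal_sum; first exact: jacobian_is_ideal.
by move=> i _; apply: iM; exact: jacobian_deriv.
Qed.

Lemma dhomog_mderiv f d i : f \is d.-homog -> f^`M(i) \is d.-1.-homog.
Proof.
move=> hf; rewrite [f]mpolyE raddf_sum big_seq; apply: rpred_sum => m hm /=.
rewrite mderivZ mderivX; apply: dhomogZ; rewrite scaler_nat.
have [->|mi] := eqVneq (m i) 0%N; first by rewrite mulr0n dhomog0.
rewrite -scaler_nat; apply: dhomogZ.
rewrite dhomogX; apply/eqP; rewrite -(dhomog_mf hf hm) /=.
have : (m - U_(i) + U_(i) = m)%MM by rewrite submK // lep1mP.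
by move=> /(congr1 (@mdeg 3)); rewrite mdegD mdeg1 addn1 => <-.
Qed.

Lemma pihomog_lincomb (m k : nat) (g a : 'I_3 -> S) : (forall i, g i \is m.-homog) ->
  pihomog mdeg (m + k) (\sum_i a i * g i) = \sum_i pihomog mdeg k (a i) * g i.
Proof.
move=> hg; rewrite raddf_sum; apply: eq_bigr => i _ /=.
by rewrite mulrC pihomogM // mulrC.
Qed.

Lemma jacobian_pihomog f d k s : f \is d.-homog -> jacobian_ideal f s ->
  jacobian_ideal f (pihomog mdeg k s).
Proof.
move=> hf [a ->]; have hd i := dhomog_mderiv i hf.
case: (leqP d.-1 k) => [/subnKC <-|lt]; last first.
  rewrite raddf_sum /=; apply: ideal_sum => [|i _]; first exact: jacobian_is_ideal.
  by rewrite mulrC (pihomogM_lt _ (hd i)) //; case: (jacobian_is_ideal f).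
by rewrite pihomog_lincomb //; exists (fun i => pihomog mdeg (k - d.-1) (a i)).
Qed.

Lemma meval_homog_scale n (p : {mpoly K[n]}) k c (u v : 'I_n -> K) :
  p \is k.-homog -> (forall i, v i = c * u i) -> p.@[v] = c ^+ k * p.@[u].
Proof. by move=> hp huv; rewrite /meval (mmap_homog_scale _ hp huv). Qed.

End Jacobian.

(** * Dehomogenization and lifting to forms *)

Section Dehomogenization.
Variables (K : numClosedFieldType) (i : 'I_3).
Local Notation S := {mpoly K[3]}.
Local Notation frac := {fraction {mpoly K[3]}}.

Section Abstract.
Variables (B : comNzRingType) (c : {rmorphism K -> B}) (h : 'I_3 -> B).
Hypothesis hi : h i = 1.
Local Notation phi := (mmap c h).

(** Asking for every large degree, and not for just one, lets finitely many elements be lifted to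
    the degrees prescribed by one homogeneous identity. The ring [B] is abstract because both
    K[u, v] and K[X_j][X_i] are needed. *)
Definition liftable (b : B) : Prop :=
  exists N0, forall N, (N0 <= N)%N -> exists2 G : S, G \is N.-homog & phi G = b.

Lemma liftable_const a : liftable (c a).
Proof.
exists 0%N => N _; exists (a *: 'X_i ^+ N).
  by apply: dhomogZ; exact: dhomog_varX.
by rewrite mmapZ rmorphXn /= mmapX mmap1U hi expr1n mulr1.
Qed.

Lemma liftableD b b' : liftable b -> liftable b' -> liftable (b + b').
Proof.
move=> [N hN] [N' hN']; exists (maxn N N') => M; rewrite geq_max => /andP [h1 h2].
have [G hG <-] := hN _ h1; have [G' hG' <-] := hN' _ h2.
by exists (G + G'); [exact: dhomogD|rewrite rmorphD].
Qed.

Lemma liftableM b b' : liftable b -> liftable b' -> liftable (b * b').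
Proof.
move=> [N hN] [N' hN']; exists (N + N')%N => M hM.
have [G hG <-] := hN _ (leqnn N).
have [|G' hG' <-] := hN' (M - N)%N; first by rewrite leq_subRL // (leq_trans _ hM) ?leq_addr.
exists (G * G'); last by rewrite rmorphM.
by have := dhomogM hG hG'; rewrite subnKC // (leq_trans _ hM) ?leq_addr.
Qed.

Lemma liftable_var j : liftable (h j).
Proof.
exists 1%N => -[//|N] _; exists ('X_j * 'X_i ^+ N).
  by rewrite -[N.+1]add1n; apply: dhomogM; [exact: dhomog_var|exact: dhomog_varX].
by rewrite rmorphM rmorphXn /= !mmapX !mmap1U hi expr1n mulr1.
Qed.

(* Composing phi with X_j / X_i sends a form G of degree N to G / X_i^N. *)
Lemma dehom_inj (psi : {rmorphism B -> frac}) N (G : S) :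
    (forall a, psi (c a) = tofrac a%:MP) ->
    (forall j, psi (h j) = tofrac 'X_j / tofrac 'X_i) ->
  G \is N.-homog -> phi G = 0 -> G = 0.
Proof.
move=> psic psih hG G0; apply/eqP.
suff /eqP : tofrac 'X_i ^+ N * psi (phi G) = tofrac G.
  by rewrite G0 rmorph0 mulr0 eq_sym tofrac_eq0.
pose c' := [the {rmorphism K -> frac} of @tofrac S \o @mpolyC 3 K].
have X0 : tofrac ('X_i : S) != 0 by rewrite tofrac_eq0 -msize_poly_eq0 msizeX.
have -> : psi (phi G) = mmap c' (fun j => tofrac 'X_j / tofrac 'X_i) G.
  rewrite /mmap rmorph_sum; apply: eq_bigr => m _; rewrite rmorphM /= psic; congr (_ * _).
  by rewrite /mmap1 rmorph_prod; apply: eq_bigr => j _; rewrite rmorphXn /= psih.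
rewrite -(mmap_homog_scale (h' := fun j => tofrac 'X_j) _ hG); last first.
  by move=> j; rewrite mulrC divfK.
rewrite {2}[G]mpolyE rmorph_sum; apply: eq_bigr => m _ /=.
rewrite -mul_mpolyC rmorphM /=; congr (_ * _).
rewrite /mmap1 mpolyXE_id rmorph_prod; apply: eq_bigr => j _; by rewrite rmorphXn.
Qed.

End Abstract.

End Dehomogenization.

Section Chart.
Variables (K : numClosedFieldType) (i : 'I_3).
Local Notation S := {mpoly K[3]}.
Local Notation frac := {fraction {mpoly K[3]}}.

Definition chart_var (j : 'I_3) : {mpoly K[2]} := if unlift i j is Some k then 'X_k else 1.

Lemma dehomogE (f : S) : dehomog i f = mmap (@mpolyC 2 K) chart_var f.
Proof. by apply: eq_bigr => m _; congr (_ * _); apply: eq_bigr => j _; rewrite tnth_mktuple. Qed.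

Lemma dehomogM (f g : S) : dehomog i (f * g) = dehomog i f * dehomog i g.
Proof. by rewrite !dehomogE rmorphM. Qed.

Lemma dehomogD (f g : S) : dehomog i (f + g) = dehomog i f + dehomog i g.
Proof. by rewrite !dehomogE rmorphD. Qed.

Lemma dehomogB (f g : S) : dehomog i (f - g) = dehomog i f - dehomog i g.
Proof. by rewrite !dehomogE rmorphB. Qed.

Lemma dehomog_sum n (F : 'I_n -> S) : dehomog i (\sum_j F j) = \sum_j dehomog i (F j).
Proof. by rewrite dehomogE rmorph_sum; apply: eq_bigr => j _; rewrite /= dehomogE. Qed.

Lemma chart_var_self : chart_var i = 1.
Proof. by rewrite /chart_var unlift_none. Qed.

Lemma chart_var_lift k : chart_var (lift i k) = 'X_k.
Proof. by rewrite /chart_var liftK. Qed.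

Lemma dehomog_liftable (b : {mpoly K[2]}) :
  exists N0, forall N, (N0 <= N)%N -> exists2 G : S, G \is N.-homog & dehomog i G = b.
Proof.
suff [N0 h] : liftable (@mpolyC 2 K) chart_var b.
  by exists N0 => N /h [G hG <-]; exists G; [exact: hG|rewrite dehomogE].
elim/mpoly_ring_ind: b => [a|k|p q|p q].
- exact: liftable_const chart_var_self a.
- by rewrite -chart_var_lift; exact: liftable_var chart_var_self _.
- exact: liftableD.
- exact: liftableM.
Qed.

Lemma dehomog_inj N (G : S) : G \is N.-homog -> dehomog i G = 0 -> G = 0.
Proof.
rewrite dehomogE => hG G0.
pose c := [the {rmorphism K -> frac} of @tofrac S \o @mpolyC 3 K].
pose psi := [the {rmorphism {mpoly K[2]} -> frac} of
  mmap c (fun k => tofrac ('X_(lift i k) : S) / tofrac 'X_i)].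
have X0 : tofrac ('X_i : S) != 0 by rewrite tofrac_eq0 -msize_poly_eq0 msizeX.
apply: (dehom_inj (psi := psi) _ _ hG G0) => [a|j]; first by rewrite /= mmapC.
rewrite /chart_var; case: unliftP => [k ->|->] /=; first by rewrite mmapX mmap1U.
by rewrite rmorph1 divff.
Qed.

Lemma meval_dehomog N (G : S) (p : {ffun 'I_3 -> K}) : p i != 0 -> G \is N.-homog ->
  p i ^+ N * (dehomog i G).@[chart_point i p] = G.@[p].
Proof.
move=> pi0 hG; rewrite comp_mpoly_meval.
apply/esym; apply: meval_homog_scale => // j; rewrite tnth_mktuple.
case: unliftP => [k ->|->]; last by rewrite meval1 mulr1.
by rewrite mevalXU ffunE mulrC divfK.
Qed.

Lemma mderiv_dehomog (f : S) k : (dehomog i f)^`M(k) = dehomog i f^`M(lift i k).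
Proof.
rewrite !dehomogE (@mmap_derivation _ _ _ _ chart_var (mderiv k)).
- rewrite (@bigD1_ord _ _ _ _ i xpredT) //= chart_var_self.
  rewrite (_ : 1^`M(k) = 0) ?mulr0 ?add0r; last by rewrite -(mpolyC1 2 K) mderivC.
  rewrite (bigD1 k) //= chart_var_lift mderivXU eqxx mulr1 big1 ?addr0 //.
  by move=> l /negPf lk; rewrite chart_var_lift mderivXU eq_sym lk mulr0n mulr0.
- by move=> x y; rewrite mderivD.
- by move=> x y; rewrite mderivM.
- by move=> a; rewrite mderivC.
Qed.

(** The derivative lost in the chart is recovered from Euler's formula; this is why f itself stands
    beside its two affine derivatives in the Tjurina ideal. *)
Lemma dehomog_euler d (f : S) : f \is d.-homog ->
  dehomog i f^`M(i) = d%:R%:MP * dehomog i f - \sum_(k < 2) 'X_k * (dehomog i f)^`M(k).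
Proof.
move=> /euler_formula /(congr1 (mmap (@mpolyC 2 K) chart_var)).
rewrite mmapZ rmorph_sum (@bigD1_ord _ _ _ _ i xpredT) //=.
rewrite rmorphM /= mmapX mmap1U chart_var_self mul1r !dehomogE => <-.
rewrite (eq_bigr (fun k => 'X_k * (mmap (@mpolyC 2 K) chart_var f)^`M(k))) ?addrK // => k _.
by rewrite rmorphM /= mmapX mmap1U chart_var_lift -dehomogE mderiv_dehomog -dehomogE.
Qed.

End Chart.

(** * Local Tjurina algebras *)

Section LocalRing.
Variables (K : numClosedFieldType) (a : {ffun 'I_2 -> K}).
Local Notation P := {mpoly K[2]}.
Local Notation O := (local_ring a).

Lemma tofrac_sum n (F : 'I_n -> P) : tofrac (\sum_j F j) = \sum_j tofrac (F j).
Proof. by rewrite rmorph_sum. Qed.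

Lemma tofrac_neq0 (h : P) : h.@[a] != 0 -> tofrac h != 0.
Proof. by move=> ha; rewrite tofrac_eq0; apply: contraNneq ha => ->; rewrite meval0. Qed.

Lemma local_ring_tofrac g : O (tofrac g).
Proof. by exists g, 1; rewrite meval1 oner_neq0 tofrac1 divr1. Qed.

Lemma local_ring_inv h : h.@[a] != 0 -> O (tofrac h)^-1.
Proof. by move=> ha; exists 1, h; rewrite tofrac1 mul1r. Qed.

Lemma local_ringM x y : O x -> O y -> O (x * y).
Proof.
move=> [g [h [ha ->]]] [g' [h' [ha' ->]]]; exists (g * g'), (h * h').
by rewrite mevalM mulf_neq0 // mulf_div !tofracM.
Qed.

Lemma local_ringD x y : O x -> O y -> O (x + y).
Proof.
move=> [g [h [ha ->]]] [g' [h' [ha' ->]]]; exists (g * h' + g' * h), (h * h').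
rewrite mevalM mulf_neq0 // addf_div ?tofrac_neq0 //.
by rewrite tofracD !tofracM.
Qed.

Lemma tjurina_idealD g x y : tjurina_ideal g a x -> tjurina_ideal g a y ->
    tjurina_ideal g a (x + y).
Proof.
move=> [u [v [hu hv ->]]] [u' [v' [hu' hv' ->]]].
exists (u + u'), (fun k => v k + v' k); split; first exact: local_ringD.
  by move=> k; apply: local_ringD.
rewrite mulrDl addrACA -big_split; congr (_ + _).
by apply: eq_bigr => k _; rewrite mulrDl.
Qed.

Lemma tjurina_idealM g x y : O y -> tjurina_ideal g a x -> tjurina_ideal g a (y * x).
Proof.
move=> hy [u [v [hu hv ->]]]; exists (y * u), (fun k => y * v k); split.
- exact: local_ringM.
- by move=> k; apply: local_ringM.
- by rewrite mulrDr mulrA mulr_sumr; congr (_ + _); apply: eq_bigr => k _; rewrite mulrA.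
Qed.

Lemma tjurina_idealB g x y : tjurina_ideal g a x -> tjurina_ideal g a y ->
    tjurina_ideal g a (x - y).
Proof.
move=> hx hy; apply: tjurina_idealD => //; rewrite -mulN1r; apply: tjurina_idealM => //.
by rewrite -(tofrac1 P) -tofracN; exact: local_ring_tofrac.
Qed.

End LocalRing.

Lemma clear_denominator (F : fieldType) (x y z w : F) : x != 0 -> x * z * (y / x * w) = y * z * w.
Proof. by move=> x0; field. Qed.

(** * Germs at a projective point, described by forms *)

Section PointIdeal.
Variable K : numClosedFieldType.
Local Notation S := {mpoly K[3]}.
Implicit Types (f s h : S) (p : {ffun 'I_3 -> K}).

(* The forms whose germ at p lies in the ideal generated by the partial
   derivatives of f. *)
Definition germ_ideal f (p : {ffun 'I_3 -> K}) s : Prop :=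
  exists D h, [/\ h \is D.-homog, h.@[p] != 0 & jacobian_ideal f (h * s)].

Lemma germ_is_ideal f p : is_ideal (germ_ideal f p).
Proof.
have [j0 jD jM] := jacobian_is_ideal f; split.
- exists 0%N, 1; rewrite mulr0 meval1 oner_neq0; split=> //.
  by rewrite -(expr0 ('X_ord0)); exact: dhomog_varX.
- move=> u v [D [h [hh hp hu]]] [D' [h' [hh' hp' hv]]].
  exists (D + D')%N, (h * h'); split; [exact: dhomogM|by rewrite mevalM mulf_neq0|].
  rewrite mulrDr; apply: (jD); last by rewrite -mulrA; apply: jM.
  by rewrite mulrAC mulrC; apply: jM.
- move=> c u [D [h [hh hp hu]]]; exists D, h; split => //.
  by rewrite mulrCA; apply: jM.
Qed.

Lemma germ_ideal_cancel f p D h s : h \is D.-homog -> h.@[p] != 0 ->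
  germ_ideal f p (h * s) -> germ_ideal f p s.
Proof.
move=> hh hp [D' [h' [hh' hp' hJ]]]; exists (D' + D)%N, (h' * h); split.
- exact: dhomogM.
- by rewrite mevalM mulf_neq0.
- by rewrite -mulrA.
Qed.

Lemma jacobian_germ f p s : jacobian_ideal f s -> germ_ideal f p s.
Proof.
move=> hs; exists 0%N, 1; rewrite mul1r meval1 oner_neq0; split=> //.
by rewrite -(expr0 ('X_ord0)); exact: dhomog_varX.
Qed.

(** From right to left, [h] becomes a unit of the local ring. From left to right, denominators are
    cleared and the polynomial identity is lifted to forms; the lift of the common denominator
    serves as [h]. *)
Lemma tjurina_dehomog i f (p : {ffun 'I_3 -> K}) d k s :
    p i != 0 -> (0 < d)%N -> f \is d.-homog -> s \is k.-homog ->
  tjurina_ideal (dehomog i f) (chart_point i p) (tofrac (dehomog i s)) <-> germ_ideal f p s.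
Proof.
move=> pi0 d0 hf hs; split; last first.
  move=> [D [h [hh hp [b hb]]]].
  have ha : (dehomog i h).@[chart_point i p] != 0.
    by move: hp; rewrite -(meval_dehomog pi0 hh) mulf_eq0 negb_or => /andP[].
  have -> : tofrac (dehomog i s) = (tofrac (dehomog i h))^-1 * tofrac (dehomog i (h * s)).
    by rewrite dehomogM tofracM mulKf //; exact: tofrac_neq0 ha.
  apply: tjurina_idealM; first exact: local_ring_inv.
  rewrite hb dehomog_sum (@bigD1_ord _ _ _ _ i xpredT) //= dehomogM (dehomog_euler i hf).
  exists (tofrac (dehomog i (b i) * d%:R%:MP)),
    (fun k => tofrac (dehomog i (b (lift i k)) - dehomog i (b i) * 'X_k)); split.
  - exact: local_ring_tofrac.
  - by move=> ?; exact: local_ring_tofrac.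
  - rewrite -tofracM (eq_bigr (fun k => tofrac ((dehomog i (b (lift i k)) - dehomog i (b i) * 'X_k)
      * (dehomog i f)^`M(k)))); last by move=> ? _; rewrite tofracM.
    rewrite -tofrac_sum -tofracD; congr tofrac.
    rewrite mulrBr mulrA -addrA; congr (_ + _).
    rewrite mulr_sumr -sumrN -big_split; apply: eq_bigr => l _ /=.
    by rewrite mulrBl addrC mulrA dehomogM mderiv_dehomog.
move=> [u [v [[u1 [u2 [hu2 ->]]] hv eqs]]].
have /choice [w hw] : forall k : 'I_2, exists w : {mpoly K[2]} * {mpoly K[2]},
    w.2.@[chart_point i p] != 0 /\ v k = tofrac w.1 / tofrac w.2.
  by move=> l; have [w1 [w2 [h1 h2]]] := hv l; exists (w1, w2).
(* [h'] is a common denominator of all the coefficients; [U] and [V l] are the numerators over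
   it. *)
pose h' := u2 * \prod_l (w l).2.
pose U := u1 * \prod_l (w l).2.
pose V l := u2 * (w l).1 * \prod_(l' | l' != l) (w l').2.
have ha : h'.@[chart_point i p] != 0.
  by rewrite mevalM rmorph_prod mulf_neq0 //; apply/prodf_neq0 => l _; case: (hw l).
have eqh : h' * dehomog i s = U * dehomog i f + \sum_l V l * (dehomog i f)^`M(l).
  apply/eqP; rewrite -tofrac_eq; apply/eqP.
  rewrite tofracM eqs tofracD tofrac_sum mulrDr mulr_sumr; congr (_ + _).
    by rewrite /h' /U !tofracM; apply: clear_denominator; exact: tofrac_neq0 hu2.
  apply: eq_bigr => l _; have [hl ->] := hw l.
  rewrite /h' /V (bigD1 l) //= !tofracM mulrCA -!mulrA [RHS]mulrCA !mulrA.
  rewrite [X in X * _ * _ = _]mulrAC divfK //; exact: tofrac_neq0 hl.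
have [N1 hN1] := dehomog_liftable i h'.
have [N2 hN2] := dehomog_liftable i U.
have /choice [N3 hN3] : forall l, exists N0, forall N, (N0 <= N)%N ->
    exists2 G : S, G \is N.-homog & dehomog i G = V l.
  by move=> l; exact: dehomog_liftable.
(* The identity will have degree N + k: [h'] is lifted to degree N, while [U] and [V l] are lifted
   to the degrees that match after multiplication by f and by its derivatives. *)
have [N [NN1 NN2 NN3 Nd]] : exists N, [/\ N1 <= N, N2 <= N - d, forall l, N3 l <= N - d & d <= N]%N.
  exists (N1 + N2 + \sum_l N3 l + d)%N; split=> [|||]; try lia.
  by move=> l; rewrite addnK (bigD1 l) //= addnCA leq_addr.
have [H hH dH] := hN1 N NN1.
have [|U' hU' dU'] := hN2 (N + k - d)%N; first by lia.
have /choice [V' hV'] : forall l, exists G : S, G \is (N + k - d.-1).-homog /\ dehomog i G = V l.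
  move=> l; have [|G hG dG] := hN3 l (N + k - d.-1)%N; last by exists G.
  by have := NN3 l; lia.
have hd j := dhomog_mderiv j hf.
have dN : (d <= N + k)%N by lia.
exists N, H; split=> //.
  by rewrite -(meval_dehomog pi0 hH) mulf_neq0 ?expf_neq0 // dH.
have -> : H * s = U' * f + \sum_l V' l * f^`M(lift i l).
  apply/eqP; rewrite -subr_eq0; apply/eqP; apply: (@dehomog_inj _ i (N + k)).
    apply: rpredB; first exact: dhomogM.
    apply: rpredD; first by rewrite -(subnK dN); exact: dhomogM.
    apply: rpred_sum => l _; have [h1 _] := hV' l.
    by rewrite -(subnK (leq_trans (leq_pred d) dN)); apply: dhomogM.
  rewrite dehomogB dehomogD !dehomogM dehomog_sum dH eqh dU'.
  apply/eqP; rewrite subr_eq0; apply/eqP; congr (_ + _); apply: eq_bigr => l _.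
  by rewrite dehomogM (hV' l).2 mderiv_dehomog.
have [j0 jD jM] := jacobian_is_ideal f.
apply: (jD); first by apply: jM; exact: jacobian_self hf.
apply: ideal_sum => // l _; apply: jM; exact: jacobian_deriv.
Qed.

End PointIdeal.

Lemma eventually_constant (m : nat -> nat) C :
  (forall k, m k <= m k.+1)%N -> (forall k, m k <= C)%N ->
  exists n k0, forall k, (k0 <= k)%N -> m k = n.
Proof.
move=> mono bound.
pose Q n := `[< exists k, m k = n >].
have exQ : exists n, Q n by exists (m 0%N); apply/asboolP; exists 0%N.
have ubQ n : Q n -> (n <= C)%N by move=> /asboolP [k <-].
have [n /asboolP [k0 hk0] maxn] := ex_maxnP exQ ubQ.
have monoD k l : (m k <= m (l + k))%N.
  by elim: l => // l IH; apply: leq_trans IH _; rewrite addSn.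
exists n, k0 => k kk0; apply/eqP; rewrite eqn_leq maxn; last by apply/asboolP; exists k.
by rewrite -hk0 -(subnK kk0) monoD.
Qed.

(** * Dimensions of germs and the Chinese remainder theorem *)

Section Points.
Variable K : numClosedFieldType.
Local Notation S := {mpoly K[3]}.
Local Notation forms k := (fun s : S => s \is k.-homog).
Implicit Types (f s h : S) (p q : {ffun 'I_3 -> K}).

Lemma linear_mul h : linear (fun s : S => h * s).
Proof. by move=> a u v; rewrite mulrDr scalerAr. Qed.

Lemma subspace_germ f p : subspace (germ_ideal f p).
Proof. exact: ideal_subspace (germ_is_ideal f p). Qed.

Lemma subspace_jacobian f : subspace (jacobian_ideal f).
Proof. exact: ideal_subspace (jacobian_is_ideal f). Qed.

(** A germ g/h lifts to G/H with forms of equal degree. Multiplication by H is injective modulo the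
    germ ideal, hence bijective between pieces of the same dimension n, so a form of degree [k1]
    represents the germ. *)
Lemma tjurina_number_germ f d p i n k1 : p i != 0 -> (0 < d)%N -> f \is d.-homog ->
    (forall k, (k1 <= k)%N -> qdim (forms k) (germ_ideal f p) n) ->
  tjurina_number (dehomog i f) (chart_point i p) n.
Proof.
move=> pi0 d0 hf dG; have sF k := @subspace_homog 3 K k; have sG := subspace_germ f p.
have [b hb hc] := (qdim_basis n (sF k1) sG).1 (dG k1 (leqnn _)).
pose phi s := tofrac (dehomog i s).
have phi_sum (c : {ffun 'I_n -> K}) :
    phi (\sum_j c j *: b j) = \sum_j tofrac ((c j)%:MP : {mpoly K[2]}) * phi (b j).
  rewrite /phi dehomog_sum tofrac_sum; apply: eq_bigr => j _.
  by rewrite -tofracM; congr tofrac; rewrite /dehomog comp_mpolyZ mul_mpolyC.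
exists (phi \o b) => [j|v [g [h [ha ->]]]]; first exact: local_ring_tofrac.
have [N1 hN1] := dehomog_liftable i g; have [N2 hN2] := dehomog_liftable i h.
have [G hG dG'] := hN1 (N1 + N2)%N (leq_addr _ _).
have [H hH dH] := hN2 (N1 + N2)%N (leq_addl _ _).
have Hp : H.@[p] != 0 by rewrite -(meval_dehomog pi0 hH) mulf_neq0 ?expf_neq0 // dH.
set N := (N1 + N2)%N in hG hH.
have HF (s : S) : s \is k1.-homog -> H * s \is (N + k1).-homog by move=> hs; exact: dhomogM.
have HG (s : S) : s \is k1.-homog -> (germ_ideal f p (H * s) <-> germ_ideal f p s).
  move=> hs; split; first exact: germ_ideal_cancel hH Hp.
  by case: (germ_is_ideal f p) => _ _; apply.
(* The power of X_i is 1 in the chart and only adjusts the degree. *)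
have hGX : G * 'X_i ^+ k1 \is (N + k1).-homog by apply: dhomogM => //; exact: dhomog_varX.
have [s hs sE] := qdim_inj_onto (sF k1) sG (sF (N + k1)%N) sG (linear_mul H) HF HG
  (dG k1 (leqnn _)) (dG (N + k1)%N (leq_addl _ _)) (leqnn _) hGX.
have Ts : tjurina_ideal (dehomog i f) (chart_point i p) (tofrac g / tofrac h - phi s).
  have -> : tofrac g / tofrac h - phi s = (tofrac h)^-1 * phi (G * 'X_i ^+ k1 - H * s).
    rewrite /phi dehomogB !dehomogM dG' dH.
    rewrite (_ : dehomog i ('X_i ^+ k1) = 1) ?mulr1; last first.
      by rewrite dehomogE rmorphXn /= mmapX mmap1U chart_var_self expr1n.
    by rewrite tofracB tofracM mulrBr mulKf ?(tofrac_neq0 ha) // mulrC.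
  apply: tjurina_idealM; first exact: local_ring_inv.
  apply/(tjurina_dehomog pi0 d0 hf (k := N + k1)) => //.
  by apply: rpredB => //; exact: HF.
have key (c : {ffun 'I_n -> K}) : tjurina_ideal (dehomog i f) (chart_point i p)
    (tofrac g / tofrac h - \sum_j tofrac ((c j)%:MP : {mpoly K[2]}) * phi (b j)) <->
    germ_ideal f p (s - \sum_j c j *: b j).
  have hl : s - \sum_j c j *: b j \is k1.-homog.
    by apply: rpredB => //; apply: rpred_sum => j _; apply: dhomogZ.
  rewrite -(tjurina_dehomog pi0 d0 hf hl) dehomogB tofracB -/(phi s) -[tofrac (dehomog i _)]/(phi
      _) phi_sum.
  split=> h1; last first.
    by have := tjurina_idealD Ts h1; rewrite addrA subrK.
  by have := tjurina_idealB h1 Ts; rewrite opprB addrC subrKA.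
have [c [hc1 hc2]] := hc s hs; exists c; split; first exact/key.
by move=> c' /key; exact: hc2.
Qed.

(** A coordinate that does not vanish at p acts injectively, so the dimensions increase with the
    degree; they are bounded by those of M(f), hence they stabilize at their maximum. *)
Lemma germ_dim f p C : (exists i, p i != 0) ->
    (forall k n, qdim (forms k) (jacobian_ideal f) n -> (n <= C)%N) ->
  exists n, (exists k1, forall k, (k1 <= k)%N -> qdim (forms k) (germ_ideal f p) n) /\
            (forall k m, qdim (forms k) (germ_ideal f p) m -> (m <= n)%N).
Proof.
move=> [i pi0] bound; have sF k := @subspace_homog 3 K k; have sG := subspace_germ f p.
have sI (I : S -> Prop) k : subspace I -> subspace (fun s => s \is k.-homog /\ I s).
  by move=> [i0 iP]; split=> [|a u v [hu iu] [hv iv]]; split;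
      [exact: (sF k).1|done|exact: (sF k).2|exact: iP].
have dims k : exists m, qdim (forms k) (germ_ideal f p) m /\ (m <= C)%N.
  have J0 v : v \is k.-homog -> v = 0 -> v \is k.-homog /\ jacobian_ideal f v.
    by move=> hv v0; split=> //; rewrite v0; exact: (subspace_jacobian f).1.
  have [a [_ [da _ _]]] := qdim_sub (sF k) (sI _ k (subspace_jacobian f))
    J0 (fun v hv => hv.1) (qdim_homog 2 K k).
  have dJ : qdim (forms k) (jacobian_ideal f) a by apply: qdim_eq da => v hv; split=> [[]|].
  have [b [c [db _ bc]]] := qdim_sub (sF k) (sI _ k sG) 
    (fun v hv hj => conj hv (jacobian_germ p hj)) (fun v hv => hv.1) dJ.
  exists b; split; first by apply: qdim_eq db => v hv; split=> [[]|].
  by apply: leq_trans (bound _ _ dJ); rewrite -bc leq_addr.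
have /choice [m hm] := dims.
have hX : ('X_i : S).@[p] != 0 by rewrite mevalXU.
have mono k : (m k <= m k.+1)%N.
  have [d1 _] := hm k; have [d2 _] := hm k.+1.
  apply: (qdim_map_le (sF k) (sF k.+1) (linear_mul 'X_i) _ _ d1 d2) => v hv.
    by exact: dhomogM (dhomog_var _ _) hv.
  exact: germ_ideal_cancel (dhomog_var _ _) hX.
have [n [k1 hn]] := eventually_constant mono (fun k => (hm k).2).
exists n; split; first by exists k1 => k hk; rewrite -(hn k hk); case: (hm k).
move=> k m' dm; rewrite (qdim_uniq (sF k) dm (hm k).1) -(hn (k1 + k)%N (leq_addr _ _)).
by elim: k1 {hn} => // l IH; apply: leq_trans IH _; rewrite addSn.
Qed.

(* The n + 1 forms c^j x^(n-j) are linearly dependent modulo the germ ideal; the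
   lowest power of c in such a relation has a coefficient which is a unit at p. *)
Lemma germ_nilpotent f p n (c x : S) :
    (forall k m, qdim (forms k) (germ_ideal f p) m -> (m <= n)%N) ->
    c \is 1.-homog -> x \is 1.-homog -> x.@[p] != 0 -> c.@[p] = 0 ->
  exists j, germ_ideal f p (c ^+ j).
Proof.
move=> bound hc hx xp cp; have sF k := @subspace_homog 3 K k; have sG := subspace_germ f p.
have sI : subspace (fun s : S => s \is n.-homog /\ germ_ideal f p s).
  by split=> [|a u v [hu iu] [hv iv]]; split; [exact: (sF n).1|exact: sG.1|exact: (sF n).2|exact:
      sG.2].
have G0 v : v \is n.-homog -> v = 0 -> v \is n.-homog /\ germ_ideal f p v.
  by move=> hv v0; split=> //; rewrite v0; exact: sG.1.
have [a [_ [da _ _]]] := qdim_sub (sF n) sI G0 (fun v hv => hv.1) (qdim_homog 2 K n).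
have {da}dG : qdim (forms n) (germ_ideal f p) a by apply: qdim_eq da => v hv; split=> [[]|].
have an := bound _ _ dG; have [pi [l o k]] := dG.
have hX m (y : S) : y \is 1.-homog -> y ^+ m \is m.-homog.
  by move=> hy; rewrite -[m in m.-homog]mul1n; exact: dhomog_exp.
pose u (j : 'I_n.+1) := c ^+ j * x ^+ (n - j).
have hu j : u j \is n.-homog.
  by rewrite -[n in n.-homog](subnKC (ltn_ord j : (j <= n)%N)); apply: dhomogM; exact: hX.
pose M := \matrix_(j < n.+1) pi (u j).
have [al al0 alM] : exists2 al : 'rV[K]_n.+1, al != 0 & al *m M = 0.
  have : kermx M != 0.
    by rewrite kermx_eq0 /row_free neq_ltn (leq_ltn_trans (rank_leq_col M)).
  by case/rowV0Pn => v /sub_kermxP hv v0; exists v.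
have sum0 : germ_ideal f p (\sum_j al 0 j *: u j).
  apply/k; first exact: (@subspace_lincomb _ _ _ _ _ _ (sF n) hu).
  rewrite (coord_lincomb (sF n) l) // -[RHS]alM mulmx_sum_row.
  by apply: eq_bigr => j _; rewrite rowK.
have /rV0Pn [j0 aj0] := al0.
case: (arg_minnP (fun j : 'I_n.+1 => val j) (P := fun j => al 0 j != 0) aj0) => j1 aj1 minj.
exists j1.
pose H := \sum_(j < n.+1 | (j1 <= j)%N) al 0 j *: (c ^+ (j - j1) * x ^+ (n - j)).
have hH : H \is (n - j1).-homog.
  apply: rpred_sum => j jj; apply: dhomogZ.
  have -> : (n - j1 = (j - j1) + (n - j))%N by have := ltn_ord j; lia.
  by apply: dhomogM; exact: hX.
apply: (germ_ideal_cancel hH).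
  rewrite /H (bigD1 j1) //= subnn expr0 mul1r mevalD mevalZ rmorphXn /= rmorph_sum big1 ?addr0.
    by rewrite mulf_neq0 // expf_neq0.
  move=> j /andP [jj nj]; rewrite /= mevalZ mevalM rmorphXn /= cp expr0n.
  have -> : (j - j1 == 0)%N = false by apply/negP => /eqP e; move/negP: nj; apply;
      apply/eqP/val_inj => /=; lia.
  by rewrite mul0r mulr0.
suff -> : H * c ^+ j1 = \sum_j al 0 j *: u j by [].
rewrite /H mulr_suml [RHS](bigID (fun j : 'I_n.+1 => (j1 <= j)%N)) /= [X in _ = _ + X]big1 ?addr0.
  by apply: eq_bigr => j jj; rewrite -scalerAl mulrAC -exprD subnK.
move=> j jj; have [->|/minj] := eqVneq (al 0 j) 0; first by rewrite scale0r.
by rewrite (negPf jj).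
Qed.

Lemma proj_eq_or_separated p q : (exists i, p i != 0) -> (exists i, q i != 0) ->
  proj_eq p q \/ exists c : S, [/\ c \is 1.-homog, c.@[q] = 0 & c.@[p] != 0].
Proof.
move=> [i pi0] [j qj0].
(* The forms q_j X_l - q_l X_j vanish at q; as q_j is nonzero, they all vanish at p only if p and q
   are proportional. *)
have [h|] := pselect (forall i, q j * p i = q i * p j); last first.
  move/existsNP => [l /eqP hl]; right; exists (q j *: 'X_l - q l *: 'X_j); split.
  - by apply: rpredB; apply: dhomogZ; exact: dhomog_var.
  - by rewrite mevalB !mevalZ !mevalXU mulrC subrr.
  - by rewrite mevalB !mevalZ !mevalXU subr_eq0.
left; have pj0 : p j != 0.
  by apply: contraNneq pi0 => pj; have := h i; rewrite pj mulr0 => /eqP;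
      rewrite mulf_eq0 (negPf qj0).
exists (q j / p j); first by rewrite mulf_neq0 ?invr_neq0.
by move=> l; rewrite mulrAC h mulfK.
Qed.

(* The forms E_j, vanishing in the germs at all the points but p_j, where they are
   units, make the map from S_k to the product of its quotients at the points onto. *)
Lemma points_crt f C N (pt : 'I_N -> {ffun 'I_3 -> K}) (n : 'I_N -> nat) :
    (forall k m, qdim (forms k) (jacobian_ideal f) m -> (m <= C)%N) ->
    (forall j, exists i, pt j i != 0) ->
    (forall j l, proj_eq (pt j) (pt l) -> j = l) ->
    (forall j, exists k1, forall k, (k1 <= k)%N -> qdim (forms k) (germ_ideal f (pt j)) (n j)) ->
  exists k1, forall k, (k1 <= k)%N ->
    qdim (forms k) (fun s => forall j, germ_ideal f (pt j) s) (\sum_j n j).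
Proof.
move=> bound nz inj dG; have sF k := @subspace_homog 3 K k.
(* A linear form that vanishes at p_l but not at p_j is nilpotent in the germ at p_l, so one of its
   powers separates the two points. *)
have sepE j l : exists eD : S * nat, [/\ eD.1 \is eD.2.-homog, l != j -> germ_ideal f (pt l) eD.1 &
    eD.1.@[pt j] != 0].
  have [->|lj] := eqVneq l j.
    exists (1, 0%N); split=> //=; last by rewrite meval1 oner_neq0.
    by rewrite -(expr0 ('X_ord0)); exact: dhomog_varX.
  have [/inj jl|[c [hc cl cj]]] := proj_eq_or_separated (nz j) (nz l).
    by rewrite jl eqxx in lj.
  have [m [_ hm]] := germ_dim (nz l) bound; have [i li0] := nz l.
  have [|r hr] := germ_nilpotent hm hc (dhomog_var K i) _ cl; first by rewrite mevalXU.
  exists (c ^+ r, r); split=> //=; last by rewrite rmorphXn expf_neq0.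
  by rewrite -[r in r.-homog]mul1n; exact: dhomog_exp.
have /choice [E hE] : forall j, exists eD : S * nat, [/\ eD.1 \is eD.2.-homog,
    forall l, l != j -> germ_ideal f (pt l) eD.1 & eD.1.@[pt j] != 0].
  move=> j; have /choice [e he] := sepE j.
  exists (\prod_l (e l).1, (\sum_l (e l).2)%N); split=> /=.
  - elim/big_rec2: _ => [|l D p _ hp]; first by rewrite -(expr0 ('X_ord0)); exact: dhomog_varX.
    by apply: dhomogM => //; case: (he l).
  - move=> l lj; rewrite (bigD1 l) //= mulrC; case: (germ_is_ideal f (pt l)) => _ _; apply.
    by case: (he l) => _ /(_ lj).
  - by rewrite rmorph_prod; apply/prodf_neq0 => l _; case: (he l).
have /choice [k1 hk1] := dG.
exists (\sum_j (k1 j + (E j).2))%N => k hk.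
have hk' j : (k1 j + (E j).2 <= k)%N by apply: leq_trans hk; rewrite (bigD1 j) //= leq_addr.
apply: qdim_crt => // [j|v hv]; first by apply: hk1; have := hk' j; lia.
(* As E_j is a unit at p_j, v_j can be divided by it modulo the germ ideal; then E_j w_j agrees with
   v_j at p_j and is zero at the other points. *)
have /choice [w hw] : forall j, exists w, w \is (k - (E j).2).-homog /\ germ_ideal f (pt j) (v j
    - (E j).1 * w).
  move=> j; have [h1 h2 h3] := hE j; have sG := subspace_germ f (pt j).
  have e1 : ((E j).2 + (k - (E j).2) = k)%N by have := hk' j; lia.
  have EF (s : S) : s \is (k - (E j).2).-homog -> (E j).1 * s \is k.-homog.
    by move=> hs; rewrite -e1; exact: dhomogM.
  have EG (s : S) : s \is (k - (E j).2).-homog ->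
      (germ_ideal f (pt j) ((E j).1 * s) <-> germ_ideal f (pt j) s).
    move=> hs; split; first exact: germ_ideal_cancel h1 h3.
    by case: (germ_is_ideal f (pt j)) => _ _; apply.
  have [k1k k1k'] : (k1 j <= k /\ k1 j <= k - (E j).2)%N by have := hk' j; lia.
  have [w hw wE] := qdim_inj_onto (sF _) sG (sF k) sG (linear_mul (E j).1) EF EG
    (hk1 j _ k1k') (hk1 j _ k1k) (leqnn _) (hv j).
  by exists w.
exists (\sum_j (E j).1 * w j).
  apply: rpred_sum => j _; have [h1 _ _] := hE j; have [h2 _] := hw j.
  have {1}-> : (k = (E j).2 + (k - (E j).2))%N by have := hk' j; lia.
  exact: dhomogM.
move=> j; have [i0 iD iM] := germ_is_ideal f (pt j).
rewrite (bigD1 j) //= addrAC; apply: (iD).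
  have [_ h] := hw j; rewrite -opprB -mulN1r; exact: iM.
apply: ideal_sum => [|l lj]; first exact: germ_is_ideal.
rewrite mulrC; apply: iM; have [_ h _] := hE l; apply: h; by rewrite eq_sym.
Qed.

End Points.

(** * Binary forms in the Jacobian ideal *)

(** Let P be a common factor of F and F' of least positive degree. It is coprime to P', since a
    nonconstant common factor of P and P' would be smaller. Writing F = P Q, one sees that P divides
    Q P', hence Q. The scalars stem from division over a domain. *)
Lemma repeated_factor (R : idomainType) (F : {poly R}) :
    (forall (x : R) n, x *+ n.+1 = 0 -> x = 0) ->
    F != 0 -> (1 < size (gcdp F F^`()))%N ->
  exists (c : R) (P Q : {poly R}), [/\ c != 0, (1 < size P)%N & c *: F = P ^+ 2 * Q].
Proof.
move=> char0 F0 hg.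
pose D n := `[< exists P : {poly R}, [/\ size P = n, (1 < n)%N, P %| F & P %| F^`()] >].
have exD : exists n, D n.
  by exists (size (gcdp F F^`())); apply/asboolP; exists (gcdp F F^`());
      rewrite dvdp_gcdl dvdp_gcdr.
have [n /asboolP [P [sP n1 PF PF']] minP] := ex_minnP exD.
have P0 : P != 0 by apply: contraTneq n1 => P0; rewrite -sP P0 size_poly0.
have P'0 : P^`() != 0.
  apply/eqP => /polyP /(_ n.-2); rewrite coef_deriv coef0 => /char0 /eqP.
  have -> : n.-2.+1 = (size P).-1 by rewrite sP; lia.
  by rewrite -lead_coefE lead_coef_eq0 (negPf P0).
have cop : coprimep P P^`().
  rewrite coprimep_def; set g := gcdp P _.
  have g0 : size g != 0%N by rewrite size_poly_eq0 gcdp_eq0 negb_and P0.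
  have [g1|] := leqP (size g) 1; first by rewrite eqn_leq g1 lt0n.
  move=> g1; have : (n <= size g)%N.
    apply: minP; apply/asboolP; exists g; split => //.
      exact: dvdp_trans (dvdp_gcdl _ _) PF.
    exact: dvdp_trans (dvdp_gcdl _ _) PF'.
  have := dvdp_leq P'0 (dvdp_gcdr P P^`()); have := lt_size_deriv P0.
  by rewrite -/g sP => h1 h2 h3; move: (leq_trans h3 h2); rewrite leqNgt h1.
have /Pdiv.Idomain.dvdpP [[c Q] /= c0 cF] := PF.
have : P %| Q * P^`().
  have : P %| (c *: F)^`() by rewrite derivZ dvdpZr.
  by rewrite cF derivM dvdp_addr // dvdp_mull.
rewrite mulrC (Gauss_dvdpr _ cop) => /Pdiv.Idomain.dvdpP [[e Q2] /= e0 eQ].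
exists (e * c), P, Q2; split; [exact: mulf_neq0|by rewrite sP|].
by rewrite -scalerA cF scalerAl eQ; ring.
Qed.

Lemma bezout_constant (R : idomainType) (p q : {poly R}) : size (gcdp p q) = 1%N ->
  exists (c : R) (u v : {poly R}), c != 0 /\ u * p + v * q = c%:P.
Proof.
move=> /eqP/size_poly1P [b b0 eb].
have [[u v] /= /Pdiv.Idomain.eqpP [[c1 c2] /= /andP [c10 c20]]] := Bezoutp p q.
rewrite eb => e; exists (c2 * b), (c1 *: u), (c1 *: v); split; first exact: mulf_neq0.
by rewrite -!scalerAl -scalerDr e -mul_polyC -rmorphM.
Qed.

Section Eliminants.
Variables (K : numClosedFieldType) (i j l : 'I_3).
Hypotheses (ij : i != j) (il : i != l) (jl : j != l).
Local Notation S := {mpoly K[3]}.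
Local Notation B := {poly {poly K}}.
Local Notation frac := {fraction {mpoly K[3]}}.
Implicit Types (f g h : S) (c : {poly K}).

(** This homogenizes [c] to degree N by means of X_l. Coefficients beyond N are lost, whence the
    bounds on [size c] below. *)
Definition binary_form N c : S := \sum_(b < N.+1) c`_b *: ('X_j ^+ b * 'X_l ^+ (N - b)).

Lemma binary_form_homog N c : binary_form N c \is N.-homog.
Proof.
apply: rpred_sum => b _; apply: dhomogZ.
rewrite -[N in N.-homog](subnKC (ltn_ord b : (b <= N)%N)).
by apply: dhomogM; exact: dhomog_varX.
Qed.

Definition bivariate_const := [the {rmorphism K -> B} of @polyC {poly K} \o @polyC K].
(** In the chart X_l = 1, the variable X_i to be eliminated is the outer one, so that gcds are taken
    over the domain K[X_j]. *)
Definition bivariate_var (v : 'I_3) : B :=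
  if v == i then 'X else if v == j then 'X%:P else 1.
Local Notation phi := (mmap bivariate_const bivariate_var).

Lemma bivariate_i : bivariate_var i = 'X.
Proof. by rewrite /bivariate_var eqxx. Qed.
Lemma bivariate_j : bivariate_var j = 'X%:P.
Proof. by rewrite /bivariate_var eq_sym (negPf ij) eqxx. Qed.
Lemma bivariate_l : bivariate_var l = 1.
Proof. by rewrite /bivariate_var ![l == _]eq_sym (negPf il) (negPf jl). Qed.

Lemma bivariate_binary_form N c : (size c <= N.+1)%N -> phi (binary_form N c) = c%:P.
Proof.
move=> sc; have {2}-> : c = \poly_(b < N.+1) c`_b.
  apply/polyP => b; rewrite coef_poly; case: ltnP => // /(leq_trans sc).
  exact: nth_default.
rewrite poly_def !rmorph_sum; apply: eq_bigr => b _ /=.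
rewrite mmapZ rmorphM !rmorphXn /= !mmapX !mmap1U bivariate_j bivariate_l expr1n mulr1.
by rewrite -mul_polyC rmorphM rmorphXn.
Qed.

Lemma bivariate_liftable (b : B) : liftable bivariate_const bivariate_var b.
Proof.
have hl := bivariate_l.
have hc c : liftable bivariate_const bivariate_var c%:P.
  elim/poly_ind: c => [|c a IH].
    by have := liftable_const bivariate_const hl 0; rewrite rmorph0.
  rewrite rmorphD rmorphM /= -bivariate_j; apply: liftableD.
    by apply: liftableM => //; exact: liftable_var hl _.
  exact: (liftable_const bivariate_const hl).
elim/poly_ind: b => [|b a IH]; first exact: hc.
by apply: liftableD => //; apply: liftableM => //; rewrite -bivariate_i; exact: liftable_var hl _.
Qed.

Lemma bivariate_inj N g : g \is N.-homog -> phi g = 0 -> g = 0.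
Proof.
move=> hg g0.
have X0 : tofrac ('X_l : S) != 0 by rewrite tofrac_eq0 -msize_poly_eq0 msizeX.
pose c1 := [the {rmorphism K -> frac} of @tofrac S \o @mpolyC 3 K].
pose psi1 := [the {rmorphism {poly K} -> frac} of
  horner_eval (tofrac ('X_j : S) / tofrac 'X_l) \o map_poly c1].
pose psi := [the {rmorphism B -> frac} of
  horner_eval (tofrac ('X_i : S) / tofrac 'X_l) \o map_poly psi1].
apply: (dehom_inj (i := l) (psi := psi) _ _ hg g0) => [a|v].
  by rewrite /= map_polyC /= /horner_eval hornerC /= map_polyC hornerC.
have [->|vi] := eqVneq v i; first by rewrite bivariate_i /= map_polyX /horner_eval hornerX.
have [->|vj] := eqVneq v j.
  by rewrite bivariate_j /= map_polyC /= map_polyX /horner_eval hornerC hornerX.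
rewrite /bivariate_var (negPf vi) (negPf vj) rmorph1; have -> : v = l; last by rewrite divff.
apply/val_inj; move: ij il jl vi vj; rewrite -!val_eqE /=.
case: i j l v => [i' hi] [j' hj] [l' hl] [v' hv] /=; lia.
Qed.

Lemma bivariate_deriv f : (phi f)^`() = phi f^`M(i).
Proof.
rewrite (@mmap_derivation _ _ _ _ _ (@deriv {poly K})).
- rewrite (bigD1 i) //= bivariate_i derivX mulr1 big1 ?addr0 // => v vi.
  rewrite /bivariate_var (negPf vi); case: ifP => _; last by rewrite (derivC 1) mulr0.
  by rewrite derivC mulr0.
- by move=> x y; rewrite derivD.
- by move=> x y; rewrite derivM.
- by move=> a; rewrite /= derivC.
Qed.

Definition substitute (v : 'I_3) (t : S) : S -> S :=
  mmap (@mpolyC 3 K) (fun w => if w == v then t else 'X_w).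

(** Substituting t for X_v takes values in a domain and only multiples of X_v - t are sent to 0; the
    hypothesis on t makes X_v - t itself go to 0. *)
Lemma linear_form_prime v t g h w :
    substitute v t t = t -> g * h = ('X_v - t) * w ->
  (exists g', g = ('X_v - t) * g') \/ (exists h', h = ('X_v - t) * h').
Proof.
move=> tt e; set la := 'X_v - t in e *.
pose I (p : S) := exists q, p = la * q.
have iI : is_ideal I.
  split; first by exists 0; rewrite mulr0.
    by move=> _ _ [p ->] [q ->]; exists (p + q); rewrite mulrDr.
  by move=> a _ [p ->]; exists (a * p); rewrite mulrCA.
have sub0 p : substitute v t p = 0 -> I p.
  move=> p0; have <- : p - substitute v t p = p by rewrite p0 subr0.
  have -> : p = mmap (@mpolyC 3 K) (fun w => 'X_w) p.
    rewrite {1}[p]mpolyE; apply: eq_bigr => m _.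
    by rewrite mul_mpolyC; congr (_ *: _); rewrite mmap1_id.
  rewrite (_ : substitute v t _ = substitute v t p); last first.
    congr (substitute v t _); rewrite [RHS]mpolyE; apply: eq_bigr => m _.
    by rewrite mul_mpolyC; congr (_ *: _); rewrite mmap1_id.
  apply: mmap_congr => // u; case: eqP => [->|_]; first by exists 1; rewrite mulr1.
  by rewrite subrr; case: iI.
have : substitute v t g * substitute v t h = 0.
  rewrite -[LHS](rmorphM (mmap (@mpolyC 3 K) _)) /= e /la rmorphM rmorphB /= mmapX mmap1U eqxx.
  by rewrite -/(substitute v t t) tt subrr mul0r.
by move/eqP; rewrite mulf_eq0 => /orP [] /eqP /sub0; [left|right].
Qed.

(** The prime X_v - t divides G or H. If it divides G, one copy cancels and the other moves to H;
    being constant in X_i, it takes nothing from the degree of G in X_i. *)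
Lemma cancel_linear_form v t f G H N :
    substitute v t t = t -> 'X_v - t \is 1.-homog -> size (phi ('X_v - t)) = 1%N ->
    f != 0 -> G \is N.-homog -> (1 < size (phi G))%N -> ('X_v - t) * f = G ^+ 2 * H ->
  exists N' G' H', [/\ G' \is N'.-homog, (1 < size (phi G'))%N & f = G' ^+ 2 * H'].
Proof.
move=> tt hla sla f0 hG sG e; set la := 'X_v - t in e hla sla *.
have la0 : la != 0 by apply: contra_eqN sla => /eqP ->; rewrite rmorph0 size_poly0.
have G0 : G != 0 by apply: contraTneq sG => ->; rewrite rmorph0 size_poly0.
have divG : (exists g', G = la * g') \/ (exists H', H = la * H').
  move: e; rewrite expr2 -mulrA => /esym e.
  have [|[w hw]] := linear_form_prime tt e; first by left.
  have [|] := linear_form_prime tt (hw : G * H = _); by [left|right].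
have [[g' eG]|[H' eH]] := divG; last first.
  exists N, G, H'; split=> //; apply: (mulfI la0); rewrite e eH; ring.
have N0 : (0 < N)%N.
  rewrite lt0n; apply: contraTneq sG => N0; rewrite N0 in hG.
  by rewrite (dhomog_const hG) mmapC -leqNgt size_polyC_leq1.
exists N.-1, g', (la * H); split.
- by apply: (dhomog_factor la0 hla); rewrite -eG add1n prednK.
- move: sG; rewrite eG rmorphM /=; have /eqP/size_poly1P [a a0 ->] := sla.
  by rewrite mul_polyC size_scale.
- by apply: (mulfI la0); rewrite e eG; ring.
Qed.

Lemma binary_form_const N (a : K) : binary_form N a%:P = a *: 'X_l ^+ N.
Proof.
rewrite /binary_form (bigD1 ord0) //= coefC eqxx expr0 mul1r subn0 big1 ?addr0 // => b b0.
by rewrite coefC -[(b : nat) == 0%N]/(b == ord0) (negPf b0) scale0r.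
Qed.

Lemma linear_form_homog (a : K) : 'X_j - a *: 'X_l \is [in K[3], 1.-homog].
Proof. by apply: rpredB; [|apply: dhomogZ]; exact: dhomog_var. Qed.

Lemma binary_formM N (a : K) c : (size c <= N.+1)%N ->
  binary_form N.+1 (('X - a%:P) * c) = ('X_j - a *: 'X_l) * binary_form N c.
Proof.
move=> sc; apply/eqP; rewrite -subr_eq0; apply/eqP; apply: (@bivariate_inj N.+1).
  apply: rpredB; first exact: binary_form_homog.
  by rewrite -[N.+1]add1n; apply: dhomogM; [exact: linear_form_homog|exact: binary_form_homog].
rewrite rmorphB rmorphM rmorphB /= mmapZ !bivariate_binary_form //; last first.
  have [->|c0] := eqVneq c 0; first by rewrite mulr0 size_poly0.
  by rewrite size_monicM ?monicXsubC // size_XsubC.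
rewrite !mmapX !mmap1U bivariate_j bivariate_l mulr1 rmorphM rmorphB /=.
by rewrite subrr.
Qed.

(* A Gauss lemma: binary forms are products of linear forms, which are prime. *)
Lemma cancel_binary_form c : c != 0 -> forall M N f G H,
    (size c <= M.+1)%N -> f != 0 -> G \is N.-homog -> (1 < size (phi G))%N ->
    binary_form M c * f = G ^+ 2 * H ->
  exists N' G' H', [/\ G' \is N'.-homog, (1 < size (phi G'))%N & f = G' ^+ 2 * H'].
Proof.
have substV v (a : K) w : w != v -> substitute v (a *: 'X_w) (a *: 'X_w) = a *: 'X_w.
  by move=> /negPf wv; rewrite /substitute mmapZ mmapX mmap1U wv mul_mpolyC.
move: {2}(size c) (leqnn (size c)) => n.
elim: n c => [|n IH] c sn c0 M N f G H sc f0 hG sG e.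
  by move: sn; rewrite leqn0 size_poly_eq0 (negPf c0).
have [s1|s1] := eqVneq (size c) 1%N; last first.
  have /closed_rootP [a /factor_theorem [c' ec]] := s1; rewrite mulrC in ec.
  have c'0 : c' != 0 by apply: contraNneq c0 => c'0; rewrite ec c'0 mulr0.
  have sc' : size c = (size c').+1 by rewrite ec size_monicM ?monicXsubC // size_XsubC.
  case: M sc e => [|M] sc e.
    by move: sc s1; rewrite sc' ltnS leqn0 size_poly_eq0 (negPf c'0).
  rewrite ec binary_formM in e; last by rewrite sc' in sc.
  have [|||||||N' [G' [H' [hG' sG' e']]]] := @cancel_linear_form j (a *: 'X_l) (binary_form M c'
      * f) G H N.
  - by apply: substV; rewrite eq_sym.
  - exact: linear_form_homog.
  - rewrite rmorphB /= mmapZ !mmapX !mmap1U bivariate_j bivariate_l mulr1 /= -rmorphB.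
    by rewrite size_polyC polyXsubC_eq0.
  - rewrite mulf_neq0 //; apply: contraNneq c'0 => b0.
    have := bivariate_binary_form (N := M) (c := c'); rewrite b0 rmorph0 => /(_ _)/esym/eqP.
    by rewrite polyC_eq0; apply; rewrite -ltnS -sc'.
  - by [].
  - by [].
  - by rewrite mulrA.
  by apply: (IH c' _ c'0 M N' f G' H') => //; [rewrite -ltnS -sc'|rewrite -ltnS -sc'].
(* For a constant [c] the binary form is a multiple of a power of X_l, which is cancelled one factor
   at a time. *)
have /size_poly1P [a a0 ec] : size c == 1%N by rewrite s1.
rewrite ec binary_form_const in e.
have {e} : exists H0, 'X_l ^+ M * f = G ^+ 2 * H0.
  exists (a^-1 *: H); rewrite -scalerAr -e -scalerAl scalerA mulVf // scale1r.
  by [].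
elim: M {sc} N G hG sG => [|M IHM] N G hG sG [H0 e].
  by exists N, G, H0; rewrite -e expr0 mul1r.
have [|||||||N' [G' [H' [hG' sG' e']]]] := @cancel_linear_form l 0 ('X_l ^+ M * f) G H0 N.
- by rewrite /substitute rmorph0.
- by rewrite subr0; exact: dhomog_var.
- by rewrite subr0 mmapX mmap1U bivariate_l size_poly1.
- by rewrite mulf_neq0 // expf_neq0 // -msize_poly_eq0 msizeX.
- by [].
- by [].
- by rewrite subr0 mulrA -exprS.
by apply: (IHM N' G') => //; exists H'.
Qed.

Definition no_square f : Prop :=
  forall N G H, (0 < N)%N -> G \is N.-homog -> f <> G ^+ 2 * H.

(** View f as a polynomial F in X_i over K[X_j]. A common factor of F and F' would give F a repeated
    factor up to a scalar in K[X_j], and cancelling the homogenized scalar would give f a square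
    factor. So Bezout puts a nonzero element of K[X_j] into (F, F'). *)
Lemma eliminant d f : (0 < d)%N -> f \is d.-homog -> f != 0 -> no_square f ->
  exists N c, [/\ c != 0, (size c <= N.+1)%N & jacobian_ideal f (binary_form N c)].
Proof.
move=> d0 hf f0 nsq; have F0 : phi f != 0.
  by apply: contraNneq f0 => F0; apply/eqP; exact: bivariate_inj hf F0.
have [gs|gs] := ltnP 1 (size (gcdp (phi f) (phi f)^`())).
  have char0 (x : {poly K}) n : x *+ n.+1 = 0 -> x = 0.
    by rewrite -scaler_nat => /eqP; rewrite scaler_eq0 pnatr_eq0 => /eqP.
  have [c [P [Q [c0 sP e]]]] := repeated_factor char0 F0 gs.
  have [N1 hN1] := bivariate_liftable P; have [N2 hN2] := bivariate_liftable Q.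
  (* With G and H both of degree N, the homogenized scalar must have degree 3N - d, and N is large
     enough for this to hold all coefficients of [c]. *)
  have [N [leN1 leN2 leN]] : exists N, [/\ N1 <= N, N2 <= N & d + size c <= N]%N.
    by clear; exists (N1 + N2 + (d + size c))%N; split; lia.
  have [G hG eG] := hN1 N leN1; have [H hH eH] := hN2 N leN2.
  have sN : (size c <= (N + N + N - d).+1)%N by clear -leN; lia.
  have eN3 : (N + N + N - d + d = N + N + N)%N by clear -leN; lia.
  have sG : (1 < size (phi G))%N by rewrite eG.
  have eN : binary_form (N + N + N - d) c * f = G ^+ 2 * H.
    apply/eqP; rewrite -subr_eq0; apply/eqP; apply: (@bivariate_inj (N + N + N)%N).
      apply: rpredB; last by rewrite expr2; apply: dhomogM => //; exact: dhomogM.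
      by have := dhomogM (binary_form_homog (N + N + N - d) c) hf; rewrite eN3.
    by rewrite rmorphB !rmorphM /= eG eH -expr2 -e bivariate_binary_form // mul_polyC subrr.
  have [N' [G' [H' [hG' sG' e']]]] := cancel_binary_form c0 sN f0 hG sG eN.
  case: (nsq N' G' H') => //; rewrite lt0n; apply: contraTneq sG' => N0; rewrite N0 in hG'.
  by rewrite (dhomog_const hG') mmapC -leqNgt size_polyC_leq1.
have [|c [u [v [c0 e]]]] := @bezout_constant _ (phi f) (phi f)^`().
  by apply/eqP; rewrite eqn_leq gs lt0n size_poly_eq0 gcdp_eq0 negb_and F0.
rewrite bivariate_deriv in e.
have [N1 hN1] := bivariate_liftable u; have [N2 hN2] := bivariate_liftable v.
have [N [le1 le2 le3 le4]] : exists N, [/\ N1 <= N - d, N2 <= N - d.-1, d <= N & size c <= N.+1]%N.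
  by clear; exists (N1 + N2 + d + size c)%N; split; lia.
have [U hU eU] := hN1 _ le1; have [V hV eV] := hN2 _ le2.
exists N, c; split; [exact: c0|exact: le4|].
have -> : binary_form N c = U * f + V * f^`M(i).
  apply/eqP; rewrite -subr_eq0; apply/eqP; apply: (@bivariate_inj N).
    apply: rpredB; first exact: binary_form_homog.
    apply: rpredD; first by rewrite -(subnK le3); exact: dhomogM.
    rewrite -(subnK (leq_trans (leq_pred d) le3)); apply: dhomogM => //.
    exact: dhomog_mderiv.
  by rewrite rmorphB rmorphD !rmorphM /= bivariate_binary_form // eU eV e subrr.
have [j0 jD jM] := jacobian_is_ideal f.
apply: (jD); apply: jM; [exact: jacobian_self d0 hf|exact: jacobian_deriv].
Qed.

End Eliminants.

(** * Common zeros *)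

Section Nullstellensatz.
Variable K : numClosedFieldType.
Local Notation S := {mpoly K[3]}.
Implicit Types (f g h s : S) (I : S -> Prop) (p v : {ffun 'I_3 -> K}).

Definition has_eliminants f : Prop := forall i j l : 'I_3, i != j -> i != l -> j != l ->
  exists N (c : {poly K}), [/\ c != 0, (size c <= N.+1)%N & jacobian_ideal f (binary_form j l N c)].

Lemma no_square_eliminants d f : (0 < d)%N -> f \is d.-homog -> f != 0 -> no_square f ->
  has_eliminants f.
Proof. by move=> d0 hf f0 nsq i j l ij il jl; exact: (eliminant ij il jl d0 hf f0 nsq). Qed.

Lemma is_ideal_add I h : is_ideal I -> is_ideal (fun s => exists q w, I q /\ s = q + h * w).
Proof.
move=> [i0 iD iM]; split.
- by exists 0, 0; rewrite mulr0 addr0.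
- move=> _ _ [q [w [hq ->]]] [q' [w' [hq' ->]]]; exists (q + q'), (w + w').
  by split; [exact: iD|rewrite mulrDr addrACA].
- move=> a _ [q [w [hq ->]]]; exists (a * q), (a * w); split; first exact: iM.
  by rewrite mulrDr mulrCA.
Qed.

Section Saturation.
Variables (i j l : 'I_3).
Hypotheses (ij : i != j) (il : i != l) (jl : j != l).

Lemma binary_form_mulX N M (c : {poly K}) : (size c <= N.+1)%N ->
  binary_form j l N c * 'X_l ^+ M = binary_form j l (N + M) c.
Proof.
move=> sc; apply/eqP; rewrite -subr_eq0; apply/eqP; apply: (bivariate_inj ij il jl (N :=
    (N + M)%N)).
  apply: rpredB; last exact: binary_form_homog.
  by apply: dhomogM; [exact: binary_form_homog|exact: dhomog_varX].
rewrite rmorphB rmorphM rmorphXn /= !(bivariate_binary_form ij il jl) //; last first.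
  by apply: leq_trans sc _; rewrite ltnS leq_addr.
by rewrite mmapX mmap1U (bivariate_l K il jl) expr1n mulr1 subrr.
Qed.

(* A product of binary linear forms lies in I; if each of its factors generated,
   together with I, an ideal containing a power of X_l, then so would I. *)
Lemma saturate I N (c : {poly K}) : is_ideal I -> c != 0 -> (size c <= N.+1)%N ->
    I (binary_form j l N c) -> (forall M, ~ I ('X_l ^+ M)) ->
  exists (a : K) I', [/\ is_ideal I', forall s, I s -> I' s, I' ('X_j - a *: 'X_l) &
    forall M, ~ I' ('X_l ^+ M)].
Proof.
move=> iI; have [i0 iD iM] := iI; move: {2}(size c) (leqnn (size c)) => n.
elim: n N c => [|n IH] N c sn c0 sc Ic nI.
  by move: sn; rewrite leqn0 size_poly_eq0 (negPf c0).
have [s1|s1] := eqVneq (size c) 1%N.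
  have /size_poly1P [a a0 ec] : size c == 1%N by rewrite s1.
  case: (nI N); rewrite ec binary_form_const in Ic.
  have -> : 'X_l ^+ N = (a^-1)%:MP * (a *: 'X_l ^+ N) :> S.
    by rewrite mul_mpolyC scalerA mulVf ?scale1r.
  exact: iM.
have /closed_rootP [a /factor_theorem [c' ec]] := s1; rewrite mulrC in ec.
have c'0 : c' != 0 by apply: contraNneq c0 => c'0; rewrite ec c'0 mulr0.
have sc' : size c = (size c').+1 by rewrite ec size_monicM ?monicXsubC // size_XsubC.
case: N sc Ic => [|N] sc Ic.
  by move: sc s1; rewrite sc' ltnS leqn0 size_poly_eq0 (negPf c'0).
rewrite sc' ltnS in sc; rewrite sc' ltnS in sn.
rewrite ec (binary_formM ij il jl) // in Ic.
(* Either the factor X_j - a X_l can be adjoined to I, or the cofactor times a power of X_l already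
   lies in I and the induction goes on with it. *)
have [h|] := pselect (forall M, ~ exists q w, I q /\ 'X_l ^+ M = q + ('X_j - a *: 'X_l) * w).
  exists a, (fun s => exists q w, I q /\ s = q + ('X_j - a *: 'X_l) * w); split=> //.
  - exact: is_ideal_add.
  - by move=> s hs; exists s, 0; rewrite mulr0 addr0.
  - by exists 0, 1; rewrite add0r mulr1.
move=> /existsNP [M /contrapT [q [w [hq e]]]].
apply: (IH (N + M)%N c') => //; first by apply: leq_trans sc _; rewrite ltnS leq_addr.
rewrite -binary_form_mulX // e mulrDr; apply: (iD); first exact: iM.
by rewrite mulrCA mulrA mulrC; apply: iM.
Qed.

End Saturation.

Lemma meval_congr_form I g N v l : is_ideal I -> g \is N.-homog ->
    (forall w, I ('X_w - v w *: 'X_l)) ->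
  I (g - g.@[v] *: 'X_l ^+ N).
Proof.
move=> iI hg hv.
have -> : g.@[v] *: 'X_l ^+ N = mmap (@mpolyC 3 K) (fun w => v w *: 'X_l) g.
  rewrite (mmap_homog_scale (h := fun w => (v w)%:MP) (c := 'X_l) _ hg); last first.
    by move=> w; rewrite mulrC mul_mpolyC.
  rewrite -mul_mpolyC mulrC; congr (_ * _).
  rewrite /meval /mmap rmorph_sum; apply: eq_bigr => m _; rewrite /= mpolyCM; congr (_ * _).
  by rewrite /mmap1 rmorph_prod; apply: eq_bigr => w _; rewrite rmorphXn.
have {1}-> : g = mmap (@mpolyC 3 K) (fun w => 'X_w) g.
  by rewrite {1}[g]mpolyE; apply: eq_bigr => m _; rewrite mul_mpolyC mmap1_id.
exact: mmap_congr.
Qed.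

Lemma two_other_indices (l : 'I_3) : exists i j : 'I_3, [/\ i != j, i != l, j != l &
  forall w, [|| w == i, w == j | w == l]].
Proof.
exists (lift l ord0), (lift l ord_max); split; rewrite ?(eq_sym _ l) ?neq_lift //.
  by rewrite (inj_eq (@lift_inj _ l)).
move=> w; case: (unliftP l w) => [k ->|->]; last by rewrite eqxx !orbT.
rewrite !(inj_eq (@lift_inj _ l)) -!val_eqE /=; case: k => [[|[|k]]] //.
Qed.

(** Two saturations adjoin X_j - a X_l and X_i - b X_l without admitting a power of X_l. Modulo the
    enlarged ideal, a form g of degree M is g(v) X_l^M, so g in I forces g(v) = 0. *)
Lemma projective_nullstellensatz f I l :
    has_eliminants f -> is_ideal I -> (forall s, jacobian_ideal f s -> I s) ->
    (forall N, ~ I ('X_l ^+ N)) ->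
  exists2 v : {ffun 'I_3 -> K}, v l = 1 & forall N g, g \is N.-homog -> I g -> g.@[v] = 0.
Proof.
move=> ef iI JI nI; have [i [j [ij il jl all_w]]] := two_other_indices l.
have [N [c [c0 sc Jc]]] := ef _ _ _ ij il jl.
have ji : j != i by rewrite eq_sym.
have [N' [c' [c'0 sc' Jc']]] := ef _ _ _ ji jl il.
have [a [I1 [iI1 II1 I1a nI1]]] := saturate ij il jl iI c0 sc (JI _ Jc) nI.
have [b [I2 [iI2 II2 I2b nI2]]] := saturate ji jl il iI1 c'0 sc' (II1 _ (JI _ Jc')) nI1.
pose v := [ffun w => if w == l then 1 else if w == j then a else b].
exists v; first by rewrite ffunE eqxx.
move=> M g hg Ig; apply/eqP; apply: contra_notT (nI2 M) => gv.
have hv w : I2 ('X_w - v w *: 'X_l).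
  rewrite ffunE; have [->|wl] := eqVneq w l.
    by rewrite scale1r subrr; case: iI2.
  have [->|wj] := eqVneq w j; first exact: II2.
  by have := all_w w; rewrite (negPf wl) (negPf wj) !orbF => /eqP ->.
have h := meval_congr_form iI2 hg hv; have [_ iD iM] := iI2.
have -> : 'X_l ^+ M = (g.@[v]^-1)%:MP * (g - (g - g.@[v] *: 'X_l ^+ M)).
  by rewrite subKr mul_mpolyC scalerA mulVf ?scale1r.
by apply: iM; apply: idealB => //; exact/II2/II1.
Qed.

Lemma forms_in_ideal I N k s : is_ideal I -> (forall l, I ('X_l ^+ N)) -> (3 * N <= k)%N ->
  s \is k.-homog -> I s.
Proof.
move=> iI hN le hs; have [i0 iD iM] := iI.
rewrite [s]mpolyE big_seq; apply: ideal_sum => // m hm.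
(* Three exponents below N add up to less than 3N. *)
have [l ml] : exists l, (N <= m l)%N.
  apply: contrapT => /forallNP h; have := dhomog_mf hs hm; rewrite /= mdegE => e.
  have : (\sum_(l < 3) (m l).+1 <= \sum_(l < 3) N)%N.
    by apply: leq_sum => l _; rewrite ltnNge; apply/negP.
  by move: e; rewrite !big_ord_recl !big_ord0; lia.
rewrite -mul_mpolyC; apply: (iM); rewrite mpolyXE_id (bigD1 l) //=.
by rewrite -(subnK ml) exprD mulrAC; apply: iM.
Qed.

Lemma forms_in_ideal_of_no_zero f I :
    has_eliminants f -> is_ideal I -> (forall s, jacobian_ideal f s -> I s) ->
    (forall v, (exists i, v i != 0) -> exists N g, [/\ g \is N.-homog, I g & g.@[v] != 0]) ->
  exists k0, forall k s, (k0 <= k)%N -> s \is k.-homog -> I s.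
Proof.
move=> ef iI JI nz; have [i0 iD iM] := iI.
have /choice [N hN] : forall l, exists N, I ('X_l ^+ N).
  move=> l; apply: contrapT => /forallNP nI.
  have [v vl hv] := projective_nullstellensatz ef iI JI nI.
  have [|N [g [hg Ig]]] := nz v; first by exists l; rewrite vl oner_neq0.
  by rewrite (hv N g hg Ig) eqxx.
exists (3 * \sum_l N l)%N => k s hk hs; apply: forms_in_ideal hk hs => // l.
by rewrite (bigD1 l) //= exprD mulrC; apply: iM.
Qed.

Lemma singularP f d p : (0 < d)%N -> f \is d.-homog -> (exists i, p i != 0) ->
  (forall i, f^`M(i).@[p] = 0) -> singular_point f p.
Proof.
move=> d0 hf p0 hp; split=> //.
have [a ->] := jacobian_self d0 hf.
by rewrite rmorph_sum big1 // => i _; rewrite /= mevalM hp mulr0.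
Qed.

Lemma jacobian_singular f p s : singular_point f p -> jacobian_ideal f s -> s.@[p] = 0.
Proof.
move=> [_ _ hp] [a ->]; by rewrite rmorph_sum big1 // => i _; rewrite /= mevalM hp mulr0.
Qed.

Lemma meval_proj_eq k s p q : s \is k.-homog -> proj_eq p q -> (s.@[q] == 0) = (s.@[p] == 0).
Proof.
move=> hs [c c0 e]; rewrite (meval_homog_scale hs (u := p) (v := q) e).
by rewrite mulf_eq0 expf_eq0 (negPf c0) andbF.
Qed.

End Nullstellensatz.

(** * Total Tjurina number *)

Lemma representatives (T : eqType) (P : T -> Prop) (R : T -> T -> Prop) (s : seq T) :
  exists N (pt : 'I_N -> T), [/\ forall k, P (pt k), forall j k, j != k ->
      ~ R (pt j) (pt k) /\ ~ R (pt k) (pt j)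
    & forall x, x \in s -> P x -> exists k, x = pt k \/ R x (pt k) \/ R (pt k) x].
Proof.
elim: s => [|y s [N [pt [hP hR hs]]]].
  have pt : 'I_0 -> T by case.
  by exists 0%N, pt; split=> [[]|[]|].
have [h|h] := pselect (P y -> exists k, y = pt k \/ R y (pt k) \/ R (pt k) y).
  exists N, pt; split=> // x; rewrite inE => /orP [/eqP ->|] //; exact: hs.
have [Py nR] : P y /\ forall k, ~ (y = pt k \/ R y (pt k) \/ R (pt k) y).
  by move: h => /not_implyP [Py /forallNP nR].
exists N.+1, (fun k => if unlift ord0 k is Some k' then pt k' else y); split.
- by move=> k; case: unliftP.
- move=> j k; case: (unliftP ord0 j) => [j' ->|->]; case: (unliftP ord0 k) => [k' ->|->] //.
  + by rewrite (inj_eq (@lift_inj _ ord0)) => /hR.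
  + by move=> _; have h1 := nR j'; split=> h2; apply: h1; right; [right|left].
  + by move=> _; have h1 := nR k'; split=> h2; apply: h1; right; [left|right].
- move=> x; rewrite inE => /orP [/eqP -> _|xs Px].
    by exists ord0; rewrite unlift_none; left.
  by have [k hk] := hs x xs Px; exists (lift ord0 k); rewrite liftK.
Qed.

Section Total.
Variable K : numClosedFieldType.
Local Notation S := {mpoly K[3]}.
Local Notation forms k := (fun s : S => s \is k.-homog).
Implicit Types (f g h s : S) (I : S -> Prop) (p q v : {ffun 'I_3 -> K}).

Lemma poly_roots (c : {poly K}) : c != 0 -> exists rs : seq K, forall a, root c a -> a \in rs.
Proof.
move=> c0; have [rs e] := closed_field_poly_normal c; exists rs => a.
by rewrite e rootZ ?lead_coef_eq0 // root_prod_XsubC.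
Qed.

Lemma proj_eq_sym p q : proj_eq p q -> proj_eq q p.
Proof. by move=> [c c0 e]; exists c^-1; rewrite ?invr_eq0 // => i; rewrite e mulKf. Qed.

Lemma proj_eq_trans p q r : proj_eq p q -> proj_eq q r -> proj_eq p r.
Proof.
move=> [c c0 e] [c' c'0 e']; exists (c' * c); rewrite ?mulf_neq0 // => i.
by rewrite e' e mulrA.
Qed.

Lemma meval_binary_form j l N (c : {poly K}) p : p l = 1 -> (size c <= N.+1)%N ->
  (binary_form j l N c).@[p] = c.[p j].
Proof.
move=> pl sc; rewrite (horner_coef_wide _ sc) rmorph_sum; apply: eq_bigr => b _ /=.
by rewrite mevalZ mevalM !rmorphXn /= !mevalXU pl expr1n mulr1.
Qed.

Lemma singular_proj_eq f d p q : (0 < d)%N -> f \is d.-homog -> proj_eq p q ->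
  singular_point f p -> singular_point f q.
Proof.
move=> d0 hf pq [[i pi0] _ hp]; apply: (singularP d0 hf).
  by have [c c0 e] := pq; exists i; rewrite e mulf_neq0.
by move=> k; apply/eqP; rewrite (meval_proj_eq (dhomog_mderiv k hf) pq) hp.
Qed.

(** In the chart p_l = 1 two eliminants vanish at every singular point, so its other two coordinates
    are roots of fixed nonzero polynomials. *)
Lemma finite_singular_points f d : (0 < d)%N -> f \is d.-homog -> has_eliminants f ->
  exists s : seq {ffun 'I_3 -> K}, forall p, singular_point f p -> exists2 q, q \in s & proj_eq p q.
Proof.
move=> d0 hf ef.
have onel (l : 'I_3) : exists s : seq {ffun 'I_3 -> K},
    forall p, singular_point f p -> p l = 1 -> p \in s.
  have [i [j [ij il jl all_w]]] := two_other_indices l.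
  have ji : j != i by rewrite eq_sym.
  have [N [c [c0 sc Jc]]] := ef _ _ _ ij il jl.
  have [N' [c' [c'0 sc' Jc']]] := ef _ _ _ ji jl il.
  have [rs hrs] := poly_roots c0; have [rs' hrs'] := poly_roots c'0.
  exists [seq [ffun w => if w == l then 1 else if w == j then a else b] | a <- rs, b <- rs'].
  move=> p sp pl; apply/allpairsP; exists (p j, p i); split=> /=.
  - by apply: hrs; rewrite /root -(meval_binary_form j pl sc) (jacobian_singular sp Jc).
  - by apply: hrs'; rewrite /root -(meval_binary_form i pl sc') (jacobian_singular sp Jc').
  - apply/ffunP => w; rewrite ffunE; have [->//|wl] := eqVneq w l.
    have [->//|wj] := eqVneq w j.
    by have := all_w w; rewrite (negPf wl) (negPf wj) !orbF => /eqP ->.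
have /choice [s hs] := onel.
exists (flatten [seq s l | l <- enum 'I_3]) => p sp; have [[l pl0] _ _] := sp.
pose q : {ffun 'I_3 -> K} := [ffun w => (p l)^-1 * p w].
have pq : proj_eq p q by exists (p l)^-1; rewrite ?invr_eq0 // => w; rewrite ffunE.
exists q => //; apply/flatten_mapP; exists l; first by rewrite mem_enum.
by apply: hs; [exact: singular_proj_eq d0 hf pq sp|rewrite ffunE mulVf].
Qed.

Lemma enumerate_singular_points f d : (0 < d)%N -> f \is d.-homog -> has_eliminants f ->
  exists N (pt : 'I_N -> {ffun 'I_3 -> K}), [/\ forall k, singular_point f (pt k),
    forall j k, proj_eq (pt j) (pt k) -> j = k &
    forall p, singular_point f p -> exists k, proj_eq p (pt k)].
Proof.
move=> d0 hf ef; have [s hs] := finite_singular_points d0 hf ef.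
have [N [pt [h1 h2 h3]]] := representatives (singular_point f) (@proj_eq K) s.
exists N, pt; split=> // [j k jk|p sp].
  by apply/eqP; apply: contraPT jk => /h2 [].
have [q qs pq] := hs p sp; have [k hk] := h3 q qs (singular_proj_eq d0 hf pq sp).
exists k; case: hk => [<- //|[qk|kq]]; first exact: proj_eq_trans qk.
exact: proj_eq_trans (proj_eq_sym kq).
Qed.

Lemma avoiding_linear_form N (pt : 'I_N -> {ffun 'I_3 -> K}) :
    (forall j, exists i, pt j i != 0) ->
  exists2 ell : S, ell \is 1.-homog & forall j, ell.@[pt j] != 0.
Proof.
(* The linear form with coefficients 1, a, a^2 takes the value P_j(a) at the j-th point, so a has
   only finitely many roots to avoid. *)
move=> nz; pose P j := \poly_(w < 3) pt j (inord w).
have P0 j : P j != 0.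
  have [i pi0] := nz j; apply: contraNneq pi0 => /polyP /(_ i).
  by rewrite coef_poly ltn_ord coef0 inord_val => ->.
have /closed_nonrootP [a ra] : \prod_j P j != 0 by apply/prodf_neq0 => j _.
exists (\sum_(w < 3) a ^+ w *: 'X_w).
  by apply: rpred_sum => w _; apply: dhomogZ; exact: dhomog_var.
move=> j; apply: contraNneq ra => e; rewrite /root horner_prod; apply/prodf_eq0.
exists j => //; rewrite -e /P horner_poly rmorph_sum; apply/eqP/eq_bigr => w _ /=.
by rewrite mevalZ mevalXU inord_val mulrC.
Qed.

Section Saturation.
Variables (f : S) (d t k0 N : nat) (pt : 'I_N -> {ffun 'I_3 -> K}).
Hypotheses (d0 : (0 < d)%N) (hf : f \is d.-homog) (ef : has_eliminants f).
Hypothesis dJ : forall k, (k0 <= k)%N -> qdim (forms k) (jacobian_ideal f) t.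
Hypothesis sing_pt : forall k, singular_point f (pt k).
Hypothesis cover_pt : forall p, singular_point f p -> exists k, proj_eq p (pt k).

Lemma no_common_zero I : is_ideal I -> (forall s, jacobian_ideal f s -> I s) ->
    (forall j, exists D g, [/\ g \is D.-homog, I g & g.@[pt j] != 0]) ->
  exists k1, forall k s, (k1 <= k)%N -> s \is k.-homog -> I s.
Proof.
move=> iI JI nz; apply: (forms_in_ideal_of_no_zero ef iI JI) => v v0.
have [sv|] := pselect (forall i, f^`M(i).@[v] = 0).
  have [k pk] := cover_pt (singularP d0 hf v0 sv).
  have [D [g [hg Ig gk]]] := nz k; exists D, g; split=> //.
  by rewrite (meval_proj_eq hg (proj_eq_sym pk)).
move=> /existsNP [i /eqP hi]; exists d.-1, f^`M(i); split=> //; first exact: dhomog_mderiv.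
exact/JI/jacobian_deriv.
Qed.

(* A linear form ell vanishing at no singular point is eventually onto, hence
   bijective, on the graded pieces of M(f), all of dimension t.  If s is zero in
   all the germs, the ideal J : s has no zero, so it contains a power of ell. *)
Lemma jacobian_saturated : exists k1, forall k s, (k1 <= k)%N -> s \is k.-homog ->
  (forall j, germ_ideal f (pt j) s) -> jacobian_ideal f s.
Proof.
have iJ := jacobian_is_ideal f; have [j0 jD jM] := iJ.
have sF k := @subspace_homog 3 K k; have sJ := subspace_jacobian f.
have [|ell hell ell0] := avoiding_linear_form (pt := pt); first by move=> j; case: (sing_pt j).
have [|j|k1 hk1] := no_common_zero (is_ideal_add ell iJ).
- by move=> s hs; exists s, 0; rewrite mulr0 addr0.
- by exists 1%N, ell; split=> //; exists 0, 1; rewrite add0r mulr1.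
have inj k s : (k0 + k1 <= k)%N -> s \is k.-homog -> jacobian_ideal f (ell * s) ->
    jacobian_ideal f s.
  move=> hk; apply: (qdim_onto_inj (sF k) sJ (sF k.+1) sJ (linear_mul ell)) => [v hv|v hv|v hv|||].
  - exact: dhomogM hell hv.
  - exact: jM.
  - have [|q [w [hq e]]] := hk1 k.+1 v _ hv; first by lia.
    (* The cofactor [w] need not be a form, but its component of degree k serves as well, because J
       is homogeneous. *)
    exists (pihomog mdeg k w); first exact: pihomogP.
    have -> : v - ell * pihomog mdeg k w = pihomog mdeg k.+1 q.
      have ew : pihomog mdeg k.+1 (ell * w) = ell * pihomog mdeg k w by exact: (pihomogM k w hell).
      by rewrite -{1}(pihomog_dE hv) e pihomogD ew addrK.
    exact: jacobian_pihomog hf hq.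
  - by apply: dJ; lia.
  - by apply: dJ; lia.
  - by [].
have injX M k s : (k0 + k1 <= k)%N -> s \is k.-homog -> jacobian_ideal f (ell ^+ M * s) ->
    jacobian_ideal f s.
  elim: M k s => [|M IH] k s hk hs; first by rewrite mul1r.
  rewrite exprSr -mulrA => /(IH k.+1) h; apply: (inj k) => //; apply: h; first by lia.
  exact: dhomogM hell hs.
exists (k0 + k1)%N => k s hk hs gs.
have iI : is_ideal (fun h => jacobian_ideal f (h * s)).
  split=> [|u v hu hv|a u hu]; first by rewrite mul0r.
    by rewrite mulrDl; exact: jD.
  by rewrite -mulrA; exact: jM.
have [h hh|j|k2 hk2] := no_common_zero iI.
- by rewrite mulrC; exact: jM.
- by have [D [h [hh hp hJ]]] := gs j; exists D, h.
apply: (injX k2 k) => //; apply: (hk2 k2) => //.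
by rewrite -[k2 in k2.-homog]mul1n; exact: dhomog_exp.
Qed.

End Saturation.

(** In one large degree the forms lying in all germ ideals are those of J, so [t] is the sum of the
    local dimensions. *)
Theorem total_tjurina_stable f d t k0 C : (0 < d)%N -> f \is d.-homog -> has_eliminants f ->
    (forall k, (k0 <= k)%N -> qdim (forms k) (jacobian_ideal f) t) ->
    (forall k m, qdim (forms k) (jacobian_ideal f) m -> (m <= C)%N) ->
  total_tjurina f t.
Proof.
move=> d0 hf ef dJ bound; have sF k := @subspace_homog 3 K k.
have [N [pt [sing_pt inj_pt cover_pt]]] := enumerate_singular_points d0 hf ef.
have nz j : exists i, pt j i != 0 by case: (sing_pt j).
have /choice [n hn] : forall j, exists n, exists k1, forall k, (k1 <= k)%N ->
    qdim (forms k) (germ_ideal f (pt j)) n.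
  by move=> j; have [n [h _]] := germ_dim (nz j) bound; exists n.
exists N, pt, n; split=> //.
- move=> p sp; have [k pk] := cover_pt p sp; exists k; split=> // k' pk'.
  exact/inj_pt/(proj_eq_trans (proj_eq_sym pk)).
- move=> k i pi0; have [k1 hk1] := hn k; exact: tjurina_number_germ pi0 d0 hf hk1.
- have [k1 hk1] := points_crt bound nz inj_pt hn.
  have [k2 hk2] := jacobian_saturated d0 hf ef dJ sing_pt cover_pt.
  pose k := (k0 + k1 + k2)%N.
  apply: (qdim_uniq (sF k) (dJ k _)); first by rewrite /k; lia.
  apply: qdim_eq (hk1 k _); last by rewrite /k; lia.
  move=> s hs; split=> [|hJ j]; last exact: jacobian_germ.
  by apply: (hk2 k) => //; rewrite /k; lia.
Qed.

End Total.

(** * Bounding the Hilbert function *)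

Section Bound.
Variable K : numClosedFieldType.
Local Notation S := {mpoly K[3]}.
Local Notation forms k := (fun s : S => s \is k.-homog).
Implicit Types f g h s : S.

Lemma binary_reduction f j l N (c : {poly K}) D (R : S -> Prop) h :
    c != 0 -> (size c <= N.+1)%N -> jacobian_ideal f (binary_form j l N c) ->
    (N <= D)%N -> subspace R -> (forall s, jacobian_ideal f s -> R s) ->
    (forall b, (b < D)%N -> R ('X_j ^+ b * 'X_l ^+ (D + D - b) * h)) ->
  R ('X_j ^+ D * 'X_l ^+ D * h).
Proof.
move=> c0 sc Jc ND sR JR hR; pose A := (size c).-1.
have sA : size c = A.+1 by rewrite /A prednK // lt0n size_poly_eq0.
have AN : (A <= N)%N by rewrite sA in sc.
have cA : c`_A != 0 by rewrite /A -lead_coefE lead_coef_eq0.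
(* This multiplier turns the leading term of the binary form into X_j^D X_l^D h, and all other terms
   into ones with a smaller power of X_j. *)
pose m := 'X_j ^+ (D - A) * 'X_l ^+ (D - N + A) * h.
have e : m * binary_form j l N c = c`_A *: ('X_j ^+ D * 'X_l ^+ D * h) +
    \sum_(b < N.+1 | (b : nat) != A) c`_b *: (m * ('X_j ^+ b * 'X_l ^+ (N - b))).
  rewrite /binary_form mulr_sumr (bigD1 (Ordinal (AN : A < N.+1)%N)) //= -scalerAr.
  congr (_ *: _ + _); last by apply: eq_big => [b|b _]; rewrite ?scalerAr.
  have -> : 'X_j ^+ D = 'X_j ^+ (D - A) * 'X_j ^+ A :> S.
    by rewrite -exprD; congr (_ ^+ _); lia.
  have -> : 'X_l ^+ D = 'X_l ^+ (D - N + A) * 'X_l ^+ (N - A) :> S.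
    by rewrite -exprD; congr (_ ^+ _); lia.
  by rewrite /m; ring.
have -> : 'X_j ^+ D * 'X_l ^+ D * h = (c`_A)^-1 *: (m * binary_form j l N c -
    \sum_(b < N.+1 | (b : nat) != A) c`_b *: (m * ('X_j ^+ b * 'X_l ^+ (N - b)))).
  by rewrite e addrK scalerA mulVf // scale1r.
apply: subspaceZ => //; apply: subspaceB => //.
  by apply: JR; case: (jacobian_is_ideal f) => _ _; apply.
apply: subspace_sum => // b bA.
have [bA'|] := ltnP b A; last first.
  rewrite leq_eqVlt eq_sym (negPf bA) /= => Ab.
  by rewrite nth_default ?sA // scale0r; exact: sR.1.
apply: subspaceZ => //.
have -> : m * ('X_j ^+ b * 'X_l ^+ (N - b)) = 'X_j ^+ (D - A + b) * 'X_l ^+ (D + D - (D - A + b))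
    * h.
  have -> : (D + D - (D - A + b) = (D - N + A) + (N - b))%N by lia.
  by rewrite /m !exprD; ring.
by apply: hR; lia.
Qed.

Definition monomial3 (a b c : nat) : S :=
  'X_(@Ordinal 3 0 isT) ^+ a * 'X_(@Ordinal 3 1 isT) ^+ b * 'X_(@Ordinal 3 2 isT) ^+ c.

Lemma monomial3_homog a b c : monomial3 a b c \is (a + b + c).-homog.
Proof. by apply: dhomogM; [apply: dhomogM|]; exact: dhomog_varX. Qed.

Lemma mpolyX_monomial3 (m : 'X_{1..3}) :
  'X_[m] = monomial3 (m (@Ordinal 3 0 isT)) (m (@Ordinal 3 1 isT)) (m (@Ordinal 3 2 isT)).
Proof.
rewrite mpolyXE_id !big_ord_recl big_ord0 mulr1 mulrA.
by congr (_ * _ * _); congr ('X_ _ ^+ m _); apply/val_inj.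
Qed.

(** The index l names the variable that carries the rest of the degree; u and v are the other two
    exponents. The value 0 for u + v > k keeps the index set, of size 3 D^2, independent of k. *)
Definition small_monomial (D k : nat) (t : 'I_3 * ('I_D * 'I_D)) : S :=
  let: (l, (u, v)) := t in
  if (u + v <= k)%N then
    match val l with
    | 0%N => monomial3 (k - (u + v)) u v
    | 1%N => monomial3 u (k - (u + v)) v
    | _ => monomial3 u v (k - (u + v))
    end
  else 0.

Lemma small_monomial_homog D k (t : 'I_3 * ('I_D * 'I_D)) : small_monomial k t \is k.-homog.
Proof.
case: t => [l [u v]] /=; case: ifP => [uv|_]; last exact: dhomog0.
case: l => [[|[|l]] hl] /=.
- have := monomial3_homog (k - (u + v)) u v.
  by have -> : (k - (u + v) + u + v = k)%N by lia.
- have := monomial3_homog u (k - (u + v)) v.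
  by have -> : (u + (k - (u + v)) + v = k)%N by lia.
- have := monomial3_homog u v (k - (u + v)).
  by have -> : (u + v + (k - (u + v)) = k)%N by lia.
Qed.

(* A monomial X0^a X1^b X2^c with two exponents at least D is rewritten by one
   of the three binary relations, which decreases 2a + b. *)
Lemma monomials_span f : has_eliminants f -> exists D, forall k (R : S -> Prop),
  subspace R -> (forall s, jacobian_ideal f s -> R s) ->
  (forall t : 'I_3 * ('I_D * 'I_D), R (small_monomial k t)) ->
  forall s, s \is k.-homog -> R s.
Proof.
move=> ef; pose i0 := @Ordinal 3 0 isT; pose i1 := @Ordinal 3 1 isT; pose i2 := @Ordinal 3 2 isT.
have [N1 [c1 [c10 sc1 J1]]] := ef i1 i0 i2 isT isT isT.
have [N2 [c2 [c20 sc2 J2]]] := ef i0 i1 i2 isT isT isT.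
have [N3 [c3 [c30 sc3 J3]]] := ef i2 i0 i1 isT isT isT.
pose D := (N1 + N2 + N3)%N; have [le1 [le2 le3]] : (N1 <= D /\ N2 <= D /\ N3 <= D)%N by rewrite
    /D; lia.
exists D => k R sR JR hR.
(* The relations shift exponents from X1 to X2, from X0 to X2 and from X0 to X1, so weights that
   strictly decrease along the variables, here 2, 1, 0, drop every time. *)
suff mon n a b c : (a + b + c = k)%N -> (2 * a + b < n)%N -> R (monomial3 a b c).
  move=> s hs; rewrite [s]mpolyE big_seq; apply: subspace_sum => // m hm.
  apply: subspaceZ => //; rewrite mpolyX_monomial3; apply: mon (leqnn _).
  have := dhomog_mf hs hm; rewrite /= mdegE !big_ord_recl big_ord0 => <-.
  rewrite addn0 addnA; congr (m _ + m _ + m _)%N; exact/val_inj.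
elim: n a b c => // n IH a b c abc an.
have [aD|aD] := ltnP a D.
  have [bD|bD] := ltnP b D.
    have := hR (i2, (Ordinal aD, Ordinal bD)); rewrite /= ifT; last by lia.
    by have -> : (k - (a + b) = c)%N by lia.
  have [cD|cD] := ltnP c D.
    have := hR (i1, (Ordinal aD, Ordinal cD)); rewrite /= ifT; last by lia.
    by have -> : (k - (a + c) = b)%N by lia.
  pose h := 'X_i0 ^+ a * 'X_i1 ^+ (b - D) * 'X_i2 ^+ (c - D) : S.
  have -> : monomial3 a b c = 'X_i1 ^+ D * 'X_i2 ^+ D * h.
    rewrite /monomial3 /h -/i0 -/i1 -/i2 -{1}(subnK bD) -{1}(subnK cD) !exprD; ring.
  apply: (binary_reduction c20 sc2 J2 le2 sR JR) => x xD.
  have -> : 'X_i1 ^+ x * 'X_i2 ^+ (D + D - x) * h = monomial3 a (x + (b - D)) ((D + D - x) + (c -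
      D)).
    rewrite /monomial3 /h -/i0 -/i1 -/i2 !exprD; ring.
  by apply: IH; lia.
have [cD|cD] := ltnP c D; last first.
  pose h := 'X_i0 ^+ (a - D) * 'X_i1 ^+ b * 'X_i2 ^+ (c - D) : S.
  have -> : monomial3 a b c = 'X_i0 ^+ D * 'X_i2 ^+ D * h.
    rewrite /monomial3 /h -/i0 -/i1 -/i2 -{1}(subnK aD) -{1}(subnK cD) !exprD; ring.
  apply: (binary_reduction c10 sc1 J1 le1 sR JR) => x xD.
  have -> : 'X_i0 ^+ x * 'X_i2 ^+ (D + D - x) * h = monomial3 (x + (a - D)) b ((D + D - x) + (c -
      D)).
    rewrite /monomial3 /h -/i0 -/i1 -/i2 !exprD; ring.
  by apply: IH; lia.
have [bD|bD] := ltnP b D.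
  have := hR (i0, (Ordinal bD, Ordinal cD)); rewrite /= ifT; last by lia.
  by have -> : (k - (b + c) = a)%N by lia.
pose h := 'X_i0 ^+ (a - D) * 'X_i1 ^+ (b - D) * 'X_i2 ^+ c : S.
have -> : monomial3 a b c = 'X_i0 ^+ D * 'X_i1 ^+ D * h.
  rewrite /monomial3 /h -/i0 -/i1 -/i2 -{1}(subnK aD) -{1}(subnK bD) !exprD; ring.
apply: (binary_reduction c30 sc3 J3 le3 sR JR) => x xD.
have -> : 'X_i0 ^+ x * 'X_i1 ^+ (D + D - x) * h = monomial3 (x + (a - D)) ((D + D - x) + (b - D)) c.
  rewrite /monomial3 /h -/i0 -/i1 -/i2 !exprD; ring.
by apply: IH; lia.
Qed.

Lemma milnor_dim_bounded f : has_eliminants f ->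
  exists C, forall k n, qdim (forms k) (jacobian_ideal f) n -> (n <= C)%N.
Proof.
move=> ef; have [D hD] := monomials_span ef; have sJ := subspace_jacobian f.
pose T := ('I_3 * ('I_D * 'I_D))%type.
exists #|{: T}| => k n; pose b (x : 'I_#|{: T}|) : S := small_monomial k (enum_val x).
have hb x : b x \is k.-homog by exact: small_monomial_homog.
apply: (qdim_span_le (subspace_homog 3 K k) sJ hb).
(* The subspace to be filled is J plus the span of the small monomials. *)
apply: (hD k (fun s => exists x : 'I_#|{: T}| -> K, jacobian_ideal f (s - \sum_i x i *: b i))).
- split.
    by exists (fun=> 0); rewrite big1 ?subr0; [exact: sJ.1|move=> x _; rewrite scale0r].
  move=> a u v [x hx] [y hy]; exists (fun i => a * x i + y i).
  have -> : a *: u + v - \sum_i (a * x i + y i) *: b i =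
      a *: (u - \sum_i x i *: b i) + (v - \sum_i y i *: b i).
    rewrite scalerBr addrACA -opprD; congr (_ - _); rewrite scaler_sumr -big_split.
    by apply: eq_bigr => i _; rewrite scalerDl scalerA.
  exact: sJ.2.
- by move=> u hu; exists (fun=> 0); rewrite big1 ?subr0 // => x _; rewrite scale0r.
- move=> t; exists (fun x => (x == enum_rank t)%:R).
  rewrite (bigD1 (enum_rank t)) //= eqxx scale1r /b enum_rankK big1 ?addr0 ?subrr;
      first exact: sJ.1.
  by move=> x /negPf ->; rewrite scale0r.
Qed.

End Bound.

(** * Hilbert function of a resolution *)

(* A matrix type has only a module structure over its own coefficient ring; this
   alias carries the K-vector space structure. *)
Definition krow (K : fieldType) (n : nat) : Type := 'rV[{mpoly K[3]}]_n.

Section KRow.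
Variables (K : fieldType) (n : nat).
Local Notation V := (krow K n).

HB.instance Definition _ := GRing.Zmodule.copy V 'rV[{mpoly K[3]}]_n.

Definition krow_scale (a : K) (u : V) : V := a%:MP *: (u : 'rV[{mpoly K[3]}]_n).

Lemma krow_scaleA a b u : krow_scale a (krow_scale b u) = krow_scale (a * b) u.
Proof. by rewrite /krow_scale scalerA mpolyCM. Qed.

Lemma krow_scale1 : left_id 1 krow_scale.
Proof. by move=> u; rewrite /krow_scale mpolyC1 scale1r. Qed.

Lemma krow_scaleDr : right_distributive krow_scale +%R.
Proof. by move=> a u v; rewrite /krow_scale scalerDr. Qed.

Lemma krow_scaleDl u : {morph krow_scale^~ u : a b / a + b}.
Proof. by move=> a b; rewrite /krow_scale mpolyCD scalerDl. Qed.

HB.instance Definition _ :=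
  GRing.Zmodule_isLmodule.Build K V krow_scaleA krow_scale1 krow_scaleDr krow_scaleDl.

End KRow.

Lemma krowE (K : fieldType) n (a : K) (u v : krow K n) j : (a *: u + v) 0 j = a *: (u 0 j) + v 0 j.
Proof. by rewrite -mul_mpolyC [LHS]mxE [X in X + _]mxE. Qed.

Lemma krow_mulmx (K : fieldType) n p (M : 'M[{mpoly K[3]}]_(n, p)) (a : K) (u v : krow K n) :
  ((a *: u + v : krow K n) *m M) = (a *: (u *m M : krow K p) + (v *m M : krow K p)).
Proof. by rewrite mulmxDl -scalemxAl. Qed.

(** * Graded pieces of free modules and rank of homogeneous matrices *)

Section Graded.
Variable K : fieldType.
Local Notation S := {mpoly K[3]}.

Definition pihomogz (z : int) (p : S) : S := if z is Posz k then pihomog mdeg k p else 0.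

Lemma pihomogz_homogz z p : homogz z (pihomogz z p).
Proof. by case: z => k //=; exact: pihomogP. Qed.

Lemma pihomogz_id z p : homogz z p -> pihomogz z p = p.
Proof. by case: z => k //=; exact: pihomog_dE. Qed.

Lemma pihomogz_sum z n (F : 'I_n -> S) : pihomogz z (\sum_j F j) = \sum_j pihomogz z (F j).
Proof. by case: z => k /=; rewrite ?raddf_sum // big1. Qed.

Lemma pihomogzM z a p h : homogz a h -> pihomogz (a + z) (p * h) = pihomogz z p * h.
Proof.
case: a => a /=; last by move=> ->; rewrite !mulr0; case: (_ + z) => k //=; rewrite pihomog0.
move=> hh; rewrite mulrC; case: z => z /=; first by rewrite pihomogM // mulrC.
rewrite mul0r; case e : (a%:Z + Negz z) => [k|k] //=.
by apply: (pihomogM_lt _ hh); move: e; rewrite NegzE; lia.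
Qed.

Definition graded_piece n (b : 'I_n -> int) (z : int) (u : krow K n) : Prop :=
  forall j, homogz (z - b j) (u 0 j).

Lemma subspace_graded n (b : 'I_n -> int) z : subspace (graded_piece b z).
Proof.
split=> [j|a u v hu hv j]; first by rewrite mxE; exact: (subspace_homogz K _).1.
by rewrite krowE; apply: (subspace_homogz K _).2; [exact: hu|exact: hv].
Qed.

Lemma qdim_graded n (b : 'I_n -> int) z :
  qdim (graded_piece b z) (fun u : krow K n => u = 0) (\sum_j hdim (z - b j)).
Proof.
apply: (@qdim_eq _ _ _ (fun u : krow K n => forall j, u 0 j = 0)).
  by move=> v _; split=> [h|-> j]; [apply/rowP => j; rewrite h mxE|rewrite mxE].
apply: (qdim_crt (W := fun j (u : krow K n) => u 0 j = 0)) => [|j|v hv];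
    first exact: subspace_graded.
- have lj : linear (fun u : krow K n => u 0 j) by move=> a u v; rewrite krowE.
  apply: (qdim_map (W := fun u : krow K n => u 0 j = 0) lj _ (subspace_homogz K _) _ _
      (qdim_homogz K (z - b j))) => //.
  move=> p hp; exists (\row_i (if i == j then p else 0)); last by rewrite mxE eqxx subrr.
  by move=> i; rewrite mxE; case: eqP => [->|_] //; exact: (subspace_homogz K _).1.
- exists (\row_i v i 0 i) => [i|i]; last by rewrite !mxE subrr.
  by rewrite mxE; exact: hv.
Qed.

Lemma homogz_mul y y' (p h : S) : homogz y p -> homogz y' h -> homogz (y + y') (p * h).
Proof.
case: y => y /=; last by move=> ->; rewrite mul0r => _; exact: (subspace_homogz K _).1.
case: y' => y' /=; last by move=> _ ->; rewrite mulr0; exact: (subspace_homogz K _).1.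
by move=> hp hh; exact: dhomogM.
Qed.

Section Rank.
Variables (m n : nat) (M : 'M[S]_(m, n)) (a : 'I_m -> int) (b : 'I_n -> int) (z : int).
Hypothesis hM : forall j k, homogz (a j - b k) (M j k).

Lemma graded_mulmx v : graded_piece a z v -> graded_piece b z (v *m M).
Proof.
move=> hv k; rewrite mxE; apply: subspace_sum => [|j _]; first exact: subspace_homogz.
have -> : z - b k = (z - a j) + (a j - b k) by rewrite addrA subrK.
by apply: homogz_mul.
Qed.

Lemma graded_image u : graded_piece b z u -> (exists v, u = v *m M) ->
  exists2 v, graded_piece a z v & u = v *m M.
Proof.
move=> hu [v e]; exists (\row_j pihomogz (z - a j) (v 0 j)).
  by move=> j; rewrite mxE; exact: pihomogz_homogz.
apply/rowP => k; rewrite -(pihomogz_id (hu k)) e !mxE pihomogz_sum.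
apply: eq_bigr => j _; rewrite mxE.
have -> : z - b k = (a j - b k) + (z - a j) by rewrite [RHS]addrC subrKA.
exact: pihomogzM.
Qed.

(** This is rank-nullity in degree z. The rank is stated as the dimension of the source modulo the
    kernel, which exactness turns into the cokernel dimension of the preceding map in the
    complex. *)
Lemma graded_rank : exists r x, [/\ qdim (graded_piece b z) (fun u => exists v, u = v *m M) x,
  (x + r = \sum_k hdim (z - b k))%N & qdim (graded_piece a z) (fun v => v *m M = 0) r].
Proof.
pose U (u : krow K n) := graded_piece b z u /\ exists v, u = v *m M.
have sb := subspace_graded b z; have sa := subspace_graded a z.
have sU : subspace U.
  split; first by split; [exact: sb.1|exists 0; rewrite mul0mx].
  move=> c u v [hu [u' eu]] [hv [v' ev]]; split; first exact: sb.2.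
  by exists (c *: (u' : krow K m) + (v' : krow K m)); rewrite krow_mulmx eu ev.
have U0 u : graded_piece b z u -> u = 0 -> U u.
  by move=> hu u0; split=> //; exists 0; rewrite mul0mx.
have [x [r [dx dr xr]]] := qdim_sub sb sU U0 (fun u hu => hu.1) (qdim_graded b z).
exists r, x; split=> //; first by apply: qdim_eq dx => v hv; split=> [[]|].
apply: (qdim_map (phi := fun v : krow K m => v *m M : krow K n) _ _ sU _ _ dr).
- by move=> c u v; exact: krow_mulmx.
- by move=> v hv; split; [exact: graded_mulmx|exists v].
- by [].
- by move=> u [hu /(graded_image hu) [v hv ->]]; exists v => //; rewrite subrr.
Qed.

End Rank.
End Graded.

Section Resolution.
Variables (K : numClosedFieldType) (f : {mpoly K[3]}) (d d1 d2 d3 : nat) (e : int).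
Local Notation S := {mpoly K[3]}.
Local Notation forms k := (fun s : S => s \is k.-homog).
Local Notation B := [:: [:: 0];
        [:: d%:Z - 1; d%:Z - 1; d%:Z - 1];
        [:: d%:Z - 1 + d1%:Z; d%:Z - 1 + d2%:Z; d%:Z - 1 + d3%:Z];
        [:: e]].
Hypotheses (d_gt1 : (1 < d)%N) (hf : f \is d.-homog).
Variables (eps : 'cV[S]_(rk B 0)) (phi : forall i, 'M[S]_(rk B i.+1, rk B i)).
Hypothesis res : min_free_resolution (jacobian_ideal f) eps phi.

Lemma jacobian_one : ~ jacobian_ideal f 1.
Proof.
move=> [a /(congr1 (pihomog mdeg 0))].
have h1 : (1 : S) \is 0.-homog by rewrite -(expr0 ('X_ord0)); exact: dhomog_varX.
rewrite pihomog_dE // raddf_sum big1 /=; first by move/eqP; rewrite oner_eq0.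
move=> i _; rewrite mulrC (pihomogM_lt _ (dhomog_mderiv i hf)) //; lia.
Qed.

(** The entry has degree 0; if it were zero, the augmentation would miss the class of 1. *)
Lemma augmentation_const : exists2 c : K, c != 0 & eps 0 0 = c%:MP.
Proof.
have [[heps _] aug _ _ _] := res; have := heps 0; rewrite /= => /dhomog_const ec.
exists (eps 0 0)@_0%MM => //; apply/eqP => c0; apply: jacobian_one.
have [u] := aug 1; rewrite mxE big1 ?subr0 // => j _.
by rewrite !ord1 ec c0 mpolyC0 mulr0.
Qed.

Lemma jacobian_image p : jacobian_ideal f p <-> exists w, (const_mx p : 'rV[S]_1) = w *m phi 0%N.
Proof.
have [c c0 ec] := augmentation_const; have [_ _ im _ _] := res.
have h (q : S) : ((const_mx q : 'rV[S]_1) *m eps) 0 0 = c *: q.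
  by rewrite mxE big_ord1 mxE ec mulrC mul_mpolyC.
have := im (const_mx (c^-1 *: p)); rewrite h scalerA mulfV // scale1r => ->.
have sc (a : K) : a != 0 -> (exists w, (const_mx p : 'rV[S]_1) = w *m phi 0%N) ->
    exists w, (const_mx (a *: p) : 'rV[S]_1) = w *m phi 0%N.
  move=> a0 [w ew]; exists (a%:MP *: w); rewrite -scalemxAl -ew; apply/matrixP => i j.
  by rewrite !mxE mul_mpolyC.
split=> [[w ew]|]; last by apply: sc; rewrite invr_eq0.
exists (c%:MP *: w); rewrite -scalemxAl -ew; apply/matrixP => i j.
by rewrite !mxE mul_mpolyC scalerA mulfV // scale1r.
Qed.

Definition graded_dim i z := (\sum_(j < rk B i) hdim (z - shift B i j))%N.

Lemma resolution_homogeneous i (j : 'I_(rk B i.+1)) (k : 'I_(rk B i)) :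
  homogz (shift B i.+1 j - shift B i k) (phi i j k).
Proof. by have [[_ h] _ _ _ _] := res; exact: h. Qed.

Lemma milnor_hilbert k : exists n, qdim (forms k) (jacobian_ideal f) n /\
  (n + graded_dim 1 k + graded_dim 3 k = graded_dim 0 k + graded_dim 2 k)%N.
Proof.
have [_ _ _ exact _] := res.
have sg i : subspace (@graded_piece K _ (fun j : 'I_(rk B i) => shift B i j) k) by exact:
    subspace_graded.
have [r0 [x0 [dx0 e0 dr0]]] := graded_rank k (@resolution_homogeneous 0).
have [r1 [x1 [dx1 e1 dr1]]] := graded_rank k (@resolution_homogeneous 1).
have [r2 [x2 [dx2 e2 dr2]]] := graded_rank k (@resolution_homogeneous 2).
have shift0 (j : 'I_(rk B 0)) : k%:Z - shift B 0 j = k%:Z by rewrite ord1 subr0.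
have er0 : r0 = x1 by apply: (qdim_uniq (sg 1%N) dr0); apply: qdim_eq dx1 => v _; rewrite exact.
have er1 : r1 = x2 by apply: (qdim_uniq (sg 2%N) dr1); apply: qdim_eq dx2 => v _; rewrite exact.
(* The next map starts from the zero module, so this one is injective. *)
have er2 : r2 = graded_dim 3 k.
  apply: (qdim_uniq (sg 3%N) dr2); apply: qdim_eq (qdim_graded K _ _) => v _; rewrite exact.
  by split=> [->|[w ->]]; [exists 0; rewrite mul0mx|rewrite [w]thinmx0 mul0mx].
exists x0; split; last by rewrite -er2 /graded_dim -e0 -e1 -e2 er0 er1; lia.
apply: (qdim_map (phi := fun p : S => const_mx p : krow K 1) _ _ (sg 0%N) _ _ dx0).
- by move=> a u v; apply/rowP => j; rewrite krowE !mxE.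
- by move=> v hv j; rewrite (shift0 j) mxE.
- by move=> v hv; rewrite jacobian_image.
- move=> v hv; exists (v 0 0); first by have := hv 0; rewrite shift0.
  by exists 0; rewrite mul0mx; apply/matrixP => i j; rewrite !mxE !ord1 subrr.
Qed.

End Resolution.

(** * Smooth curves *)

(* Depth sensitivity of the Koszul complex of (g0, g1, g2): with c = a x p one
   has x a = g x c, and regularity of (x, y, z) lets one correct c by a multiple
   of g to make it divisible by x. *)
Lemma koszul_syzygy (A : comNzRingType) (x y z g0 g1 g2 p0 p1 p2 q0 q1 q2 r0 r1 r2 a0 a1 a2 : A) :
    x = p0 * g0 + p1 * g1 + p2 * g2 -> y = q0 * g0 + q1 * g1 + q2 * g2 ->
    z = r0 * g0 + r1 * g1 + r2 * g2 ->
    (forall u, x * u = 0 -> u = 0) ->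
    (forall u v, y * u = x * v -> exists u', u = x * u') ->
    (forall u v w, z * u = x * v + y * w -> exists v' w', u = x * v' + y * w') ->
    a0 * g0 + a1 * g1 + a2 * g2 = 0 ->
  exists w0 w1 w2, [/\ a0 = g1 * w2 - g2 * w1, a1 = g2 * w0 - g0 * w2 & a2 = g0 * w1 - g1 * w0].
Proof.
move=> ex ey ez reg1 reg2 reg3 ag.
pose c0 := a1 * p2 - a2 * p1; pose c1 := a2 * p0 - a0 * p2; pose c2 := a0 * p1 - a1 * p0.
have xa0 : x * a0 = g1 * c2 - g2 * c1.
  have -> : x * a0 = g1 * c2 - g2 * c1 + p0 * (a0 * g0 + a1 * g1 + a2 * g2) by rewrite ex /c1
      /c2; ring.
  by rewrite ag mulr0 addr0.
have xa1 : x * a1 = g2 * c0 - g0 * c2.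
  have -> : x * a1 = g2 * c0 - g0 * c2 + p1 * (a0 * g0 + a1 * g1 + a2 * g2) by rewrite ex /c0
      /c2; ring.
  by rewrite ag mulr0 addr0.
have xa2 : x * a2 = g0 * c1 - g1 * c0.
  have -> : x * a2 = g0 * c1 - g1 * c0 + p2 * (a0 * g0 + a1 * g1 + a2 * g2) by rewrite ex /c0
      /c1; ring.
  by rewrite ag mulr0 addr0.
(* With s = q . c and b = q x a, expanding q x (g x c) gives y c = s g - x b. *)
pose s := q0 * c0 + q1 * c1 + q2 * c2.
pose b0 := q1 * a2 - q2 * a1; pose b1 := q2 * a0 - q0 * a2; pose b2 := q0 * a1 - q1 * a0.
have yc0 : y * c0 = s * g0 - x * b0.
  have -> : s * g0 - x * b0 = s * g0 - (q1 * (x * a2) - q2 * (x * a1)) by rewrite /b0; ring.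
  by rewrite xa1 xa2 ey /s; ring.
have yc1 : y * c1 = s * g1 - x * b1.
  have -> : s * g1 - x * b1 = s * g1 - (q2 * (x * a0) - q0 * (x * a2)) by rewrite /b1; ring.
  by rewrite xa0 xa2 ey /s; ring.
have yc2 : y * c2 = s * g2 - x * b2.
  have -> : s * g2 - x * b2 = s * g2 - (q0 * (x * a1) - q1 * (x * a0)) by rewrite /b2; ring.
  by rewrite xa0 xa1 ey /s; ring.
(* Pairing the last identity with r puts z s into (x, y), hence also s; this yields the multiple s2
   g to be subtracted from c. *)
have [s1 [s2 es]] : exists s1 s2, s = x * s1 + y * s2.
  apply: (reg3 s (r0 * b0 + r1 * b1 + r2 * b2) (r0 * c0 + r1 * c1 + r2 * c2)).
  have -> : y * (r0 * c0 + r1 * c1 + r2 * c2) = r0 * (y * c0) + r1 * (y * c1) + r2 * (y * c2) by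
      ring.
  by rewrite yc0 yc1 yc2 ez; ring.
have div c g b : y * c = s * g - x * b -> exists w, c - s2 * g = x * w.
  move=> e; apply: (reg2 _ (s1 * g - b)).
  have -> : y * (c - s2 * g) = y * c - y * s2 * g by ring.
  by rewrite e es; ring.
have [w0 e0] := div _ _ _ yc0; have [w1 e1] := div _ _ _ yc1; have [w2 e2] := div _ _ _ yc2.
have [f0 [f1 f2]] : [/\ c0 = s2 * g0 + x * w0, c1 = s2 * g1 + x * w1 & c2 = s2 * g2 + x * w2] :>
    Prop.
  by split; [rewrite -e0|rewrite -e1|rewrite -e2]; ring.
exists w0, w1, w2; split; apply/eqP; rewrite -subr_eq0; apply/eqP/reg1; rewrite mulrBr.
- by rewrite xa0 f1 f2; ring.
- by rewrite xa1 f0 f2; ring.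
- by rewrite xa2 f0 f1; ring.
Qed.

(** * Powers of the variables form a regular sequence *)

Section MonomialRegularity.
Variables (n N : nat) (K : fieldType).
Local Notation S := {mpoly K[n]}.
Implicit Types (u v : S) (T : seq 'I_n).

(* Membership in the ideal generated by the X_j^N for j in T. *)
Definition power_ideal T u : Prop := forall m : 'X_{1..n}, (forall j, j \in T -> m j < N)%N ->
    u@_m = 0.

Lemma power_idealD T u v : power_ideal T u -> power_ideal T v -> power_ideal T (u + v).
Proof. by move=> hu hv m hm; rewrite mcoeffD hu ?hv ?addr0. Qed.

Lemma mcoeff_mulXn j u (m : 'X_{1..n}) : (m j < N)%N -> ('X_j ^+ N * u)@_m = 0.
Proof.
move=> mj; elim/mpolyind: u => [|c k p _ _ IH]; first by rewrite mulr0 mcoeff0.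
rewrite mulrDr mcoeffD IH addr0 -scalerAr mcoeffZ mpolyXn -mpolyXD mcoeffX.
case: eqP => [e|_]; last by rewrite mulr0.
by move: mj; rewrite -e mnmDE mulmnE mnm1E eqxx mul1n ltnNge leq_addr.
Qed.

Lemma power_ideal_gen T j u : j \in T -> power_ideal T ('X_j ^+ N * u).
Proof. by move=> jT m hm; apply: mcoeff_mulXn; exact: hm. Qed.

(** Membership constrains only the exponents of variables in T, which multiplication by X_l^N leaves
    unchanged. *)
Lemma power_ideal_regular T l u : l \notin T -> power_ideal T ('X_l ^+ N * u) -> power_ideal T u.
Proof.
move=> lT h m hm; rewrite -(mcoeffMX u (U_(l) *+ N)%MM) -mpolyXn mulrC; apply: h => j jT.
rewrite mnmDE mulmnE mnm1E (_ : (l == j) = false) ?hm //.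
by apply: contraNF lT => /eqP ->.
Qed.

Lemma power_ideal1 j u : power_ideal [:: j] u -> exists v, u = 'X_j ^+ N * v.
Proof.
move=> hu; rewrite [u]mpolyE big_seq.
apply: (big_ind (fun p => exists v, p = 'X_j ^+ N * v)).
- by exists 0; rewrite mulr0.
- by move=> _ _ [v ->] [w ->]; exists (v + w); rewrite mulrDr.
move=> m hm; have mj : (N <= m j)%N.
  rewrite leqNgt; apply/negP => mj; move: hm; rewrite mcoeff_msupp hu ?eqxx // => k.
  by rewrite inE => /eqP ->.
exists (u@_m *: 'X_[m - U_(j) *+ N]); rewrite -scalerAr mpolyXn -mpolyXD addmC submK //.
by apply/mnm_lepP => k; rewrite mulmnE mnm1E; case: eqP => [<-|_]; rewrite ?mul1n.
Qed.

Lemma power_ideal2 i j u : power_ideal [:: i; j] u -> exists v w, u = 'X_i ^+ N * v + 'X_j ^+ N * w.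
Proof.
move=> hu; rewrite [u]mpolyE big_seq.
apply: (big_ind (fun p => exists v w, p = 'X_i ^+ N * v + 'X_j ^+ N * w)).
- by exists 0, 0; rewrite !mulr0 addr0.
- by move=> _ _ [v [w ->]] [v' [w' ->]]; exists (v + v'), (w + w'); rewrite !mulrDr addrACA.
have key k (m : 'X_{1..n}) : (N <= m k)%N -> u@_m *: 'X_[m] = 'X_k ^+ N * (u@_m *: 'X_[m - U_(k)
    *+ N]).
  move=> mk; rewrite -scalerAr mpolyXn -mpolyXD addmC submK //.
  by apply/mnm_lepP => l; rewrite mulmnE mnm1E; case: eqP => [<-|_]; rewrite ?mul1n.
move=> m hm; have [mi|mi] := leqP N (m i).
  by exists (u@_m *: 'X_[m - U_(i) *+ N]), 0; rewrite mulr0 addr0; exact: key.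
have [mj|mj] := leqP N (m j).
  by exists 0, (u@_m *: 'X_[m - U_(j) *+ N]); rewrite mulr0 add0r; exact: key.
exfalso; move: hm; rewrite mcoeff_msupp hu ?eqxx // => k.
by rewrite !inE => /orP [] /eqP ->.
Qed.

End MonomialRegularity.

(** * Partial derivatives of a smooth form *)

Section Smooth.
Variable K : numClosedFieldType.
Local Notation S := {mpoly K[3]}.
Local Notation forms k := (fun s : S => s \is k.-homog).
Implicit Types (f g G H s : S) (p v : {ffun 'I_3 -> K}).

(** If neither G(X, 1, 0) nor G(1, X, 0) has a root, they are nonzero constants c and c'.
    Homogeneity gives c' = s^N c for every nonzero s, and s = 1 and s = 2 contradict each other. *)
Lemma form_has_zero N G : (0 < N)%N -> G \is N.-homog ->
  exists p, (exists i, p i != 0) /\ G.@[p] = 0.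
Proof.
move=> N0 hG; pose i0 := @Ordinal 3 0 isT; pose i1 := @Ordinal 3 1 isT.
pose vec (a b : K) : {ffun 'I_3 -> K} := [ffun i => if i == i0 then a else if i == i1 then b else
    0].
pose pvec (a b : {poly K}) (i : 'I_3) := if i == i0 then a else if i == i1 then b else 0.
have eval a b (s : K) : (mmap (@polyC K) (pvec a b) G).[s] = G.@[vec a.[s] b.[s]].
  rewrite /mmap -[LHS]/(horner_eval s _) rmorph_sum; apply: eq_bigr => m _.
  rewrite rmorphM /= /horner_eval hornerC; congr (_ * _).
  rewrite -[LHS]/(horner_eval s _) rmorph_prod; apply: eq_bigr => i _.
  rewrite rmorphXn /= /horner_eval /pvec ffunE; congr (_ ^+ _).
  by case: ifP => // _; case: ifP => // _; rewrite horner0.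
pose q := mmap (@polyC K) (pvec 'X 1) G; pose q' := mmap (@polyC K) (pvec 1 'X) G.
have [sq|] := eqVneq (size q) 1%N; last first.
  move=> /closed_rootP [a /rootP]; rewrite eval hornerX hornerC => h; exists (vec a 1); split=> //.
  by exists i1; rewrite ffunE /= oner_neq0.
have [sq'|] := eqVneq (size q') 1%N; last first.
  move=> /closed_rootP [a /rootP]; rewrite eval hornerX hornerC => h; exists (vec 1 a); split=> //.
  by exists i0; rewrite ffunE /= oner_neq0.
have /size_poly1P [c c0 ec] : size q == 1%N by rewrite sq.
have /size_poly1P [c' c'0 ec'] : size q' == 1%N by rewrite sq'.
have val (s : K) : s != 0 -> c' = s ^+ N * c.
  move=> s0; rewrite -(hornerC c' s) -ec' -(hornerC c s^-1) -ec !eval !hornerX !hornerC.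
  apply: meval_homog_scale => // i; rewrite !ffunE.
  by case: ifP => [_|_]; [rewrite mulfV|case: ifP => _; rewrite ?mulr1 ?mulr0].
have := val 1 (oner_neq0 _); rewrite expr1n mul1r => cc.
have two0 : (2 : K) != 0 by rewrite pnatr_eq0.
have /eqP : (2 ^ N)%:R = 1%:R :> K by apply: (mulIf c0); rewrite natrX mul1r -(val 2 two0) cc.
by rewrite eqr_nat => /eqP e; move: N0; rewrite -(ltn_exp2l 0 N (isT : 1 < 2)%N) e.
Qed.

Lemma smooth_no_square f : smooth_curve f -> no_square f.
Proof.
move=> sm N G H N0 hG e; have [p [p0 Gp]] := form_has_zero N0 hG.
apply: (sm p); split=> //; first by rewrite e expr2 !mevalM Gp !mul0r.
move=> i; rewrite e expr2 !mderivM !(mevalM, mevalD) Gp; ring.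
Qed.

Lemma smooth_neq0 f : smooth_curve f -> f != 0.
Proof.
move=> sm; apply/eqP => f0; apply: (sm [ffun=> 1]); split.
- by exists ord0; rewrite ffunE oner_neq0.
- by rewrite f0 meval0.
- by move=> i; rewrite f0 mderiv0 meval0.
Qed.

Lemma smooth_powers f d : (0 < d)%N -> f \is d.-homog -> smooth_curve f ->
  exists N, forall i, jacobian_ideal f ('X_i ^+ N).
Proof.
move=> d0 hf sm.
have ef := no_square_eliminants d0 hf (smooth_neq0 sm) (smooth_no_square sm).
have [||k0 hk0] := forms_in_ideal_of_no_zero ef (jacobian_is_ideal f).
- by [].
- move=> v v0; apply: contrapT => h; apply: (sm v); apply: (singularP d0 hf v0) => i.
  apply: contrapT => /eqP hi; apply: h; exists d.-1, f^`M(i); split=> //;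
      first exact: dhomog_mderiv.
  exact: jacobian_deriv.
by exists k0 => i; apply: (hk0 k0) => //; exact: dhomog_varX.
Qed.

(** The partial derivatives generate powers of the variables, so every syzygy comes from Koszul
    ones, whose components in degrees below d - 1 vanish. *)
Lemma smooth_syzygy f d k (a : 'I_3 -> S) : (0 < d)%N -> f \is d.-homog -> smooth_curve f ->
  (k < d.-1)%N -> (forall i, a i \is k.-homog) -> \sum_(i < 3) a i * f^`M(i) = 0 ->
  forall i, a i = 0.
Proof.
move=> d0 hf sm kd ha; have [N hN] := smooth_powers d0 hf sm.
pose i0 := @Ordinal 3 0 isT; pose i1 := @Ordinal 3 1 isT; pose i2 := @Ordinal 3 2 isT.
have sum3 (F : 'I_3 -> S) : \sum_i F i = F i0 + F i1 + F i2.
  rewrite !big_ord_recl big_ord0 addr0 addrA.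
  by congr (F _ + F _ + F _); apply/val_inj.
have [p hp] := hN i0; have [q hq] := hN i1; have [r hr] := hN i2.
rewrite sum3 in hp; rewrite sum3 in hq; rewrite sum3 in hr; rewrite sum3 => ag.
have xN0 : 'X_i0 ^+ N != 0 :> S by rewrite expf_neq0 // -msize_poly_eq0 msizeX.
have [u|u v e|u v w e|w0 [w1 [w2 [e0 e1 e2]]]] := koszul_syzygy hp hq hr _ _ _ ag.
- by move=> /eqP; rewrite mulf_eq0 (negPf xN0) => /eqP.
- apply: power_ideal1; apply: (power_ideal_regular (l := i1)) => //.
  by rewrite e; exact: power_ideal_gen.
- apply: power_ideal2; apply: (power_ideal_regular (l := i2)) => //.
  by rewrite e; apply: power_idealD; exact: power_ideal_gen.
have hd j := dhomog_mderiv j hf.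
have van j l (u v : S) : pihomog mdeg k (f^`M(j) * u - f^`M(l) * v) = 0.
  by rewrite pihomogB !(pihomogM_lt _ (hd _)) // subr0.
move=> i; rewrite -(pihomog_dE (ha i)).
have : [\/ i = i0, i = i1 | i = i2].
  by case: i => [[|[|[|i]]] hi] //; [apply: Or31|apply: Or32|apply: Or33]; exact: val_inj.
by case=> ->; [rewrite e0|rewrite e1|rewrite e2]; exact: van.
Qed.

End Smooth.

(** * Last map of the resolution *)

Lemma hdim_eq0 z : z < 0 -> hdim z = 0%N.
Proof. by case: z. Qed.

(** Both sides vanish at -1 and -2; this carries the Hilbert polynomial down to the stability
    threshold. *)
Lemma hdim_poly z : -2 <= z -> 2 * (hdim z)%:Z = (z + 1) * (z + 2).
Proof.
case: z => k; last by case: k => [|[|k]].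
move=> _; rewrite /hdim; have := mul_bin_diag k.+2 1; rewrite bin1.
by move: ('C(k.+2, 2)) => c; lia.
Qed.

(* If the entry w_j0 vanishes, then a M_j1 = - b M_j2, where a and b are the
   other two entries, and the syzygies (M_j2i, - M_j1i) of these two rows give
   M_j1 = - b s and M_j2 = a s for a third element s of the kernel of g; writing
   s in terms of the rows of M shows that the entries of w are not all in the
   maximal ideal. *)
Lemma last_map_entry_neq0 (K : fieldType) n p (M : 'M[{mpoly K[3]}]_(3, n)) (w : 'rV[{mpoly
    K[3]}]_3)
    (g : 'M[{mpoly K[3]}]_(n, p)) :
    (forall u : 'rV_n, u *m g = 0 <-> exists v, u = v *m M) ->
    (forall u : 'rV_3, u *m M = 0 <-> exists a : 'rV_1, u = a *m w) ->
    w != 0 -> (forall j, (w 0 j)@_0%MM = 0) ->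
  forall j, w 0 j != 0.
Proof.
move=> exg exM w0 wc j0; apply/eqP => wj0.
have [j1 [j2 [j12 j10 j20 all_j]]] := two_other_indices j0.
pose a := w 0 j1; pose b := w 0 j2.
have ab : (a != 0) || (b != 0).
  apply: contra_neqT w0; rewrite negb_or !negbK => /andP [/eqP a0 /eqP b0].
  by apply/rowP => j; rewrite mxE; have /or3P [] := all_j j => /eqP ->.
have wM : a *: row j1 M + b *: row j2 M = 0.
  have : w *m M = 0 by apply/exM; exists 1%:M; rewrite mul1mx.
  rewrite mulmx_sum_row (bigD1 j1) //= (bigD1 j2) ?(eq_sym j2) //= big1 ?addr0 // => j.
  move=> /andP [h1 h2]; have /or3P [/eqP e|/eqP e|/eqP ->] := all_j j.
  - by rewrite e eqxx in h1.
  - by rewrite e eqxx in h2.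
  - by rewrite wj0 scale0r.
have wMi l : a * M j1 l + b * M j2 l = 0.
  by have /rowP/(_ l) := wM; rewrite !mxE.
have minor i l : M j2 i * M j1 l - M j1 i * M j2 l = 0.
  case/orP: ab => c0; apply: (mulfI c0); rewrite mulr0.
    have -> : a * (M j2 i * M j1 l - M j1 i * M j2 l) =
      M j2 i * (a * M j1 l + b * M j2 l) - M j2 l * (a * M j1 i + b * M j2 i) by ring.
    by rewrite !wMi !mulr0 subrr.
  have -> : b * (M j2 i * M j1 l - M j1 i * M j2 l) =
    M j1 l * (a * M j1 i + b * M j2 i) - M j1 i * (a * M j1 l + b * M j2 l) by ring.
  by rewrite !wMi !mulr0 subrr.
have /choice [s hs] : forall i, exists s, M j2 i = s * a /\ - M j1 i = s * b.
  move=> i; pose u : 'rV_3 := M j2 i *: delta_mx 0 j1 - M j1 i *: delta_mx 0 j2.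
  have /exM [c ec] : u *m M = 0.
    rewrite mulmxBl -!scalemxAl -!rowE; apply/rowP => l; rewrite !mxE; exact: minor.
  exists (c 0 0); have ej j : u 0 j = c 0 0 * w 0 j by rewrite ec mxE big_ord1.
  split.
    by rewrite -(ej j1) !mxE !eqxx /= (negPf j12) mulr1 mulr0 subr0.
  by rewrite -(ej j2) !mxE !eqxx /= eq_sym (negPf j12) mulr1 mulr0 sub0r.
pose sv : 'rV_n := \row_i s i.
have rowg j : row j M *m g = 0.
  by apply/exg; exists (delta_mx 0 j); rewrite rowE.
have e2 : row j2 M = a *: sv by apply/rowP => i; rewrite !mxE (hs i).1 mulrC.
have e1 : row j1 M = - b *: sv.
  by apply/rowP => i; rewrite !mxE -[LHS]opprK (hs i).2 mulNr mulrC.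
have /exg [v ev] : sv *m g = 0.
  case/orP: ab => c0.
    have := rowg j2; rewrite e2 -scalemxAl => /eqP; rewrite scalemx_eq0 (negPf c0) => /eqP //.
  have := rowg j1; rewrite e1 -scalemxAl => /eqP; rewrite scalemx_eq0 oppr_eq0 (negPf c0) => /eqP
      //.
have wjc j t : (t * w 0 j)@_0%MM = 0.
  by rewrite -[LHS]/(mcoeff 0%MM (t * w 0 j)) rmorphM /= wc mulr0.
(* Thus e_j2 - a v is a multiple of w. Its entry at j2 has constant term 1, whereas neither a nor w
   has constant terms. *)
have /exM [t et] : (delta_mx 0 j2 - a *: v) *m M = 0.
  by rewrite mulmxBl -rowE -scalemxAl e2 ev subrr.
have /rowP/(_ j2) := et; rewrite [RHS]mxE big_ord1 => /(congr1 (mcoeff 0%MM)).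
rewrite wjc !mxE !eqxx mcoeffB mcoeff1 eqxx [a * _]mulrC wjc subr0 => /eqP.
by rewrite oner_eq0.
Qed.

Section LastMap.
Variables (K : numClosedFieldType) (f : {mpoly K[3]}) (d d1 d2 d3 : nat) (e : int).
Local Notation S := {mpoly K[3]}.
Local Notation B := [:: [:: 0];
        [:: d%:Z - 1; d%:Z - 1; d%:Z - 1];
        [:: d%:Z - 1 + d1%:Z; d%:Z - 1 + d2%:Z; d%:Z - 1 + d3%:Z];
        [:: e]].

Lemma homogz_pos z (p : S) : homogz z p -> p != 0 -> p@_0%MM = 0 -> 0 < z.
Proof.
case: z => [[|k]|k] //=; last by move=> ->; rewrite eqxx.
by move=> /dhomog_const e0 p0 c0; rewrite e0 c0 mpolyC0 eqxx in p0.
Qed.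

Lemma last_shift_gt : has_min_free_resolution (jacobian_ideal f) B ->
  [/\ d%:Z - 1 + d1%:Z < e, d%:Z - 1 + d2%:Z < e & d%:Z - 1 + d3%:Z < e].
Proof.
move=> [eps [phi res]]; have [_ _ _ exact minc] := res.
pose w : 'rV[S]_3 := phi 2%N; pose M : 'M[S]_3 := phi 1%N; pose g : 'M[S]_(3, 1) := phi 0%N.
have w0 : w != 0.
  (* If the last map were zero, 1 would lie in its kernel, which is the image of the zero module. *)
  apply/eqP => w0; have /(exact 2%N) [v] : (1%:M : 'rV[S]_(rk B 3)) *m phi 2%N = 0.
    by rewrite -/w w0 mulmx0.
  rewrite [v]thinmx0 mul0mx => /matrixP/(_ 0 0); rewrite !mxE eqxx => /eqP.
  by rewrite oner_eq0.
have wn := @last_map_entry_neq0 _ _ _ M w g (exact 0%N) (exact 1%N) w0 (minc 2%N 0).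
have pos (j : 'I_(rk B 2)) : 0 < e - shift B 2 j.
  by apply: homogz_pos (wn j) (minc 2%N 0 j); exact: (resolution_homogeneous res (i := 2) 0 j).
have := pos (@Ordinal 3 0 isT); have := pos (@Ordinal 3 1 isT); have := pos (@Ordinal 3 2 isT).
by rewrite !subr_gt0.
Qed.

End LastMap.

(** * Numerical invariants *)

Lemma bounded_affine (a c C k0 : int) :
  (forall k, k0 <= k -> 0 <= 2 * k * a + c <= C) -> a = 0.
Proof.
move=> h; apply/eqP; rewrite eq_le !leNgt; apply/andP; split; apply/negP => a0.
  have /andP [_] := h (`|k0| + `|c| + `|C| + 1) ltac:(lia).
  have : `|k0| + `|c| + `|C| + 1 <= (`|k0| + `|c| + `|C| + 1) * a by nia.
  lia.
have /andP [+ _] := h (`|k0| + `|c| + `|C| + 1) ltac:(lia).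
have : (`|k0| + `|c| + `|C| + 1) * a <= - (`|k0| + `|c| + `|C| + 1) by nia.
lia.
Qed.

(** For m = d - 1 this is the formula for tau with all exponents at least d - 1; hence a positive
    tau forces d1 < d - 1. *)
Lemma tau_nonpositive (m a b c : int) : 0 <= m -> m <= a -> m <= b -> m <= c ->
  m * (a + b + c) - (a * b + a * c + b * c) <= 0.
Proof.
move=> m0 ma mb mc.
have -> : m * (a + b + c) - (a * b + a * c + b * c) = - ((a - m) * b + (b - m) * c + (c - m) * a)
    by ring.
by rewrite oppr_le0 !addr_ge0 // mulr_ge0 ?subr_ge0 // (le_trans m0).
Qed.

Section Milnor.
Variable K : numClosedFieldType.
Local Notation S := {mpoly K[3]}.
Local Notation forms k := (fun s : S => s \is k.-homog).
Implicit Types f : S.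

Lemma milnor_dimE f k n : milnor_dim f k n <-> qdim (forms k) (jacobian_ideal f) n.
Proof.
rewrite (qdim_basis n (subspace_homog 3 K k) (subspace_jacobian f)).
have E (b : 'I_n -> S) (c : {ffun 'I_n -> K}) : \sum_i (c i)%:MP * b i = \sum_i c i *: b i.
  by apply: eq_bigr => i _; rewrite mul_mpolyC.
split=> [[b hb hc]|[b hb hc]]; exists b => // v hv; have [c [h1 h2]] := hc v hv; exists c; split.
- by rewrite -E.
- by move=> c' hc'; apply: h2; rewrite E.
- by rewrite E.
- by move=> c' hc'; apply: h2; rewrite -E.
Qed.

Lemma milnor_dim_uniq f k n n' : milnor_dim f k n -> milnor_dim f k n' -> n = n'.
Proof. by move=> /milnor_dimE h /milnor_dimE; exact: qdim_uniq (subspace_homog 3 K k) h. Qed.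

Lemma squarefree_no_square f : squarefree f -> no_square f.
Proof.
move=> sq N G H N0 hG /sq u; have G0 : G != 0 by apply: contraTneq u => ->; rewrite unitr0.
have := hG; rewrite -[G]mulr1; move: u => /mulrV GV.
have hV : G * G^-1 \is 0.-homog by rewrite GV -(expr0 ('X_ord0)); exact: dhomog_varX.
have := pihomogM_lt (k := 0) G^-1 hG N0; rewrite (pihomog_dE hV) GV => /eqP.
by rewrite oner_eq0.
Qed.

Lemma squarefree_neq0 f : squarefree f -> f != 0.
Proof.
move=> sq; apply/eqP => f0; have := sq 0 0; rewrite mulr0 => /(_ f0).
by rewrite unitr0.
Qed.

(** In degrees below 2(d - 1) a relation between the partial derivatives has coefficients of degree
    below d - 1, so it is trivial. *)
Lemma smooth_hilbert f d k : (0 < d)%N -> f \is d.-homog -> smooth_curve f ->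
    (k < d.-1 + d.-1)%N ->
  exists n, milnor_dim f k n /\ (n + 3 * hdim (k%:Z - d.-1%:Z) = hdim k)%N.
Proof.
move=> d0 hf sm kd; pose g : 'M[S]_(3, 1) := \col_i f^`M(i).
pose a := fun _ : 'I_3 => d.-1%:Z; pose b := fun _ : 'I_1 => 0 : int.
have kb j : k%:Z - b j = k%:Z by rewrite subr0.
have hg j l : homogz (a j - b l) (g j l).
  by rewrite /a /b subr0 mxE; exact: dhomog_mderiv.
have [r [x [dx e dr]]] := graded_rank k hg.
have sa := @subspace_graded K _ a k; have sb := @subspace_graded K _ b k.
have er : r = (\sum_(j < 3) hdim (k%:Z - a j))%N.
  apply: (qdim_uniq sa dr); apply: qdim_eq (qdim_graded K _ _) => v hv.
  split=> [->|/rowP/(_ 0)]; first by rewrite mul0mx.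
  rewrite !mxE => vg; apply/rowP => j; rewrite mxE.
  have [dk|kd'] := leqP d.-1 k; last first.
    by have := hv j; rewrite /a (_ : (k%:Z - d.-1%:Z) = Negz (d.-1 - k).-1) //; lia.
  have ha i : v 0 i \is (k - d.-1).-homog.
    by have := hv i; rewrite /a subzn.
  apply: (smooth_syzygy d0 hf sm _ ha); first by lia.
  by rewrite -[RHS]vg; apply: eq_bigr => i _; rewrite mxE.
exists x; split; last first.
  rewrite er /a /b sum_nat_const card_ord in e.
  by rewrite e big_ord1 subr0.
apply/milnor_dimE; apply: (qdim_map (phi := fun p : S => const_mx p : krow K 1) _ _ sb _ _ dx).
- by move=> y u v; apply/rowP => j; rewrite krowE !mxE.
- by move=> v hv j; rewrite kb mxE.
- move=> v hv; split=> [[w /rowP/(_ 0)]|[c ->]].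
    by rewrite !mxE => ->; exists (fun i => w 0 i); apply: eq_bigr => i _; rewrite mxE.
  by exists (\row_i c i); apply/rowP => j; rewrite !mxE; apply: eq_bigr => i _; rewrite !mxE.
- move=> v hv; exists (v 0 0); first by have := hv 0; rewrite kb.
  by exists 0; rewrite mul0mx; apply/rowP => j; rewrite !mxE !ord1 subrr.
Qed.

Lemma resolution_hilbert f d d1 d2 d3 e : (1 < d)%N -> f \is d.-homog ->
    has_min_free_resolution (jacobian_ideal f)
      [:: [:: 0];
          [:: d%:Z - 1; d%:Z - 1; d%:Z - 1];
          [:: d%:Z - 1 + d1%:Z; d%:Z - 1 + d2%:Z; d%:Z - 1 + d3%:Z];
          [:: e]] ->
  forall k : nat, exists n, milnor_dim f k n /\
    (n + 3 * hdim (k%:Z - (d%:Z - 1)) + hdim (k%:Z - e) =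
     hdim k + (hdim (k%:Z - (d%:Z - 1 + d1%:Z)) + hdim (k%:Z - (d%:Z - 1 + d2%:Z)) +
               hdim (k%:Z - (d%:Z - 1 + d3%:Z))))%N.
Proof.
move=> d_gt1 hf [eps [phi res]] k; have [n [dn en]] := milnor_hilbert d_gt1 hf res k.
exists n; split; first exact/milnor_dimE.
move: en; rewrite /graded_dim /rk /= !big_ord_recl !big_ord0 /shift /= !addn0.
move: (hdim _) (hdim _) (hdim _) (hdim _) (hdim _) 'C(_, _) => x1 x2 x3 x4 x5 x6; lia.
Qed.

Lemma singular_milnor_dim_gt0 f p k : singular_point f p -> ~ milnor_dim f k 0.
Proof.
move=> sp /milnor_dimE [pi [_ _ h]]; have [[i pi0] _ _] := sp.
have : jacobian_ideal f ('X_i ^+ k).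
  by apply/h; [exact: dhomog_varX|rewrite [LHS]thinmx0].
move=> /(jacobian_singular sp) /eqP; rewrite rmorphXn /= mevalXU expf_eq0 (negPf pi0).
by rewrite andbF.
Qed.

End Milnor.

Theorem proposition2p1 (R : realType) (d : nat) (f : {mpoly R[i][3]})
    (d1 d2 d3 : nat) (e : int) :
  (3 <= d)%N ->
  f \is d.-homog ->
  squarefree f ->
  syzygy_curve f [:: d1; d2; d3] ->
  has_min_free_resolution (jacobian_ideal f)
    [:: [:: 0];
        [:: d%:Z - 1; d%:Z - 1; d%:Z - 1];
        [:: d%:Z - 1 + d1%:Z; d%:Z - 1 + d2%:Z; d%:Z - 1 + d3%:Z];
        [:: e]] ->
  [/\ e = (d1 + d2 + d3)%:Z /\ (d <= d1 + d2)%N,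
      ~ smooth_curve f -> coincidence_threshold d f (d - 2 + d1)%N,
      exists st reg,
        [/\ stability_threshold f st, is_regularity (jacobian_ideal f) reg,
            st%:Z = reg + 1 & reg + 1 = (d1 + d2 + d3)%:Z - 2]
    & exists2 tau, total_tjurina f tau &
        tau%:Z = (d%:Z - 1) * (d1 + d2 + d3)%:Z
                 - (d1 * d2 + d1 * d3 + d2 * d3)%:Z].
Proof.
move=> d3le hf sqf [/= /and3P [d12 d23 _] _] res.
have d_gt1 : (1 < d)%N by lia.
have d_gt0 : (0 < d)%N by lia.
have ef := no_square_eliminants d_gt0 hf (squarefree_neq0 sqf) (squarefree_no_square sqf).
have [C bound] := milnor_dim_bounded ef.
have hilb := resolution_hilbert d_gt1 hf res.
have [lt1 lt2 lt3] := last_shift_gt res.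
(* This is twice the constant term of the Hilbert polynomial; doubling avoids the halves in the
   binomial coefficients. *)
pose c := 2 - 3 * (d%:Z - 2) * (d%:Z - 3) + (d%:Z + d1%:Z - 2) * (d%:Z + d1%:Z - 3) +
  (d%:Z + d2%:Z - 2) * (d%:Z + d2%:Z - 3) + (d%:Z + d3%:Z - 2) * (d%:Z + d3%:Z - 3) - (e - 1) *
      (e - 2).
(* The last summand measures where [hdim] of k - e leaves its polynomial: at k = e - 3 it is 2. The
   other arguments are still at least -2 there, because e > d - 1 + d_j. *)
have hilb_poly3 (k n : nat) : e - 3 <= k%:Z -> milnor_dim f k n ->
    2 * n%:Z = 2 * k%:Z * (e - (d1 + d2 + d3)%:Z) + c +
      ((k%:Z - e + 1) * (k%:Z - e + 2) - 2 * (hdim (k%:Z - e))%:Z).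
  move=> ek dn; have [n' [/(milnor_dim_uniq dn) <- en]] := hilb k.
  have p0 := @hdim_poly k%:Z ltac:(lia).
  have p1 := @hdim_poly (k%:Z - (d%:Z - 1)) ltac:(lia).
  have p2 := @hdim_poly (k%:Z - (d%:Z - 1 + d1%:Z)) ltac:(lia).
  have p3 := @hdim_poly (k%:Z - (d%:Z - 1 + d2%:Z)) ltac:(lia).
  have p4 := @hdim_poly (k%:Z - (d%:Z - 1 + d3%:Z)) ltac:(lia).
  have enz := en.
  have -> : 2 * n%:Z = 2 * (hdim k)%:Z + 2 * (hdim (k%:Z - (d%:Z - 1 + d1%:Z)))%:Z
      + 2 * (hdim (k%:Z - (d%:Z - 1 + d2%:Z)))%:Z + 2 * (hdim (k%:Z - (d%:Z - 1 + d3%:Z)))%:Z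
      - 3 * (2 * (hdim (k%:Z - (d%:Z - 1)))%:Z) - 2 * (hdim (k%:Z - e))%:Z.
    move: enz; move: (hdim _) (hdim _) (hdim _) (hdim _) (hdim _) (hdim _) => h1 h2 h3 h4 h5 h6;
        lia.
  by rewrite p0 p1 p2 p3 p4 /c PoszD PoszD; ring.
have hilb_poly (k n : nat) : e - 2 <= k%:Z -> milnor_dim f k n ->
    2 * n%:Z = 2 * k%:Z * (e - (d1 + d2 + d3)%:Z) + c.
  move=> ek dn; rewrite (hilb_poly3 k n _ dn); last by lia.
  by rewrite hdim_poly ?subrr ?addr0 //; lia.
have eE : e = (d1 + d2 + d3)%:Z.
  apply/eqP; rewrite -subr_eq0; apply/eqP; apply: (@bounded_affine _ c (2 * C%:Z) (`|e|)) => k ek.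
  case: k ek => [k|k] ek; last by lia.
  have [n [dn _]] := hilb k; rewrite -(hilb_poly k n _ dn); last by lia.
  have := bound k n ((milnor_dimE _ _ _).1 dn); lia.
have hilb_const (k n : nat) : e - 2 <= k%:Z -> milnor_dim f k n -> 2 * n%:Z = c.
  by move=> ek dn; rewrite (hilb_poly k n ek dn) eE subrr mulr0 add0r.
have cE : c = 2 * ((d%:Z - 1) * (d1 + d2 + d3)%:Z - (d1 * d2 + d1 * d3 + d2 * d3)%:Z).
  by rewrite /c eE !PoszD !PoszM; ring.
have [st stE] : exists st : nat, st%:Z = e - 2 by exists `|e - 2|%N; lia.
have [tau [dtau _]] := hilb st.
have tauE : 2 * tau%:Z = c by apply: hilb_const dtau; lia.
have stable k : (st <= k)%N -> milnor_dim f k tau.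
  move=> sk; have [n [dn _]] := hilb k.
  have -> : tau = n; last exact: dn.
  have := hilb_const k n _ dn; lia.
have ttau : total_tjurina f tau.
  apply: (total_tjurina_stable d_gt0 hf ef (k0 := st) (C := C)) => [k sk|k n].
    exact/milnor_dimE/stable.
  exact: bound.
(* This is e > d - 1 + d3 after inserting the value of e. *)
have d12le : (d <= d1 + d2)%N by lia.
split.
- by [].
- move=> nsm fs hfs sfs.
  have [p sp] : exists p, singular_point f p.
    by apply: contrapT => /forallNP h; apply: nsm => p; exact: h.
  have tau0 : (0 < tau)%N.
    rewrite lt0n; apply/eqP => t0; apply: (singular_milnor_dim_gt0 (k := st) sp).
    by rewrite -t0; exact: stable.
  have dm : d.-1%:Z = d%:Z - 1 by lia.
  have d1lt : (d1 < d.-1)%N.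
    rewrite ltnNge; apply/negP => h1; move: tau0 tauE; rewrite cE !PoszD !PoszM.
    have := @tau_nonpositive (d%:Z - 1) d1%:Z d2%:Z d3%:Z ltac:(lia) ltac:(lia) ltac:(lia)
        ltac:(lia).
    by move=> h2 h3 h4; lia.
  split.
    (* Up to degree d - 2 + d1 only S and its three copies shifted by d - 1 contribute, for f as for
       [fs]; d1 < d - 1 keeps these degrees within the range of the smooth formula. *)
    move=> k hk; have [n [dn en]] := hilb k.
    have [|n' [dn' en']] := smooth_hilbert d_gt0 hfs sfs (k := k); first by lia.
    exists n; [exact: dn|have -> : n = n'; last exact: dn'].
    rewrite dm in en'; move: en; rewrite (@hdim_eq0 (k%:Z - e)); last by lia.
    rewrite (@hdim_eq0 (k%:Z - (d%:Z - 1 + d1%:Z))); last by lia.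
    rewrite (@hdim_eq0 (k%:Z - (d%:Z - 1 + d2%:Z))); last by lia.
    rewrite (@hdim_eq0 (k%:Z - (d%:Z - 1 + d3%:Z))); last by lia.
    by move: en'; move: (hdim _) (hdim _) => x y; lia.
  (* One degree further, the generator of degree d1 adds at least 1 on the side of f only. *)
  move=> q hq; rewrite leqNgt; apply/negP => lq; set k := (d - 2 + d1).+1 in lq *.
  have [n dn dn'] := hq k lq.
  have [n0 [/(milnor_dim_uniq dn) <- en]] := hilb k.
  have [|n1 [/(milnor_dim_uniq dn') <- en']] := smooth_hilbert d_gt0 hfs sfs (k := k);
      first by rewrite /k; lia.
  rewrite dm in en'; move: en; rewrite (@hdim_eq0 (k%:Z - e)); last by rewrite /k; lia.
  have -> : k%:Z - (d%:Z - 1 + d1%:Z) = 0 by rewrite /k; lia.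
  have -> : hdim 0 = 1%N by [].
  by move: en'; move: (hdim _) (hdim _) (hdim _) (hdim _) => x y z w; lia.
- exists st, (e - 3); split.
  + exists tau => //; split=> [k|q hq]; first exact: stable.
    (* In degree st - 1 = e - 3 the correction term makes the dimension tau + 1. *)
    rewrite leqNgt; apply/negP => qs.
    have [n [dn en]] := hilb (st - 1)%N.
    have qst : (q <= st - 1)%N by lia.
    have ntau := milnor_dim_uniq dn (hq (st - 1)%N qst).
    have := hilb_poly3 (st - 1)%N n ltac:(lia) dn.
    have -> : (st - 1)%N%:Z = e - 3 by lia.
    rewrite hdim_eq0; last by lia.
    by rewrite eE subrr mulr0 add0r -eE -tauE ntau; lia.
  + exists [:: [:: 0]; [:: d%:Z - 1; d%:Z - 1; d%:Z - 1];
        [:: d%:Z - 1 + d1%:Z; d%:Z - 1 + d2%:Z; d%:Z - 1 + d3%:Z]; [:: e]] => //.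
    (* The maximum is reached by the shift e in homological degree 3; the strict inequalities for e
       bound the contributions of homological degree 2. *)
    split; last by exists 3%N, 0%N.
    move=> [|[|[|[|i]]]] j; rewrite /rk /shift /=; last by rewrite nth_nil.
    * by case: j => //= _; lia.
    * by case: j => [|[|[|]]] //= _; lia.
    * by case: j => [|[|[|]]] //= _; lia.
    * by case: j => //= _; lia.
  + by lia.
  + by lia.
- by exists tau => //; lia.
Qed.
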